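(* (i) Let $f\colon Q(a,b)\subset\mathbb{CP}^2\to Q(c,e)\subset\mathbb{CP}^N$ (so $a+b=2$, $c+e=N$) be a monomial CR map with linearly independent components that is monomial-indecomposable. Then $\deg f\le 2N-3$. (ii) Let $f=(f_1,\dots,f_N)\colon\mathbb C^3\to\mathbb C^N$ be a polynomial map each of whose components is a single monomial $f_k(z)=c_kz^{\beta_k}$ ($c_k\in\mathbb C$, $\beta_k\in\mathbb N_0^3$), such that $\|f(z)\|=1$ whenever $\|z\|=1$ (i.e. $f$ maps $S^5$ into $S^{2N-1}$). Then $\deg f\le \frac{N-1}{2}$, where $\deg f$ is the maximal degree of a nonzero component. (iii) Let $n\ge2$. There is a number $C(n,N)$ depending only on $n$ and $N$ such that every monomial CR map $f\colon Q(a,b)\subset\mathbb{CP}^n\to Q(c,e)\subset\mathbb{CP}^N$ ($a+b=n$, $c+e=N$) with linearly independent components that is monomial-indecomposable satisfies $\deg f\le C(n,N)$.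
   Context: For integers $a\ge1$, $b\ge0$, the hyperquadric $Q(a,b)\subset\mathbb{CP}^{a+b}$ is the set of $[z_1:\dots:z_{a+b+1}]$ with $\sum_{k=1}^a|z_k|^2-\sum_{k=a+1}^{a+b+1}|z_k|^2=0$; $Q(n,0)$ is the sphere $S^{2n-1}$ (in the chart $z_{n+1}=1$). A monomial CR map $f\colon Q(a,b)\to Q(c,e)$ is given in homogeneous coordinates by $F=(F_1,\dots,F_{c+e+1})$ with $F_k(z)=C_kz^{\alpha_k}$, $C_k\in\mathbb C$, $\alpha_k\in\mathbb N_0^{a+b+1}$ all of the same length, not all $F_k\equiv0$, such that $\sum_{k=1}^c|F_k(z)|^2-\sum_{k=c+1}^{c+e+1}|F_k(z)|^2=0$ whenever $\sum_{k=1}^a|z_k|^2-\sum_{k=a+1}^{a+b+1}|z_k|^2=0$. $f$ has linearly independent components if $F_1,\dots,F_{c+e+1}$ are linearly independent polynomials. $f$ is monomial-decomposable if the index set $\{1,\dots,c+e+1\}$ can be partitioned into two nonempty sets $I_1,I_2$ such that for $i=1,2$, $\sum_{k\in I_i,k\le c}|F_k(z)|^2-\sum_{k\in I_i,k>c}|F_k(z)|^2=0$ whenever $\sum_{k=1}^a|z_k|^2-\sum_{k=a+1}^{a+b+1}|z_k|^2=0$ (i.e. $F=G\oplus H$ with $G,H$ monomial maps inducing CR maps into smaller hyperquadrics); otherwise $f$ is monomial-indecomposable. $\deg f$ is the common degree of the components of $F$ after dividing all of them by their greatest common monomial factor. *)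

(* Defs.v *)
From Stdlib Require Import Reals ZArith List Arith.
Open Scope R_scope.

Record CC := mkC { re : R ; im : R }.
Definition C0 : CC := mkC 0 0.
Definition C1 : CC := mkC 1 0.
Definition Cadd (x y : CC) : CC := mkC (re x + re y) (im x + im y).
Definition Cmul (x y : CC) : CC :=
  mkC (re x * re y - im x * im y) (re x * im y + im x * re y).
Fixpoint Cpow (x : CC) (m : nat) : CC :=
  match m with O => C1 | S m' => Cmul x (Cpow x m') end.
Definition Cnorm2 (x : CC) : R := re x * re x + im x * im x.
Definition Cnz (x : CC) : bool :=
  if Req_EM_T (re x) 0 then (if Req_EM_T (im x) 0 then false else true) else true.

Fixpoint Csum (n : nat) (g : nat -> CC) : CC :=
  match n with O => C0 | S m => Cadd (Csum m g) (g m) end.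
Fixpoint Cprod (n : nat) (g : nat -> CC) : CC :=
  match n with O => C1 | S m => Cmul (Cprod m g) (g m) end.
Fixpoint Rsum (n : nat) (g : nat -> R) : R :=
  match n with O => 0 | S m => Rsum m g + g m end.
Fixpoint nsum (n : nat) (g : nat -> nat) : nat :=
  match n with O => 0%nat | S m => (nsum m g + g m)%nat end.

Definition monomial (nv : nat) (c : CC) (alpha : nat -> nat) (z : nat -> CC) : CC :=
  Cmul c (Cprod nv (fun j => Cpow (z j) (alpha j))).

(* Q(p,q) in CP^{p+q}: homogeneous coordinates w_0..w_{p+q} (0-based);
   form  sum_{k<p} |w_k|^2 - sum_{p<=k<=p+q} |w_k|^2. *)
Definition hqform (p q : nat) (w : nat -> CC) : R :=
  Rsum p (fun k => Cnorm2 (w k)) - Rsum (S q) (fun k => Cnorm2 (w (p + k)%nat)).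

(* A monomial map Q(a,b) -> Q(c,e) is given by coefficients Cf k and
   exponent vectors A k (k = 0..c+e, variables j = 0..a+b). *)
Definition comp (a b : nat) (Cf : nat -> CC) (A : nat -> nat -> nat) (k : nat)
  (z : nat -> CC) : CC := monomial (S (a + b)) (Cf k) (A k) z.

Definition is_monomial_CR_map (a b c e : nat) (Cf : nat -> CC) (A : nat -> nat -> nat) : Prop :=
  (exists d, forall k, (k <= c + e)%nat -> nsum (S (a + b)) (A k) = d) /\
  (exists k z, (k <= c + e)%nat /\ comp a b Cf A k z <> C0) /\
  (forall z, hqform a b z = 0 -> hqform c e (fun k => comp a b Cf A k z) = 0).

Definition lin_indep_components (a b c e : nat) (Cf : nat -> CC) (A : nat -> nat -> nat) : Prop :=
  forall lam : nat -> CC,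
    (forall z, Csum (S (c + e)) (fun k => Cmul (lam k) (comp a b Cf A k z)) = C0) ->
    forall k, (k <= c + e)%nat -> lam k = C0.

Definition partial_form (a b c e : nat) (Cf : nat -> CC) (A : nat -> nat -> nat)
  (P : nat -> bool) (z : nat -> CC) : R :=
  Rsum (S (c + e)) (fun k =>
    if P k then (if (k <? c)%nat then Cnorm2 (comp a b Cf A k z)
                 else - Cnorm2 (comp a b Cf A k z))
    else 0).

Definition monomial_decomposable (a b c e : nat) (Cf : nat -> CC) (A : nat -> nat -> nat) : Prop :=
  exists P : nat -> bool,
    (exists k, (k <= c + e)%nat /\ P k = true) /\
    (exists k, (k <= c + e)%nat /\ P k = false) /\
    (forall z, hqform a b z = 0 ->
       partial_form a b c e Cf A P z = 0 /\
       partial_form a b c e Cf A (fun k => negb (P k)) z = 0).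

Definition nz_idx (K : nat) (Cf : nat -> CC) : list nat :=
  filter (fun k => Cnz (Cf k)) (seq 0 K).

Definition gcd_exp (K : nat) (Cf : nat -> CC) (A : nat -> nat -> nat) (j : nat) : nat :=
  match nz_idx K Cf with
  | nil => 0%nat
  | k0 :: r => fold_left (fun m k => Nat.min m (A k j)) r (A k0 j)
  end.

Definition mdeg (nv K : nat) (Cf : nat -> CC) (A : nat -> nat -> nat) : nat :=
  match nz_idx K Cf with
  | nil => 0%nat
  | k0 :: _ => nsum nv (fun j => (A k0 j - gcd_exp K Cf A j)%nat)
  end.

Definition deg_CR (a b c e : nat) (Cf : nat -> CC) (A : nat -> nat -> nat) : nat :=
  mdeg (S (a + b)) (S (c + e)) Cf A.

Definition maps_S5_to_sphere (N : nat) (c : nat -> CC) (B : nat -> nat -> nat) : Prop :=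
  forall z : nat -> CC,
    Rsum 3 (fun j => Cnorm2 (z j)) = 1 ->
    Rsum N (fun k => Cnorm2 (monomial 3 (c k) (B k) z)) = 1.

Definition poly_deg (N : nat) (c : nat -> CC) (B : nat -> nat -> nat) : nat :=
  fold_left Nat.max (map (fun k => nsum 3 (B k)) (nz_idx N c)) 0%nat.

(* Main.v *)
Require Import Defs.
From Stdlib Require Import Reals ZArith List Arith Lia Lra.
Open Scope R_scope.
From mathcomp Require all_boot all_order all_algebra Rstruct boolp zify ring lra.

(** With [X_j = |z_j|^2], all hypotheses become identities between real
    polynomials with nonnegative variables.

    For (i) and (iii), sort the variables into three classes, one of them being
    a full side of the source form. Along a suitable line in the cone of
    admissible [X], the components become [w_k x^(a_k) (1+x)^(m_k)], with
    [a_k + b_k + m_k = D]; they sum to zero and no proper subsum vanishes.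
    Sweep [m] downwards: at each step a row of coefficients is multiplied by
    [1+x] and the terms with [m_k = m] are added. By Descartes' rule of signs,
    the number of sign changes of the row, with signs chosen freely at its
    zeros, is not increased by the multiplication, and every added term creates
    at most two new changes. The last row vanishes, up to the terms of minimal
    [m_k], hence may be given almost [D] sign changes. This bounds
    [D - min a - min b - min m] by [2M - 5] for [M] terms. In (i) the three
    classes are the three variables; in (iii) one of the classes is a single
    variable, so that the range of its exponent is bounded.

    For (ii), let [s = x + y + z], and let [p_k] be the part of degree [k] of
    [|f|^2], so that [s^d] is the sum of the [p_k s^(d-k)]. Put [q_0 = 1 - p_0]
    and [q_(k+1) = s q_k - p_(k+1)], so [q_d = 0]. Cover the support of [q_k]
    by triangles of exponents, at a cost that generalizes the count above. By
    the argument above, applied to the groups of triangles on which [s q_k] is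
    divisible by [s], a cover of [s q_k] yields one of [q_k] that costs 4 less,
    while adding [n] monomials costs at most [2n]. Going from [q_d = 0] back to
    [q_0], every cover of which costs at least 2, gives [2N - 4d >= 2]. *)

(** The number of monomials of [q k] is not controlled by [N], so in (ii) supports are only enclosed
    in triangles. Setting [z = -(1 + x)], with [y = 1], turns divisibility by [x + y + z] into a
    vanishing sum as in (i), where the monomials [x^a] become polynomials supported on an interval
    of length [k]; hence the one-variable bound is proved for such terms, and (i) is the case
    [k = 0]. Groups of triangles whose hulls overlap are merged, since only for disjoint hulls do
    the quotients of different groups not interact. The one-variable bound improves by one for each
    contact of a term with a side of the hull. In (i) each of the three sides has two contacts, and
    6 - 1 = 5. In (ii) the contacts pay for the signs on the sides; the saving of 4 is one per side,
    because each side carries a nonzero coefficient, and one more because there is at least one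
    group. Positivity of [|f|^2] keeps the sides from moving outwards as [k] grows and keeps [q k]
    nonzero for [k < d]. *)

Module MonomialMaps.

Import all_boot all_order all_algebra Rstruct zify ring lra.
Set Implicit Arguments.
Unset Strict Implicit.
Unset Printing Implicit Defensive.
Import Order.TTheory GRing.Theory Num.Theory.
Local Open Scope ring_scope.

(** * Sign changes in the rows of a polynomial *)

(* [None] marks the positions outside [X]. *)
Definition labelling (F : realFieldType) (X : pred nat) (u : nat -> F)
  (l : nat -> option bool) :=
  forall p, [/\ (l p == None) = ~~ X p, X p -> 0 < u p -> l p = Some true
              & X p -> u p < 0 -> l p = Some false].

Definition nchange (l : nat -> option bool) (lo hi : nat) : nat :=
  (\sum_(lo <= p < hi) (l p != l p.+1))%N.

Definition shift_add (F : realFieldType) (u : nat -> F) (p : nat) : F :=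
  u p + (if p is q.+1 then u q else 0).

Definition shift_set (X : pred nat) : pred nat :=
  fun p => X p || (if p is q.+1 then X q else false).

(** The positions at which [l'] reads [l] never decrease, so [l'] shows no change that [l] has not
    made. The induction carries the term [l' q != l q]: a change already made by [l] that a lagging
    [l'] has not yet shown. *)
Lemma nchange_thin (l l' : nat -> option bool) (lo hi : nat) :
  (lo <= hi)%N -> l' lo = l lo -> l' hi.+1 = l hi ->
  (forall p, (lo < p <= hi)%N -> l' p = l p \/ l' p = l p.-1) ->
  (nchange l' lo hi.+1 <= nchange l lo hi)%N.
Proof.
move=> lehi e0 e1 H.
have tri (x y z : option bool) : ((x != z) <= (x != y) + (y != z))%N.
  by case: (x =P y) => [->|_]; rewrite ?add0n //; case: (x != z).
have key q : (lo <= q <= hi)%N ->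
    (nchange l' lo q + (l' q != l q) <= nchange l lo q)%N.
  elim: q => [|q IH].
    by rewrite leqn0 => /andP[/eqP <- _]; rewrite /nchange !big_geq // -e0 eqxx.
  move=> /andP[loq qhi]; move: loq; rewrite leq_eqVlt => /orP[/eqP <-|loq].
    by rewrite /nchange !big_geq // e0 eqxx.
  rewrite ltnS in loq; have {IH} := IH; rewrite loq (ltnW qhi) => /(_ isT) IH.
  rewrite /nchange !(big_nat_recr q) //= -!/(nchange _ _ _).
  have [e|e] : l' q.+1 = l q.+1 \/ l' q.+1 = l q by apply: (H q.+1); lia.
    by rewrite e eqxx addn0; have := tri (l' q) (l q) (l q.+1); lia.
  by rewrite e; lia.
rewrite {1}/nchange big_nat_recr //= -/(nchange _ _ _) e1.
by apply: key; rewrite lehi leqnn.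
Qed.

(* A labelling refines the sign pattern of a row by choosing signs at its zeros. Multiplying a row by 1 + x, every choice after the multiplication can be read off, up to repetitions, from a choice before it: this is Descartes' rule of signs in the form needed here. *)
Lemma labelling_shift (F : realFieldType) (X : pred nat) (u : nat -> F)
  (l' : nat -> option bool) :
  (forall p, ~~ X p -> u p = 0) ->
  (forall p, X p -> ~~ X p.+1 -> exists2 q, (q <= p)%N & u q != 0 /\
     forall r, (q <= r <= p)%N -> X r) ->
  labelling (shift_set X) (shift_add u) l' ->
  exists2 l, labelling X u l & forall p, l' p = l p \/
     (0 < p)%N /\ l' p = l p.-1.
Proof.
move=> u0 blk Ll'.
(* [E p] says that the run of [X] leading to [p] has a nonzero entry before [p]. A zero after such
   an entry takes the new label at [p + 1], a zero before it the one at [p]; thus [l'] follows [l]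
   without lag up to the first nonzero entry of a run and may lag by one after it. *)
pose E p := [exists q : 'I_p, (u q != 0) && [forall r : 'I_p, (q <= r)%N ==> X r]].
have EP p : reflect (exists2 q, (q < p)%N & u q != 0 /\
    forall r, (q <= r < p)%N -> X r) (E p).
  apply: (iffP existsP) => [[q /andP[uq /forallP Xq]]|[q qp [uq Xq]]].
    exists q => //; split=> // r /andP[qr rp].
    by have := Xq (Ordinal rp); rewrite /= qr.
  exists (Ordinal qp); rewrite uq /=; apply/forallP => r; apply/implyP => qr.
  by apply: Xq; rewrite qr ltn_ord.
pose l p := if ~~ X p then None else if 0 < u p then Some true else
  if u p < 0 then Some false else if E p then l' p.+1 else l' p.
have lN p : ~~ X p -> l p = None by rewrite /l => ->.
have lp p : 0 < u p -> l p = Some true.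
  by move=> up; rewrite /l up; case: (boolP (X p)) => // /u0 e; move: up; rewrite e ltxx.
have ln p : u p < 0 -> l p = Some false.
  move=> up; rewrite /l up; case: (boolP (X p)) => [_|/u0 e]; first by rewrite ltNge (ltW up).
  by move: up; rewrite e ltxx.
have lz p : X p -> u p = 0 -> l p = if E p then l' p.+1 else l' p.
  by move=> Xp e; rewrite /l Xp e ltxx.
have l'N p : ~~ shift_set X p -> l' p = None.
  by move=> Xp; case: (Ll' p) => e _ _; apply/eqP; rewrite e.
have l'S p : shift_set X p -> l' p != None.
  by move=> Xp; case: (Ll' p) => e _ _; rewrite e negbK.
have l'p p : shift_set X p -> 0 < shift_add u p -> l' p = Some true by case: (Ll' p).
have l'n p : shift_set X p -> shift_add u p < 0 -> l' p = Some false by case: (Ll' p).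
have eql p q : shift_set X p -> X q -> u q != 0 -> shift_add u p = u q -> l' p = l q.
  move=> Xp Xq uq e; case: (ltgtP (u q) 0) => c.
  - by rewrite l'n ?e // ln.
  - by rewrite l'p ?e // lp.
  - by rewrite c eqxx in uq.
exists l.
  move=> p; split; [| by move=> _; apply: lp | by move=> _; apply: ln].
  case: (boolP (X p)) => Xp /=; last by rewrite lN.
  case: (ltgtP (u p) 0) => c; [by rewrite ln | by rewrite lp | rewrite lz //].
  case: ifP => _; apply/negbTE/l'S; rewrite /shift_set ?Xp ?orbT //.
move=> p.
have [Xp'|Xp'] := boolP (shift_set X p); last first.
  by left; rewrite l'N // lN //; move: Xp'; rewrite /shift_set negb_or => /andP[].
case: p Xp' => [|p] Xp'.
  left; have X0 : X 0%N by move: Xp'; rewrite /shift_set orbF.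
  case: (eqVneq (u 0%N) 0) => e; last by apply: eql => //; rewrite /shift_add addr0.
  by rewrite (lz _ X0 e); case: (EP 0%N) => // -[].
have [Xp1|Xp1] := boolP (X p.+1); last first.
  have Xp : X p by move: Xp'; rewrite /shift_set (negbTE Xp1).
  right; split=> //=.
  case: (eqVneq (u p) 0) => e; last by apply: eql => //; rewrite /shift_add u0 // add0r.
  rewrite (lz _ Xp e); case: (EP p) => // -[].
  (* Just beyond a run only the lagging reading is possible; [blk] supplies the nonzero entry that
     puts the last zero of the run in the lagging case. *)
  have [q qp [uq Xq]] := blk _ Xp Xp1; exists q.
    by rewrite ltn_neqAle qp andbT; apply/eqP => eq; rewrite eq e eqxx in uq.
  by split=> // r /andP[qr /ltnW rp]; apply: Xq; rewrite qr.
have [Xp|Xp] := boolP (X p); last first.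
  left; case: (eqVneq (u p.+1) 0) => e.
    rewrite (lz _ Xp1 e); case: (EP p.+1) => // -[q qp [_ Xq]].
    by case/negP: Xp; apply: Xq; rewrite leqnn andbT -ltnS.
  by apply: eql => //; rewrite /shift_add (u0 p) // addr0.
case: (eqVneq (u p.+1) 0) => e1; case: (eqVneq (u p) 0) => e0.
- rewrite (lz _ Xp1 e1) (lz p Xp e0) /=; case: (EP p.+1) => [[q qp [uq Xq]]|_]; last by left.
  right; split=> //; case: (EP p) => // -[]; exists q.
    by move: qp; rewrite ltnS leq_eqVlt => /orP[/eqP eq|//]; rewrite eq e0 eqxx in uq.
  by split=> // r /andP[qr rp]; apply: Xq; rewrite qr ltnS ltnW.
- by right; split=> //=; apply: eql => //; rewrite /shift_add e1 add0r.
- by left; apply: eql => //; rewrite /shift_add e0 addr0.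
case: (ltgtP (u p.+1) 0) e1 => // c1 _; case: (ltgtP (u p) 0) e0 => // c0 _.
- by left; rewrite ln // l'n //= /shift_add; lra.
- rewrite ln //= lp //; case: (l' p.+1) (l'S _ Xp') => // -[] _; by [right|left].
- rewrite lp //= ln //; case: (l' p.+1) (l'S _ Xp') => // -[] _; by [right|left].
- by left; rewrite lp // l'p //= /shift_add; lra.
Qed.

Lemma coef_1DX_mul (F : realFieldType) (q : {poly F}) p :
  ((1 + 'X) * q)`_p = shift_add (fun r => q`_r) p.
Proof. by rewrite mulrDl mul1r coefD coefXM; case: p => [|p]. Qed.

Lemma supp_mul_1DX (F : realFieldType) (q : {poly F}) (lo hi e : nat) :
  (forall p, q`_p != 0 -> (lo <= p <= hi)%N) ->
  forall p, (q * (1 + 'X) ^+ e)`_p != 0 -> (lo <= p <= hi + e)%N.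
Proof.
elim: e q hi => [|e IH] q hi Hq p; first by rewrite mulr1 addn0; apply: Hq.
rewrite exprS mulrA => /(IH _ hi.+1) H; rewrite addnS -addSn; apply: H => r.
rewrite mulrC coef_1DX_mul /shift_add; case: r => [|r].
  by rewrite addr0 => /Hq /andP[-> h]; rewrite (leq_trans h).
case: (eqVneq q`_r.+1 0) => [->|/Hq /andP[h1 h2] _].
  by rewrite add0r => /Hq /andP[h1 h2]; rewrite (leq_trans h1) //.
by rewrite h1 (leq_trans h2).
Qed.

Lemma sum_nat_interval (A R lo hi : nat) :
  (\sum_(A <= p < R) ((lo <= p) && (p < hi)) = minn hi R - maxn lo A)%N.
Proof.
elim: R => [|R IH]; first by rewrite big_geq // minn0.
case: (leqP A R) => h; last by rewrite big_geq //; lia.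
by rewrite big_nat_recr //= IH; lia.
Qed.

Lemma sum_nat_interval_le (A R lo hi : nat) (f : nat -> bool) :
  (forall p, (A <= p < R)%N -> f p -> (lo <= p < hi)%N) ->
  (\sum_(A <= p < R) f p <= minn hi R - maxn lo A)%N.
Proof.
move=> H; rewrite -sum_nat_interval big_nat_cond [leqRHS]big_nat_cond.
apply: leq_sum => p; rewrite andbT => h; case fp: (f p) => //.
by rewrite (H p h fp).
Qed.

Lemma nchange_None (l : nat -> option bool) lo hi :
  (forall p, l p = None) -> nchange l lo hi = 0%N.
Proof. by move=> H; rewrite /nchange big1 // => p _; rewrite !H. Qed.

Definition sign_labelling (F : realFieldType) (X : pred nat) (u : nat -> F) p :=
  if X p then Some (0 < u p) else None.

Lemma sign_labellingP (F : realFieldType) (X : pred nat) (u : nat -> F) :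
  labelling X u (sign_labelling X u).
Proof.
move=> p; rewrite /sign_labelling; split; first by case: (X p).
  by move=> -> ->.
by move=> -> h; rewrite ltNge (ltW h).
Qed.

(** The zeros get alternating signs, in both directions from the first nonzero entry [q]. A zero
    left of [q] then differs from its right neighbour and a zero right of [q] from its left
    neighbour, so distinct zeros account for distinct pairs. *)
Lemma labelling_many_changes (F : realFieldType) (X : pred nat) (u : nat -> F)
  (lo hi : nat) :
  (forall p, X p -> (lo <= p <= hi)%N) -> (forall p, ~~ X p -> u p = 0) ->
  (exists p, u p != 0) ->
  exists2 l, labelling X u l &
    (\sum_(lo <= p < hi.+1) (X p && (u p == 0%R)) <= nchange l lo hi)%N.
Proof.
move=> Xr u0 exu; pose q := ex_minn exu.
have [uq qmin] : u q != 0 /\ forall p, (p < q)%N -> u p = 0.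
  rewrite /q; case: ex_minnP => r ur rmin; split=> // p pr.
  by apply/eqP; apply: contraLR pr => /rmin; rewrite -leqNgt.
have Xq : X q by apply: contraR uq => /u0 ->.
have /andP[loq qhi] := Xr _ Xq.
pose s0 := (0 < u q) (+) odd q.
pose fix g n := if n is n'.+1 then
    if ~~ X (q + n)%N then None else if u (q + n)%N == 0 then
      (if g n' is Some b then Some (~~ b) else Some true) else Some (0 < u (q + n)%N)
  else Some (0 < u q).
pose l p := if (p < q)%N then (if X p then Some (s0 (+) odd p) else None) else g (p - q)%N.
have lab : labelling X u l.
  move=> p; rewrite /l; case: ltnP => pq.
    rewrite (qmin _ pq) ltxx; split=> //; by case: (X p).
  rewrite -(subnKC pq); move: (p - q)%N => n; rewrite addKn.
  case: n => [|n] /=.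
    rewrite addn0 Xq; split=> // [_ -> //|_ h].
    by rewrite ltNge (ltW h).
  case: (boolP (X _)) => Xn /=; last by [].
  split; first by case: ifP => // _; case: (g n).
    by move=> _ h; rewrite gt_eqF // h.
  by move=> _ h; rewrite lt_eqF // ltNge (ltW h).
exists l => //.
have lNP p : (l p == None) = ~~ X p by case: (lab p).
have left_ch p : (p < q)%N -> X p -> l p != l p.+1.
  move=> pq Xp; case: (boolP (X p.+1)) => Xp1; last first.
    move: (lNP p.+1); rewrite Xp1 => /eqP ->; by rewrite lNP Xp.
  rewrite {1}/l pq Xp /l Xp1; case: ltnP => h.
    by rewrite /=; case: (s0); case: (odd p).
  have -> : p.+1 = q by lia.
  rewrite subnn /= /s0.
  have -> : odd q = ~~ odd p by have -> : q = p.+1 by lia.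
  by case: (0 < u q); case: (odd p).
have right_ch p : (q <= p)%N -> X p.+1 -> u p.+1 = 0 -> l p != l p.+1.
  move=> qp Xp1 e; rewrite /l !ltnNge qp (leq_trans qp) //= subSn //=.
  have -> : (q + (p - q).+1 = p.+1)%N by lia.
  rewrite Xp1 e eqxx /=.
  by case: (g (p - q)%N) => [[]|].
rewrite /nchange (big_cat_nat _ (n := q)) //=; last by lia.
rewrite [leqRHS](big_cat_nat _ (n := q)) //=.
apply: leq_add.
  rewrite big_nat_cond [leqRHS]big_nat_cond; apply: leq_sum => p.
  rewrite andbT => /andP[_ pq]; case: (boolP (X p)) => //= Xp.
  by rewrite left_ch // leq_b1.
rewrite big_nat_recl //= (negbTE uq) andbF add0n.
rewrite big_nat_cond [leqRHS]big_nat_cond; apply: leq_sum => p.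
rewrite andbT => /andP[qp _]; case: (boolP (X p.+1)) => //= Xp.
by case: eqP => //= e; rewrite right_ch.
Qed.

Lemma onePX_neq0 (F : realFieldType) : (1 + 'X : {poly F}) != 0.
Proof.
apply/eqP => /polyP /(_ 1%N).
by rewrite coefD coefX coef1 coef0 add0r => /eqP; rewrite oner_eq0.
Qed.

(** * Relations without proper vanishing subsums *)

Section Star.

Variables (F : realFieldType) (I : finType) (J : {set I}).
Variables (a b m k : I -> nat) (u : I -> {poly F}) (D A B M : nat).

Hypothesis size_tri : forall i, i \in J -> (a i + b i + m i + k i = D)%N.
Hypothesis supp_u : forall i, i \in J -> forall p, (u i)`_p != 0 ->
  (a i <= p <= a i + k i)%N.
Hypothesis sum0 : \sum_(i in J) u i * (1 + 'X) ^+ m i = 0.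
Hypothesis minimal0 : forall J' : {set I}, J' \subset J -> J' != set0 ->
  \sum_(i in J') u i * (1 + 'X) ^+ m i = 0 -> J' = J.
Hypothesis minA : forall i, i \in J -> (A <= a i)%N.
Hypothesis minB : forall i, i \in J -> (B <= b i)%N.
Hypothesis minM : forall i, i \in J -> (M <= m i)%N.
Hypothesis exA : exists2 i, i \in J & a i = A.
Hypothesis exB : exists2 i, i \in J & b i = B.
Hypothesis exM : exists2 i, i \in J & m i = M.
Hypothesis hullD : (A + B + M < D)%N.

(** Row [r] collects the terms with [m i >= r], divided by [(1 + X)^r]. The set [X r] keeps the
    positions where their coefficients cancel: these are the zeros whose sign is free. *)
Let Jm r := [set i in J | (r <= m i)%N].
Let term r i := u i * (1 + 'X) ^+ (m i - r).
Let um r := \sum_(i in Jm r) term r i.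
Let X r : pred nat := fun p =>
  [exists i, (i \in Jm r) && (a i <= p <= a i + k i + (m i - r))%N].

Let JmP r i : reflect (i \in J /\ (r <= m i)%N) (i \in Jm r).
Proof. by rewrite inE; apply: andP. Qed.

Let XP r p : reflect (exists2 i, i \in J /\ (r <= m i)%N &
  (a i <= p <= a i + k i + (m i - r))%N) (X r p).
Proof.
apply: (iffP existsP) => [[i /andP[/JmP h1 h2]]|[i h1 h2]]; first by exists i.
by exists i; rewrite h2 andbT; apply/JmP.
Qed.

Let supp_term r i p : i \in J -> (r <= m i)%N -> (term r i)`_p != 0 ->
  (a i <= p <= a i + k i + (m i - r))%N.
Proof. by move=> iJ _; apply: supp_mul_1DX; apply: supp_u. Qed.

Let um0 r p : ~~ X r p -> (um r)`_p = 0.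
Proof.
move=> Xp; rewrite coef_sum big1 // => i /JmP[iJ ri]; apply/eqP.
by apply: contraR Xp => /(supp_term iJ ri) h; apply/XP; exists i.
Qed.

Let X_range r p : X r p -> (A <= p <= D - B - r)%N.
Proof.
move=> /XP[i [iJ ri] h]; have := minA iJ; have := minB iJ; have := size_tri iJ.
lia.
Qed.

Let sum_Jsub (J' : {set I}) r : J' \subset J -> (forall i, i \in J' -> (r <= m i)%N) ->
  \sum_(i in J') term r i = 0 -> \sum_(i in J') u i * (1 + 'X) ^+ m i = 0.
Proof.
move=> sJ rJ e; transitivity ((\sum_(i in J') term r i) * (1 + 'X) ^+ r); last by rewrite e mul0r.
rewrite mulr_suml.
by apply: eq_bigr => i iJ; rewrite /term -mulrA -exprD subnK // rJ.
Qed.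

Let umS r : um r = (1 + 'X) * um r.+1 + \sum_(i in J | m i == r) u i.
Proof.
rewrite /um (bigID (fun i => m i == r)) /= addrC; congr (_ + _).
  rewrite mulr_sumr; apply: eq_big => [i|i]; first by rewrite !inE; lia.
  move=> /andP[/JmP[_ h1] h2]; rewrite /term.
  by rewrite mulrCA -exprS -subSn ?subSS //; lia.
apply: eq_big => [i|i]; first by rewrite !inE; lia.
by move=> /andP[_ /eqP e]; rewrite /term e subnn mulr1.
Qed.

Let XS r p : X r p = shift_set (X r.+1) p ||
  [exists i, [&& i \in J, m i == r & (a i <= p <= a i + k i)%N]].
Proof.
apply/idP/orP.
  move=> /XP[i [iJ ri] h]; case: (eqVneq (m i) r) => e.
    by right; apply/existsP; exists i; rewrite iJ e eqxx /=; lia.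
  left; rewrite /shift_set; have ri' : (r < m i)%N by lia.
  case: (leqP p (a i + k i + (m i - r.+1))) => hp.
    by apply/orP; left; apply/XP; exists i => //; lia.
  apply/orP; right; case: p h hp => [|p] h hp; first by lia.
  by apply/XP; exists i => //; lia.
case=> [|/existsP[i /and3P[iJ /eqP e h]]]; last by apply/XP; exists i; rewrite ?e ?subnn ?addn0.
rewrite /shift_set => /orP[/XP[i [iJ ri] h]|]; first by apply/XP; exists i; [split=> //; lia|lia].
by case: p => // p /XP[i [iJ ri] h]; apply/XP; exists i; [split=> //; lia|lia].
Qed.

(* A block of X r on which the row vanishes would be a proper vanishing subsum. *)
Let block_neq0 r p : (M < r)%N -> X r p -> ~~ X r p.+1 ->
  exists2 q, (q <= p)%N & (um r)`_q != 0 /\ forall s, (q <= s <= p)%N -> X r s.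
Proof.
move=> Mr Xp Xp1.
have [/existsP[q /andP[uq /forallP Xq]]|/existsPn H] := boolP [exists q : 'I_p.+1,
    ((um r)`_q != 0) && [forall s : 'I_p.+1, (q <= s)%N ==> X r s]].
  exists q; first by rewrite -ltnS.
  split=> // s /andP[qs sp]; have sp' : (s < p.+1)%N by [].
  by have := Xq (Ordinal sp'); rewrite /= qs.
(* The terms living in the run of [X r] that ends at [p]. No term crosses the end of the run, by
   [Xp1], so their sum is the row restricted to this run. *)
pose J' := [set i in Jm r | (a i + k i + (m i - r) <= p)%N &&
  [forall s : 'I_p.+1, (a i <= s)%N ==> X r s]].
have J'P i : reflect ((i \in J /\ (r <= m i)%N) /\ ((a i + k i + (m i - r) <= p)%N /\
    forall s, (a i <= s <= p)%N -> X r s)) (i \in J').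
  rewrite [i \in J']inE; apply: (iffP andP) => -[/JmP h1 h2]; split=> //; try exact/JmP.
    case/andP: h2 => h2 /forallP h3; split=> // s /andP[as_ sp].
    have sp' : (s < p.+1)%N by []. by have := h3 (Ordinal sp'); rewrite /= as_.
  case: h2 => -> h3; apply/forallP => s; apply/implyP => as_.
  by apply: h3; rewrite as_ -ltnS ltn_ord.
have XJ i : i \in J -> (r <= m i)%N -> forall s, (a i <= s <= a i + k i + (m i - r))%N -> X r s.
  by move=> iJ ri s h; apply/XP; exists i.
have right_le i : i \in J -> (r <= m i)%N -> (a i <= p)%N -> (a i + k i + (m i - r) <= p)%N.
  move=> iJ ri ap; rewrite leqNgt; apply: contra Xp1 => h; apply: (XJ i) => //; lia.
have sum' : \sum_(i in J') term r i = 0.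
  apply/polyP => q; rewrite coef0 coef_sum.
  case: (leqP q p) => qp; last first.
    rewrite big1 // => i /J'P[[iJ ri] [h _]]; apply/eqP.
    by apply: contraLR qp => /(supp_term iJ ri); lia.
  have [/forallP Xq|/forallPn[s]] := boolP [forall s : 'I_p.+1, (q <= s)%N ==> X r s].
    have qp' : (q < p.+1)%N by [].
    have uq : (um r)`_q = 0.
      apply/eqP; have := H (Ordinal qp'); rewrite negb_and negbK => /orP[//|].
      by move/negP; case; apply/forallP.
    rewrite -[RHS]uq coef_sum [RHS](bigID (fun i => i \in J')) /=.
    rewrite [X in _ + X]big1 ?addr0.
      by apply: eq_bigl => i; case: (boolP (i \in J')); rewrite ?andbF // => /J'P[h _]; rewrite andbT; apply/esym/JmP.
    move=> i /andP[/JmP[iJ ri] iJ']; apply/eqP; apply: contraR iJ' => /(supp_term iJ ri) /andP[h1 h2].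
    apply/J'P; split=> //; split; first by apply: right_le => //; lia.
    move=> s /andP[as_ sp]; case: (leqP q s) => qs.
      have sp' : (s < p.+1)%N by []. by have := Xq (Ordinal sp'); rewrite /= qs.
    by apply: (XJ i) => //; lia.
  rewrite negb_imply => /andP[qs Xs]; rewrite big1 // => i /J'P[[iJ ri] [_ h]].
  apply/eqP; apply: contraR Xs => /(supp_term iJ ri) /andP[h1 h2].
  by apply: h; rewrite (leq_trans h1) //= -ltnS ltn_ord.
have sJ : J' \subset J by apply/subsetP => i /J'P[[]].
have J'0 : J' != set0.
  case/XP: Xp => i [iJ ri] h; apply/set0Pn; exists i; apply/J'P; split=> //.
  have hr : (a i + k i + (m i - r) <= p)%N by apply: right_le => //; lia.
  by split=> // s hs; apply: (XJ i) => //; lia.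
have J'J : J' = J.
  apply: minimal0 => //; apply: (sum_Jsub (r := r)) => //.
  by move=> i /J'P[[]].
case: exM => i iJ mi; move: iJ; rewrite -J'J => /J'P[[_ ri] _].
by move: Mr; rewrite -mi ltnNge ri.
Qed.

Let bd i : nat := ((a i == A) + (b i == B))%N.

(** The bound is over all labellings, so that the last row may choose its signs. A term is charged
    [k i + 2], the number of adjacent pairs meeting its interval, less one for each end of the
    window from [A] to [D - B - r] that it reaches. *)
Let inv r (Y : pred nat) (v : nat -> F) s := forall l, labelling Y v l ->
  (nchange l A (D - B - r) + \sum_(i in Jm s) bd i <= \sum_(i in Jm s) (k i + 2))%N.

Let invS r : (M <= r)%N -> inv r.+1 (X r.+1) (fun p => (um r.+1)`_p) r.+1 ->
  inv r (shift_set (X r.+1)) (shift_add (fun p => (um r.+1)`_p)) r.+1.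
Proof.
move=> Mr IH l' Ll'.
have [J0|[i0 /JmP[i0J ri0]]] := set_0Vmem (Jm r.+1).
  rewrite J0 !big_set0 addn0 nchange_None // => p.
  have X0 q : X r.+1 q = false.
    by apply: negbTE; apply/negP => /XP [i h _]; move/JmP: h; rewrite J0 inE.
  case: (Ll' p) => /eqP; rewrite /shift_set X0 /=.
  by case: p => [|p]; rewrite ?X0 => /eqP /eqP.
have [l Ll H] := labelling_shift (@um0 r.+1)
  (fun p => @block_neq0 r.+1 p Mr) Ll'.
apply: leq_trans (IH l Ll); rewrite leq_add2r.
have := size_tri i0J; have := minA i0J; have := minB i0J; move=> h1 h2 h3.
have -> : (D - B - r = (D - B - r.+1).+1)%N by lia.
have lN p : ~~ X r.+1 p -> l p = None.
  by move=> Xp; case: (Ll p); rewrite Xp => /eqP.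
apply: nchange_thin.
- lia.
- case: (H A) => // -[A0 e].
  have XA : ~~ X r.+1 A.-1 by apply/negP => /X_range; lia.
  rewrite e lN // lN //; apply/negP => XA1.
  case: (Ll' A) => + _ _; rewrite e lN // eqxx /shift_set XA1 //.
- case: (H (D - B - r.+1).+1%N) => [e|[_ //]].
  have XA : ~~ X r.+1 (D - B - r.+1).+1 by apply/negP => /X_range; lia.
  rewrite e lN // lN //; apply/negP => XA1.
  by case: (Ll' (D - B - r.+1).+1) => + _ _; rewrite e lN // eqxx /shift_set XA1 orbT.
- by move=> p _; case: (H p) => [|[]]; [left|right].
Qed.

Let inv_step r : (M < r)%N -> inv r.+1 (X r.+1) (fun p => (um r.+1)`_p) r.+1 ->
  inv r (X r) (fun p => (um r)`_p) r.
Proof.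
move=> Mr /(invS (ltnW Mr)) IH l Ll.
pose new p := [exists i, [&& i \in J, m i == r & (a i <= p <= a i + k i)%N]].
have newP p : reflect (exists2 i, i \in J /\ m i = r & (a i <= p <= a i + k i)%N) (new p).
  apply: (iffP existsP) => [[i /and3P[h1 /eqP h2 h3]]|[i [h1 h2] h3]].
    by exists i.
  by exists i; rewrite h1 h2 eqxx h3.
pose X' := shift_set (X r.+1); pose u' := shift_add (fun p => (um r.+1)`_p).
(* Undoes the addition of the terms with [m i = r]: off their intervals the given labels remain
   valid, and on them any labelling of the product will do, at the price of the pairs that meet
   them. *)
pose l' p := if new p then sign_labelling X' u' p else l p.
have Ll' : labelling X' u' l'.
  move=> p; rewrite /l'; case: ifPn => np; first exact: sign_labellingP.
  have -> : X' p = X r p by rewrite XS -/X' -/(new p) (negbTE np) orbF.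
  suff -> : u' p = (um r)`_p by [].
  rewrite umS coefD coef_1DX_mul -/u' coef_sum big1 ?addr0 // => i /andP[iJ /eqP e].
  by apply/eqP; apply: contraR np => /(supp_u iJ) h; apply/newP; exists i.
have := IH l' Ll'.
have split_sum (f : I -> nat) : (\sum_(i in Jm r) f i =
    \sum_(i in Jm r.+1) f i + \sum_(i in J | m i == r) f i)%N.
  rewrite (bigID (fun i => m i == r)) /= addnC; congr (_ + _)%N.
    by apply: eq_bigl => i; rewrite !inE; lia.
  by apply: eq_bigl => i; rewrite !inE; lia.
rewrite !split_sum.
suff : (nchange l A (D - B - r) + \sum_(i in J | m i == r) bd i <=
    nchange l' A (D - B - r) + \sum_(i in J | m i == r) (k i + 2))%N by lia.
pose touch i p := (a i <= p <= a i + k i)%N || (a i <= p.+1 <= a i + k i)%N.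
have ltouch : (nchange l A (D - B - r) <= nchange l' A (D - B - r) +
    \sum_(i in J | m i == r) \sum_(A <= p < D - B - r) touch i p)%N.
  rewrite /nchange exchange_big /= -big_split /=; apply: leq_sum => p _.
  case: (boolP (new p || new p.+1)) => h.
    apply: leq_trans (leq_b1 _) _; rewrite addnC ltn_addr //.
    have [i [iJ mi] hi] : exists2 i, i \in J /\ m i = r & touch i p.
      by case/orP: h => /newP[i hi h]; exists i; rewrite // /touch h ?orbT.
    by rewrite (bigD1 i) /= ?iJ ?mi ?eqxx // hi.
  move: h; rewrite negb_or => /andP[/negbTE n1 /negbTE n2].
  by rewrite /l' n1 n2 leq_addr.
suff : (\sum_(i in J | m i == r) \sum_(A <= p < D - B - r) touch i p +
   \sum_(i in J | m i == r) bd i <= \sum_(i in J | m i == r) (k i + 2))%N by lia.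
rewrite -big_split /=; apply: leq_sum => i /andP[iJ /eqP mi].
have h1 := minA iJ; have h2 := minB iJ; have h3 := size_tri iJ.
have : (\sum_(A <= p < D - B - r) touch i p <=
    minn (a i + k i).+1 (D - B - r) - maxn (a i).-1 A)%N.
  by apply: sum_nat_interval_le => p _; rewrite /touch; lia.
by rewrite /bd; case: eqP; case: eqP; lia.
Qed.

Let inv_row r : (M < r)%N -> inv r (X r) (fun p => (um r)`_p) r.
Proof.
move=> Mr; move: {2}(D.+1 - r)%N (leqnn (D.+1 - r)) => n.
elim: n r Mr => [|n IH] r Mr hn; last first.
  by apply: inv_step => //; apply: IH => //; lia.
move=> l Ll.
have J0 : Jm r = set0.
  by apply/setP => i; rewrite [LHS]inE [RHS]inE; apply/negP => /andP[/size_tri]; lia.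
rewrite J0 !big_set0 addn0 nchange_None // => p.
have X0 : X r p = false by apply: negbTE; apply/negP => /XP [i [iJ ri]]; have := size_tri iJ; lia.
by case: (Ll p) => /eqP; rewrite X0 => /eqP/eqP.
Qed.

(** A gap would separate the terms into those left and those right of it, and the left ones would
    sum to zero by themselves. A term with [a i = A] is on the left and one with [b i = B] on the
    right, against minimality. *)
Let contig p : (A <= p <= D - B - M)%N -> X M p.
Proof.
move=> /andP[Ap pR]; apply: contraT => Xp.
have noI i : i \in J -> ~~ (a i <= p <= a i + k i + (m i - M))%N.
  by move=> iJ; apply: contra Xp => h; apply/XP; exists i => //; split=> //; apply: minM.
pose J' := [set i in J | (a i <= p)%N].
have sJ : J' \subset J by apply/subsetP => i; rewrite inE => /andP[].
have mJ i : i \in J -> (M <= m i)%N by apply: minM.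
have tot : \sum_(i in J) term M i = 0.
  have h : (1 + 'X : {poly F}) ^+ M != 0 by rewrite expf_neq0 // onePX_neq0.
  apply: (mulIf h); rewrite mul0r -[RHS]sum0 mulr_suml.
  by apply: eq_bigr => i iJ; rewrite /term -mulrA -exprD subnK // mJ.
have sum' : \sum_(i in J') term M i = 0.
  apply/polyP => q; rewrite coef0 coef_sum.
  case: (leqP q p) => qp; last first.
    rewrite big1 // => i; rewrite inE => /andP[iJ ap]; apply/eqP.
    apply: contraLR qp => /(supp_term iJ (mJ _ iJ)); have := noI _ iJ; lia.
  transitivity (\sum_(i in J) (term M i)`_q); last by rewrite -coef_sum tot coef0.
  rewrite [RHS](bigID (fun i => (a i <= p)%N)) /= [X in _ + X]big1 ?addr0.
    by apply: eq_bigl => i; rewrite inE.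
  move=> i /andP[iJ ap]; apply/eqP; apply: contraR ap => /(supp_term iJ (mJ _ iJ)); lia.
have J'J : J' = J.
  apply: minimal0 => //; last first.
    apply: (sum_Jsub (r := M)) => // i /(subsetP sJ); exact: mJ.
  by case: exA => i iJ ai; apply/set0Pn; exists i; rewrite inE iJ ai.
case: exB => i iJ bi; have : i \in J' by rewrite J'J.
rewrite inE iJ /= => ap; have := noI _ iJ; have := size_tri iJ; have := mJ _ iJ.
lia.
Qed.

Lemma minimal_relation_size :
  (D + \sum_(i in J) ((a i == A) + (b i == B) + (m i == M)) <=
   \sum_(i in J) (k i + 2) + (A + B + M + 1))%N.
Proof.
pose R := (D - B - M)%N.
pose X' := shift_set (X M.+1); pose u' := shift_add (fun p => (um M.+1)`_p).
have Inv : inv M X' u' M.+1 by apply: invS => //; apply: inv_row.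
pose new p := [exists i, [&& i \in J, m i == M & (a i <= p <= a i + k i)%N]].
(* Row [M] is the whole relation divided by [(1 + X)^M], hence zero. So the last product vanishes
   outside the intervals of the terms with [m i = M], and its signs there are free. *)
have sumM p : u' p + \sum_(i in J | m i == M) (u i)`_p = 0.
  have JM : Jm M = J.
    by apply/setP => i; rewrite inE; case: (boolP (i \in J)) => // /minM ->.
  rewrite /u' -(coef_1DX_mul (um M.+1)) -coef_sum -coefD -umS /um JM.
  have h : (1 + 'X : {poly F}) ^+ M != 0 by rewrite expf_neq0 // onePX_neq0.
  have -> : \sum_(i in J) term M i = 0.
    apply: (mulIf h); rewrite mul0r -[RHS]sum0 mulr_suml.
    by apply: eq_bigr => i iJ; rewrite /term -mulrA -exprD subnK // minM.
  by rewrite coef0.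
have u'new p : u' p != 0 -> new p.
  apply: contraR => np; have := sumM p; rewrite big1 ?addr0 => [-> //|i /andP[iJ mi]].
  by apply/eqP; apply: contraR np => /(supp_u iJ) h; apply/existsP; exists i; rewrite iJ mi.
have X'R p : X' p -> (A <= p <= R)%N.
  by move=> h; apply: (@X_range M p); rewrite XS -/X' h.
have u'0 p : ~~ X' p -> u' p = 0.
  rewrite /X' /u' /shift_set /shift_add negb_or => /andP[h1 h2].
  by rewrite um0 // add0r; case: p h1 h2 => // p _ h; rewrite um0.
have zeros : (\sum_(A <= p < R.+1) (X' p && (u' p == 0%R)) +
    \sum_(i in Jm M.+1) bd i <= \sum_(i in Jm M.+1) (k i + 2))%N.
  have [/existsP[p0 Xp0]|/existsPn noX] := boolP [exists p : 'I_R.+1, X' p].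
    have exu : exists p, u' p != 0.
      have XM1 : exists q, X M.+1 q.
        move: Xp0; rewrite /X' /shift_set => /orP[h|]; first by exists p0.
        by case: (p0 : nat) => // q h; exists q.
      have [q Xq Xq1] : exists2 q, X M.+1 q & ~~ X M.+1 q.+1.
        case: (ex_maxnP XM1 (fun q h => proj2 (andP (X_range h)))) => q Xq qmax.
        by exists q => //; apply/negP => /qmax; rewrite ltnn.
      have [r _ [ur _]] := block_neq0 (leqnn M.+1) Xq Xq1.
      have hr : exists r, (um M.+1)`_r != 0 by exists r.
      case: (ex_minnP hr) => s us smin; exists s; rewrite /u' /shift_add.
      case: s us smin => [|s] us smin; first by rewrite addr0.
      have -> : (um M.+1)`_s = 0 by apply/eqP; apply: contraT => /smin; rewrite ltnn.
      by rewrite addr0.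
    have [l Ll hl] := labelling_many_changes X'R u'0 exu.
    by apply: leq_trans (Inv l Ll); rewrite leq_add2r.
  have X'0 p : X' p = false.
    apply/negP => h; have /andP[_ pR] := X'R _ h.
    have pR' : (p < R.+1)%N by []. by have := noX (Ordinal pR'); rewrite /= h.
  rewrite big1 ?add0n => [|p _]; last by rewrite X'0.
  by apply: leq_sum => i _; rewrite /bd; case: eqP; case: eqP; lia.
pose rx := (\sum_(i in J | m i == M) (a i == A))%N.
pose ry := (\sum_(i in J | m i == M) (b i == B))%N.
(* Every position of the window is a free zero or lies in a term with [m i = M]. The [rx] terms that
   contain the end [A] pay for [rx], but perhaps not for the position itself; the same holds at [R],
   hence the [+ 2]. *)
have cover : (R.+1 - A + rx + ry <= \sum_(A <= p < R.+1) (X' p && (u' p == 0%R)) +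
    \sum_(i in J | m i == M) (k i).+1 + 2)%N.
  have -> : (\sum_(i in J | m i == M) (k i).+1 =
      \sum_(A <= p < R.+1) \sum_(i in J | m i == M) (a i <= p <= a i + k i))%N.
    rewrite exchange_big /=; apply: eq_bigr => i /andP[iJ /eqP mi].
    rewrite -[in RHS](eq_bigr _ (fun p _ => congr1 (fun c => nat_of_bool (_ && c)) (ltnS _ _))).
    rewrite sum_nat_interval.
    by have := size_tri iJ; have := minA iJ; have := minB iJ; rewrite /R; lia.
  have AR : (A < R)%N by rewrite /R; lia.
  have e1 (y : nat) c : (A <= y < R.+1 -> \sum_(A <= p < R.+1) (if p == y then c else 0) = c)%N.
    move=> hy; rewrite (big_cat_nat _ (n := y)) /=; [|lia|lia].
    rewrite [X in (X + _)%N]big_nat_cond big1 ?add0n => [|p]; last first.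
      by rewrite andbT => /andP[_ h]; rewrite ltn_eqF.
    rewrite big_ltn ?eqxx; last by lia.
    rewrite big_nat_cond big1 ?addn0 => [//|p].
    by rewrite andbT => /andP[h _]; rewrite gtn_eqF.
  have eR : (R.+1 - A = \sum_(A <= p < R.+1) 1)%N by rewrite sum_nat_const_nat muln1.
  rewrite eR -[in leqLHS](e1 A rx) ?leqnn ?ltnS ?(ltnW AR) //.
  rewrite -[in leqLHS](e1 R ry) ?leqnn ?(ltnW AR) ?andbT //.
  rewrite -[2%N]/(1 + 1)%N addnA -[X in (_ <= _ + X + _)%N](e1 A 1%N) ?leqnn ?ltnS ?(ltnW AR) //.
  rewrite -[X in (_ <= _ + X)%N](e1 R 1%N) ?leqnn ?(ltnW AR) ?andbT //.
  rewrite -!big_split /= big_nat_cond [leqRHS]big_nat_cond.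
  apply: leq_sum => p; rewrite andbT ltnS => /andP[Ap pR].
  have cov : (1 <= (X' p && (u' p == 0%R)) +
      \sum_(i in J | m i == M) (a i <= p <= a i + k i))%N.
    have cv : new p -> (0 < \sum_(i in J | m i == M) (a i <= p <= a i + k i))%N.
      by move=> /existsP[i /and3P[iJ mi h]]; rewrite (bigD1 i) /= ?iJ ?mi // h.
    case: (boolP (new p)) => np; first by rewrite ltn_addl // cv.
    have := contig (p := p); rewrite Ap pR => /(_ isT); rewrite XS -/X' -/(new p) (negbTE np) orbF.
    move=> ->; suff -> : u' p = 0 by rewrite eqxx.
    by apply/eqP; apply: contraR np => /u'new.
  case: (eqVneq p A) => [pA|_].
    rewrite [p == R]ltn_eqF ?pA // addn0.
    suff : (rx <= \sum_(i in J | m i == M) (a i <= p <= a i + k i))%N by rewrite -pA; lia.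
    by apply: leq_sum => i /andP[iJ _]; rewrite pA; case: eqP => // ->; rewrite leqnn leq_addr.
  case: (eqVneq p R) => [pE|_]; last by lia.
  suff : (ry <= \sum_(i in J | m i == M) (a i <= p <= a i + k i))%N by lia.
  apply: leq_sum => i /andP[iJ /eqP mi]; case: eqP => //= bi.
  by have := size_tri iJ; rewrite pE /R; lia.
have split_sum (f : I -> nat) : (\sum_(i in J) f i =
    \sum_(i in Jm M.+1) f i + \sum_(i in J | m i == M) f i)%N.
  rewrite (bigID (fun i => m i == M)) /= addnC; congr (_ + _)%N.
  apply: eq_bigl => i; rewrite !inE; case: (boolP (i \in J)) => //= /minM; lia.
rewrite !split_sum.
have e1 : (\sum_(i in Jm M.+1) ((a i == A) + (b i == B) + (m i == M)) =
   \sum_(i in Jm M.+1) bd i)%N.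
  by apply: eq_bigr => i; rewrite inE => /andP[_ h]; rewrite /bd [m i == M]gtn_eqF ?addn0.
have e2 : (\sum_(i in J | m i == M) ((a i == A) + (b i == B) + (m i == M)) =
   rx + ry + \sum_(i in J | m i == M) 1)%N.
  by rewrite /rx /ry -!big_split /=; apply: eq_bigr => i /andP[_ ->].
have e3 : (\sum_(i in J | m i == M) (k i + 2) =
   \sum_(i in J | m i == M) (k i).+1 + \sum_(i in J | m i == M) 1)%N.
  by rewrite -big_split /=; apply: eq_bigr => i _; lia.
rewrite e1 e2 e3; move: cover zeros; rewrite /R; lia.
Qed.

End Star.

(** * Grouping terms into vanishing sums with disjoint hulls *)

Section Grouping.

Variables (F : realFieldType) (I : finType) (S : {set I}).
Variables (a b m k : I -> nat) (u : I -> {poly F}) (D : nat).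

Definition minval (h : I -> nat) (J : {set I}) : nat :=
  if [pick t in J] is Some t0 then h [arg min_(t < t0 in J) h t] else 0%N.

Lemma minval_le h (J : {set I}) t : t \in J -> (minval h J <= h t)%N.
Proof.
move=> tJ; rewrite /minval; case: pickP => [t0 t0J|/(_ t)]; last by rewrite tJ.
by case: arg_minnP => // i _ /(_ t tJ).
Qed.

Lemma minval_ex h (J : {set I}) : J != set0 -> exists2 t, t \in J & h t = minval h J.
Proof.
move=> /set0Pn[t tJ]; rewrite /minval; case: pickP => [t0 t0J|/(_ t)]; last by rewrite tJ.
by case: arg_minnP => // i iJ _; exists i.
Qed.

Lemma minval_ge h (J : {set I}) c : J != set0 -> (forall t, t \in J -> (c <= h t)%N) ->
  (c <= minval h J)%N.
Proof. by move=> /(minval_ex h)[t tJ <-]; apply. Qed.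

Lemma minvalU h (J1 J2 : {set I}) : J1 != set0 -> J2 != set0 ->
  minval h (J1 :|: J2) = minn (minval h J1) (minval h J2).
Proof.
move=> n1 n2; have n12 : J1 :|: J2 != set0.
  by case/set0Pn: n1 => t tJ; apply/set0Pn; exists t; rewrite inE tJ.
have [t tU et] := minval_ex h n12.
have [t1 t1J e1] := minval_ex h n1; have [t2 t2J e2] := minval_ex h n2.
have h1 : (minval h (J1 :|: J2) <= h t1)%N by apply: minval_le; rewrite inE t1J.
have h2 : (minval h (J1 :|: J2) <= h t2)%N by apply: minval_le; rewrite inE t2J orbT.
have : (minval h J1 <= h t \/ minval h J2 <= h t)%N.
  by move: tU; rewrite inE => /orP[/(minval_le h)|/(minval_le h)]; [left|right].
lia.
Qed.

Definition zero_sum (J : {set I}) := \sum_(i in J) u i * (1 + 'X) ^+ m i == 0.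

Definition touching (J : {set I}) (t : I) : nat :=
  ((a t == minval a J) + (b t == minval b J) + (m t == minval m J))%N.

(** The inequality of [minimal_relation_size] for the hull of [J]. As a predicate it can be carried
    over to unions, which are no longer minimal. *)
Definition good (J : {set I}) := [/\ J != set0, zero_sum J &
  (D + \sum_(i in J) touching J i <=
   \sum_(i in J) (k i + 2) + (minval a J + minval b J + minval m J + 1))%N].

Hypothesis size_tri : forall i, i \in S -> (a i + b i + m i + k i = D)%N.
Hypothesis supp_u : forall i, i \in S -> forall p, (u i)`_p != 0 ->
  (a i <= p <= a i + k i)%N.
Hypothesis nondeg : forall J : {set I}, J \subset S -> J != set0 -> zero_sum J ->
  (minval a J + minval b J + minval m J < D)%N.

Lemma minimal_good (J : {set I}) : J \subset S -> J != set0 -> zero_sum J ->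
  (forall J' : {set I}, J' \subset J -> J' != set0 -> zero_sum J' -> J' = J) ->
  good J.
Proof.
move=> /subsetP sJ n0 z0 minJ; split=> //.
apply: (@minimal_relation_size _ _ _ _ _ _ _ u) => //.
- by move=> i /sJ /size_tri.
- by move=> i /sJ /supp_u.
- exact/eqP.
- by move=> J' s' n' /eqP; apply: minJ.
- by move=> i; apply: minval_le.
- by move=> i; apply: minval_le.
- by move=> i; apply: minval_le.
- exact: minval_ex.
- exact: minval_ex.
- exact: minval_ex.
- by apply: nondeg => //; apply/subsetP.
Qed.

Lemma big_set_disjointU (T : Type) (z : T) (op : Monoid.com_law z)
  (J1 J2 : {set I}) (f : I -> T) : [disjoint J1 & J2] ->
  \big[op/z]_(i in J1 :|: J2) f i =
  op (\big[op/z]_(i in J1) f i) (\big[op/z]_(i in J2) f i).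
Proof. by move=> dis; rewrite -bigU //=; apply: eq_bigl => i; rewrite !inE. Qed.

(** The last hypothesis says that the two hulls meet. The size of the joint hull is the sum of the
    two sizes minus that of the intersection, and each side on which the hulls differ loses a
    contact. One unit must be gained, because two terms [+ 1] become one: a differing side provides
    it, or, if the hulls coincide, their intersection, whose size is positive by [nondeg]. *)
Lemma good_merge (J1 J2 : {set I}) : J1 \subset S -> J2 \subset S ->
  [disjoint J1 & J2] -> good J1 -> good J2 ->
  (maxn (minval a J1) (minval a J2) + maxn (minval b J1) (minval b J2) +
   maxn (minval m J1) (minval m J2) <= D)%N ->
  good (J1 :|: J2).
Proof.
move=> s1 s2 dis [n1 z1 g1] [n2 z2 g2] ov.
have n12 : J1 :|: J2 != set0.
  by case/set0Pn: n1 => t tJ; apply/set0Pn; exists t; rewrite inE tJ.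
split=> //.
  by rewrite /zero_sum big_set_disjointU //= (eqP z1) (eqP z2) addr0.
have nd := nondeg s1 n1 z1.
have cnt h : (\sum_(i in J1 :|: J2) (h i == minval h (J1 :|: J2)) +
    (minval h J1 != minval h J2) <= \sum_(i in J1) (h i == minval h J1) +
    \sum_(i in J2) (h i == minval h J2))%N.
  rewrite big_set_disjointU //= minvalU //.
  have pos (J : {set I}) : J != set0 -> (0 < \sum_(i in J) (h i == minval h J))%N.
    by move=> /(minval_ex h)[t tJ e]; rewrite (bigD1 t) //= e eqxx.
  have low (J : {set I}) c : (c < minval h J)%N -> (\sum_(i in J) (h i == c) = 0)%N.
    move=> hc; rewrite big1 // => i /(minval_le h) hi; rewrite gtn_eqF //.
    exact: leq_trans hi.
  have p1 := pos _ n1; have p2 := pos _ n2.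
  case: (ltngtP (minval h J1) (minval h J2)) => c.
  - by rewrite (low J2) // addn0 leq_add2l.
  - by rewrite (low J1) // add0n addnC leq_add2r.
  - by rewrite c addn0.
have tE (J : {set I}) : (\sum_(i in J) touching J i = \sum_(i in J) (a i == minval a J) +
   \sum_(i in J) (b i == minval b J) + \sum_(i in J) (m i == minval m J))%N.
  by rewrite -!big_split.
have eK : (\sum_(i in J1 :|: J2) (k i + 2) = \sum_(i in J1) (k i + 2) +
   \sum_(i in J2) (k i + 2))%N by rewrite big_set_disjointU.
move: g1 g2; rewrite !tE eK; move: (cnt a) (cnt b) (cnt m) ov nd; rewrite !minvalU //.
by do 3 case: eqP => ? /=; lia.
Qed.

Definition class_of (g : I -> I) (c : I) := [set t in S | g t == c].

(** Splitting off a proper vanishing subsum leaves a vanishing complement, and a set without one is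
    minimal. The partition is encoded by its labels [g t]; keeping the labels inside the set
    prevents the two pieces from sharing one. *)
Lemma minimal_classes : zero_sum S -> exists g : I -> I,
  forall c, c \in g @: S -> good (class_of g c).
Proof.
suff : forall n (J : {set I}), (#|J| <= n)%N -> J \subset S -> zero_sum J ->
    exists2 g : I -> I, forall t, t \in J -> g t \in J &
      forall c, c \in g @: J -> good [set t in J | g t == c].
  by move=> /(_ #|S| S (leqnn _) (subxx _)) H /H[g _ Hg]; exists g.
elim=> [|n IH] J cJ sJ zJ.
  exists id => // c; have -> : J = set0 by apply/eqP; rewrite -cards_eq0 -leqn0.
  by rewrite imset0 inE.
have [/existsP[J' /and4P[s' n' z' d']]|/existsPn H] := boolP [exists J' : {set I},
    [&& J' \subset J, J' != set0, zero_sum J' & J' != J]].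
  have cJ' : (#|J'| < #|J|)%N by apply: proper_card; rewrite properEneq d'.
  have eJ : J = J' :|: (J :\: J') by rewrite -{1}(setID J J') (setIidPr s').
  have dis : [disjoint J' & J :\: J'].
    by rewrite -setI_eq0; apply/eqP/setP => t; rewrite !inE; case: (t \in J').
  have z'' : zero_sum (J :\: J').
    by move: zJ; rewrite /zero_sum {1}eJ big_set_disjointU //= (eqP z') add0r.
  have c'' : (#|J :\: J'| <= n)%N.
    rewrite cardsD (setIidPr s'); move/set0Pn: n' => [t tJ'].
    have : (0 < #|J'|)%N by apply/card_gt0P; exists t.
    lia.
  have [|g1 gg1 H1] := IH J' _ (subset_trans s' sJ) z'; first by lia.
  have [|g2 gg2 H2] := IH (J :\: J') c'' _ z''.
    by apply: subset_trans sJ; apply: subsetDl.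
  pose g t := if t \in J' then g1 t else g2 t.
  exists g => [t tJ|c /imsetP[t tJ ->]].
    rewrite /g; case: ifPn => t'; first exact: (subsetP s') (gg1 _ t').
    by have := gg2 t; rewrite !inE t' tJ => /(_ isT) /andP[].
  have [t'|t'] := boolP (t \in J').
    have gt : g t = g1 t by rewrite /g t'.
    suff -> : [set s in J | g s == g t] = [set s in J' | g1 s == g1 t].
      by apply: H1; apply: imset_f.
    apply/setP => s; rewrite !inE gt /g; case: ifPn => s'' /=; first by rewrite (subsetP s').
    apply/negP => /andP[sJ' /eqP e]; have := gg2 s; rewrite !inE s'' sJ' e gg1 //=.
    by move/(_ isT).
  have gt : g t = g2 t by rewrite /g (negbTE t').
  have tD : t \in J :\: J' by rewrite inE t' tJ.
  suff -> : [set s in J | g s == g t] = [set s in J :\: J' | g2 s == g2 t].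
    by apply: H2; apply: imset_f.
  apply/setP => s; rewrite !inE gt /g; case: ifPn => //= s''.
  apply/negP => /andP[_ /eqP e]; have := gg2 _ tD; rewrite -e !inE (gg1 _ s'') //.
have [->|[t0 t0J]] := set_0Vmem J.
  by exists id => // c; rewrite imset0 inE.
exists (fun _ => t0) => // c /imsetP[t tJ ->].
have -> : [set t1 in J | t0 == t0] = J by apply/setP => t1; rewrite inE eqxx andbT.
apply: minimal_good => //; first by apply/set0Pn; exists t0.
move=> J' s' n' z'; apply/eqP; have := H J'; rewrite s' n' z' /= negbK.
by [].
Qed.

(** Merging two groups whose hulls meet keeps all groups good and lowers their number, so the
    process ends. *)
Lemma separated_classes : zero_sum S -> exists g : I -> I,
  (forall c, c \in g @: S -> good (class_of g c)) /\
  (forall c c', c \in g @: S -> c' \in g @: S -> c != c' ->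
   (D < maxn (minval a (class_of g c)) (minval a (class_of g c')) +
   maxn (minval b (class_of g c)) (minval b (class_of g c')) +
   maxn (minval m (class_of g c)) (minval m (class_of g c')))%N).
Proof.
move=> /minimal_classes[g]; move: {2}#|g @: S| (leqnn #|g @: S|) => n.
elim: n g => [|n IH] g cg Hg.
  by exists g; split=> // c c'; move: cg; rewrite leqn0 cards_eq0 => /eqP ->; rewrite inE.
pose ov c c' := (maxn (minval a (class_of g c)) (minval a (class_of g c')) +
   maxn (minval b (class_of g c)) (minval b (class_of g c')) +
   maxn (minval m (class_of g c)) (minval m (class_of g c')) <= D)%N.
have [/existsP[c /existsP[c' /and4P[hc hc' cc' hov]]]|/existsPn H] :=
  boolP [exists c, exists c', [&& c \in g @: S, c' \in g @: S, c != c' & ov c c']]; last first.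
  exists g; split=> // c c' hc hc' cc'; rewrite ltnNge; apply/negP => h.
  by have /existsPn/(_ c') := H c; rewrite hc hc' cc' /ov h.
pose g' t := if g t == c' then c else g t.
have img : g' @: S \subset (g @: S) :\ c'.
  apply/subsetP => x /imsetP[t tS ->]; rewrite !inE /g'; case: ifPn => e.
    by rewrite cc' hc.
  by rewrite e imset_f.
apply: (IH g').
  have := subset_leq_card img; have := cardsD1 c' (g @: S); rewrite hc'; lia.
move=> x hx; have := subsetP img x hx; rewrite !inE => /andP[xc' xg].
have sC d : class_of g d \subset S by apply/subsetP => t; rewrite inE => /andP[].
have [->|xc] := eqVneq x c.
  have -> : class_of g' c = class_of g c :|: class_of g c'.
    apply/setP => t; rewrite !inE /g'; case: (t \in S) => //=.
    by case: ifPn => [|_]; rewrite ?eqxx ?orbT ?orbF.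
  apply: good_merge; rewrite ?sC //; last 2 first.
  - exact: Hg.
  - exact: Hg.
  rewrite -setI_eq0; apply/eqP/setP => t; rewrite !inE.
  apply/negP => /andP[/andP[_ /eqP e1] /andP[_ /eqP e2]].
  by rewrite -e1 -e2 eqxx in cc'.
have -> : class_of g' x = class_of g x; last exact: Hg.
apply/setP => t; rewrite !inE /g'; case: (t \in S) => //=.
case: ifPn => [/eqP ->|//]; by rewrite eq_sym (negbTE xc) eq_sym (negbTE xc').
Qed.

End Grouping.

(** * Covering supports by triangles *)

Definition sign_fill (F : realFieldType) (v : nat -> F) (r : nat -> bool) :=
  forall p, (0 < v p -> r p) /\ (v p < 0 -> ~~ r p).

(** Pairs of equal signs are counted, the complement of the changes: this count can be restricted by
    [c] to pairs inside a common triangle, so that uncovered parts of a side cost nothing. *)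
Definition nmono (r : nat -> bool) (c : nat -> bool) (lo hi : nat) : nat :=
  (\sum_(lo <= p < hi) (c p && (r p == r p.+1)))%N.

Lemma nmono_compl (r : nat -> bool) (l : nat -> option bool) (lo hi : nat) :
  (lo <= hi)%N -> (forall p, (lo <= p <= hi)%N -> l p = Some (r p)) ->
  (nmono r (fun _ => true) lo hi + nchange l lo hi = hi - lo)%N.
Proof.
move=> lohi H; rewrite /nmono /nchange -big_split /= big_nat_cond.
rewrite (eq_bigr (fun _ => 1%N)) => [|p]; last first.
  rewrite andbT => /andP[h1 h2]; rewrite !H ?h1 ?h2 ?(ltnW h2) ?(leq_trans h1) //.
  by case: (r p); case: (r p.+1).
by rewrite -big_nat_cond sum_nat_const_nat muln1.
Qed.

Lemma alternating_nmono c lo hi : nmono odd c lo hi = 0%N.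
Proof. by rewrite /nmono big1 // => p _ /=; case: (odd p); rewrite andbF. Qed.

(* Passing from the product back to the factor w saves two monotone pairs, up to the number of intervals that support the product. *)
Lemma side_nmono (F : realFieldType) (w : nat -> F) (r' : nat -> bool) (lo h : nat)
  (I : finType) (T : {set I}) (s e : I -> nat) :
  (forall p, w p != 0 -> (lo <= p <= lo + h)%N) -> (exists p, w p != 0) ->
  (forall t, t \in T -> (lo <= s t)%N && (s t <= e t <= (lo + h).+1)%N) ->
  (forall p, shift_add w p != 0 -> exists2 t, t \in T & (s t <= p <= e t)%N) ->
  T != set0 ->
  (forall p, (lo <= p <= (lo + h).+1)%N ->
     (0 < shift_add w p -> r' p) /\ (shift_add w p < 0 -> ~~ r' p)) ->
  exists2 r, sign_fill w r &
  (nmono r (fun _ => true) lo (lo + h) + 2 <=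
   nmono r' (fun p => [exists t, [&& t \in T, s t <= p & p < e t]]) lo (lo + h).+1
   + #|T|)%N.
Proof.
move=> supw exw T_in covw T0 fill'.
pose s0 := minval s T.
pose cov p := [exists t, [&& t \in T, s t <= p & p <= e t]]%N.
have covP p : reflect (exists2 t, t \in T & (s t <= p <= e t)%N) (cov p).
  apply: (iffP existsP) => [[t /and3P[h1 h2 h3]]|[t h1 /andP[h2 h3]]].
    by exists t; rewrite ?h2.
  by exists t; rewrite h1 h2.
(* [r2] keeps [r'] on the intervals and alternates elsewhere, so a monotone pair of [r2] lies in a
   common interval or ends at the start of an interval other than a first one. This saves the first
   of the two units. *)
pose fix g n := if n is n'.+1 then (if cov (s0 + n)%N then r' (s0 + n)%N else ~~ g n')
  else r' s0.
pose r2 p := if (p < s0)%N then r' s0 (+) odd (s0 - p) else g (p - s0)%N.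
have r2cov p : (s0 <= p)%N -> cov p -> r2 p = r' p.
  move=> sp cp; rewrite /r2 ltnNge sp /=; case e1: (p - s0)%N => [|n] /=.
    by congr (r' _); lia.
  have -> : (s0 + n.+1)%N = p by lia.
  by rewrite cp.
have r2low p : (p < s0)%N -> r2 p != r2 p.+1.
  move=> ps; rewrite /r2 ps; case: ltnP => h1.
    have -> : (s0 - p = (s0 - p.+1).+1)%N by lia.
    by rewrite /=; case: (r' s0); case: (odd _).
  have -> : (s0 - p = 1)%N by lia. have -> : (p.+1 - s0 = 0)%N by lia.
  by rewrite /=; case: (r' s0).
have r2nc p : (s0 <= p)%N -> ~~ cov p.+1 -> r2 p != r2 p.+1.
  move=> sp nc; rewrite /r2 !ltnNge sp (leq_trans sp) //= subSn //=.
  have -> : (s0 + (p - s0).+1 = p.+1)%N by lia.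
  by rewrite (negbTE nc); case: (g _).
have [t0 t0T st0] := minval_ex s T0.
have mono2 : (nmono r2 (fun _ => true) lo (lo + h).+1 + 1 <=
   nmono r' (fun p => [exists t, [&& t \in T, s t <= p & p < e t]]) lo (lo + h).+1
   + #|T|)%N.
  have -> : (#|T| = \sum_(t in T | t != t0) 1 + 1)%N.
    by rewrite -sum1_card (bigD1 t0) //= addnC.
  rewrite addnA leq_add2r.
  apply: (@leq_trans (nmono r' (fun p => [exists t, [&& t \in T, s t <= p & p < e t]])
     lo (lo + h).+1 + \sum_(t in T | t != t0) \sum_(lo <= p < (lo + h).+1) (s t == p.+1))%N).
    rewrite exchange_big /= /nmono -big_split /=; apply: leq_sum => p _.
    case: eqP => //= r2p.
    have sp : (s0 <= p)%N.
      by rewrite leqNgt; apply/negP => /r2low; rewrite r2p eqxx.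
    have cp1 : cov p.+1 by apply: contraT => /(r2nc _ sp); rewrite r2p eqxx.
    case: (boolP [exists t, [&& t \in T, s t <= p & p < e t]]%N) => [ex|nex].
      rewrite addnC ltn_addl //=; case/existsP: ex => t /and3P[h1 h2 h3].
      have cp : cov p by apply/covP; exists t => //; rewrite h2 (ltnW h3).
      by rewrite -!r2cov ?(leq_trans sp) // r2p eqxx.
    case/covP: cp1 => t tT /andP[h1 h2].
    have st : s t = p.+1.
      apply/eqP; rewrite eqn_leq h1 ltnNge; apply: contra nex => h3.
      by apply/existsP; exists t; rewrite tT h3 h2.
    rewrite add0n (bigD1 t) /= ?st ?eqxx // tT /=.
    by apply/eqP => tt; move: st; rewrite tt st0 -/s0 => e1; rewrite e1 ltnn in sp.
  rewrite leq_add2l; apply: leq_sum => t _.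
  have := @sum_nat_interval_le lo (lo + h).+1 (s t).-1 (s t).-1.+1 (fun p => s t == p.+1).
  have h1 p : (lo <= p < (lo + h).+1)%N -> s t == p.+1 -> ((s t).-1 <= p < (s t).-1.+1)%N.
    by move=> _ /eqP ->; rewrite leqnn ltnSn.
  by move=> /(_ h1); lia.
pose X : pred nat := fun p => (lo <= p <= lo + h)%N.
pose l2 p := if (lo <= p <= (lo + h).+1)%N then Some (r2 p) else None.
have XS p : shift_set X p = (lo <= p <= (lo + h).+1)%N.
  by rewrite /shift_set /X; case: p => [|p]; lia.
have shift0 p : ~~ shift_set X p -> shift_add w p = 0.
  rewrite /shift_set /shift_add negb_or => /andP[h1 h2].
  have wz q : ~~ X q -> w q = 0 by move=> Xq; apply/eqP; apply: contraR Xq => /supw.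
  by rewrite wz // add0r; case: p h1 h2 => // p _ /wz.
have r2fill p : (lo <= p <= (lo + h).+1)%N -> shift_add w p != 0 -> r2 p = r' p.
  move=> hp /covw[t tT ht]; apply: r2cov.
    by apply: leq_trans (minval_le s tT) _; case/andP: ht.
  by apply/covP; exists t.
have L2 : labelling (shift_set X) (shift_add w) l2.
  move=> p; rewrite XS /l2; case: ifPn => hp; last by [].
  split=> // _ h1; congr Some; rewrite r2fill ?(gt_eqF h1) ?(lt_eqF h1) //.
    by have [+ _] := fill' p hp; apply.
  by have [_] := fill' p hp; move=> /(_ h1) /negbTE.
have w0 p : ~~ X p -> w p = 0 by move=> Xq; apply/eqP; apply: contraR Xq => /supw.
have [|l Ll Hl] := labelling_shift w0 _ L2.
  move=> p; rewrite /X => h1 h2; have -> : p = (lo + h)%N by lia.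
  case: exw => q wq; have h3 := supw q wq; exists q; first by lia.
  by split=> // x; lia.
have lN p : ~~ X p -> l p = None by move=> Xp; case: (Ll p); rewrite Xp => /eqP.
have lS p : X p -> l p = Some (odflt true (l p)).
  by move=> Xp; case: (Ll p); rewrite Xp; case: (l p).
exists (fun p => odflt true (l p)).
  move=> p; case: (boolP (X p)) => Xp; last by rewrite w0 // ltxx.
  by case: (Ll p) => _ /(_ Xp) h1 /(_ Xp) h2; split=> [/h1 ->|/h2 ->].
(* The second unit: by Descartes' rule the product has no more changes than [w], in a window longer
   by one, so [w] has at least one monotone pair fewer. *)
have thin : (nchange l2 lo (lo + h).+1 <= nchange l lo (lo + h))%N.
  apply: nchange_thin; first by rewrite leq_addr.
  - case: (Hl lo) => // -[lo0 e1]; move: e1; rewrite (lN lo.-1); last by rewrite /X; lia.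
    by rewrite /l2 leqnn -addnS leq_addr.
  - case: (Hl (lo + h).+1) => [e1|[_ //]]; move: e1; rewrite (lN (lo + h).+1); last by rewrite /X; lia.
    by rewrite /l2 leqnn andbT -addnS leq_addr.
  - by move=> p _; case: (Hl p) => [|[]]; [left|right].
have c1 : (nmono (fun p => odflt true (l p)) (fun _ => true) lo (lo + h) +
    nchange l lo (lo + h) = (lo + h) - lo)%N.
  by apply: nmono_compl => [|p hp]; [rewrite leq_addr|exact: lS].
have c2 : (nmono r2 (fun _ => true) lo (lo + h).+1 + nchange l2 lo (lo + h).+1 =
    (lo + h).+1 - lo)%N.
  apply: nmono_compl => [|p hp]; first by lia.
  by rewrite /l2 hp.
move: c1 c2 thin mono2; lia.
Qed.

(* A polynomial in [x] and [z], homogenized by [y], is the sequence of its rows: [f j] is the coefficient of [z^j]. Hence [smul] multiplies by [x + y + z]. *)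
Definition smul (F : realFieldType) (f : nat -> {poly F}) (j : nat) : {poly F} :=
  (1 + 'X) * f j + (if j is j'.+1 then f j' else 0).

(* In total degree [D], the exponent of [y] is [D - i - j]. *)
Definition in_tri (A B M D i j : nat) := [&& A <= i, M <= j & i + j + B <= D]%N.

Definition supported (F : realFieldType) (f : nat -> {poly F}) (A B M D : nat) :=
  forall i j, (f j)`_i != 0 -> in_tri A B M D i j.

Lemma coef_smul (F : realFieldType) (f : nat -> {poly F}) j i :
  (smul f j)`_i = (f j)`_i + (if i is i'.+1 then (f j)`_i' else 0) +
    (if j is j'.+1 then (f j')`_i else 0).
Proof.
rewrite coefD coef_1DX_mul /shift_add; congr (_ + _).
by case: j => [|j]; rewrite ?coef0.
Qed.

Lemma supp_mul_N1DX (F : realFieldType) (q : {poly F}) (lo hi e : nat) :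
  (forall p, q`_p != 0 -> (lo <= p <= hi)%N) ->
  forall p, (q * (- (1 + 'X)) ^+ e)`_p != 0 -> (lo <= p <= hi + e)%N.
Proof.
move=> H p; rewrite exprNn mulrCA -signr_odd => h.
apply: (supp_mul_1DX H); move: h.
by case: (odd e); rewrite ?expr1 ?mulN1r ?coefN ?oppr_eq0 // expr0 mul1r.
Qed.

(** The sum evaluates the rows at [z = -(1 + x)], where [x + 1 + z] vanishes; truncation after row
    [n] leaves one boundary term. *)
Lemma smul_telescope (F : realFieldType) (f : nat -> {poly F}) n :
  \sum_(j < n.+1) smul f j * (- (1 + 'X)) ^+ j = (1 + 'X) * f n * (- (1 + 'X)) ^+ n.
Proof.
elim: n => [|n IH]; first by rewrite big_ord1 /smul addr0.
rewrite big_ord_recr /= IH /smul exprS.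
set y := _ ^+ n; move: (f n) (f n.+1) => p q; ring.
Qed.

Lemma smul_eq0 (F : realFieldType) (f : nat -> {poly F}) :
  (forall j, smul f j = 0) -> forall j, f j = 0.
Proof.
move=> H; elim=> [|j IH].
  apply/eqP; have := H 0%N; rewrite /smul addr0 => /eqP.
  by rewrite mulf_eq0 (negbTE (onePX_neq0 F)).
apply/eqP; have := H j.+1; rewrite /smul IH addr0 => /eqP.
by rewrite mulf_eq0 (negbTE (onePX_neq0 F)).
Qed.

Lemma smul_sum (F : realFieldType) (I : finType) (P : pred I)
  (f : I -> nat -> {poly F}) j :
  smul (fun j => \sum_(c | P c) f c j) j = \sum_(c | P c) smul (f c) j.
Proof.
rewrite /smul big_split /= mulr_sumr; congr (_ + _).
by case: j => [|j] //; rewrite big1.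
Qed.

(** Synthetic division by [z - y] with [y = -(1 + x)]: row [j] of the quotient is the sum of
    [g r * y^(r - j - 1)] over [r > j], and the remainder is the value at [z = y]. For [j < M] this
    row times [y^(j + 1)] is that whole value, hence zero, which gives the bound [M] for the
    quotient. *)
Lemma smul_div (F : realFieldType) (g : nat -> {poly F}) (A B M D : nat) :
  supported g A B M D.+1 -> \sum_(j < D.+2) g j * (- (1 + 'X)) ^+ j = 0 ->
  exists2 f, (forall j, smul f j = g j) & supported f A B M D.
Proof.
set y : {poly F} := - (1 + 'X) => sg g0.
have ye : 1 + 'X = - y by rewrite opprK.
pose f j := \sum_(r < D.+2 | (j < r)%N) g r * y ^+ (r - j.+1).
have gbig j : (D.+1 < j)%N -> g j = 0.
  move=> Dj; apply/polyP => i; rewrite coef0; apply/eqP.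
  by apply: contraTT Dj => /sg /and3P[]; lia.
exists f.
  case=> [|j].
    rewrite /smul addr0 ye mulNr mulr_sumr.
    move/eqP: g0; rewrite big_ord_recl /= mulr1 addr_eq0 => /eqP ->; congr (- _).
    rewrite big_mkcond big_ord_recl /= add0r; apply: eq_bigr => r _.
    by rewrite /bump /= add1n subn1 /= mulrCA -exprS.
  rewrite /smul ye mulNr /f mulr_sumr; case: (ltnP j.+1 D.+2) => hj; last first.
    rewrite !big1 ?oppr0 ?addr0 ?gbig //= => r h; have := ltn_ord r; move: h; lia.
  rewrite [X in - _ + X](bigD1 (Ordinal hj)) //= subnn mulr1 addrCA.
  rewrite [X in _ + (_ + X)](eq_big (fun r : 'I_D.+2 => (j.+1 < r)%N) (fun r => y * (g r * y ^+ (r - j.+2)))).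
  - by rewrite addNr addr0.
  - by move=> r /=; rewrite -(inj_eq val_inj) /=; lia.
  move=> r /andP[h1]; rewrite -(inj_eq val_inj) /= => h2.
  by rewrite mulrCA -exprS; congr (_ * _ ^+ _); lia.
move=> i j; rewrite coef_sum => h.
have [r jr hr] : exists2 r : 'I_D.+2, (j < r)%N & (g r * y ^+ (r - j.+1))`_i != 0.
  apply/exists_inP; apply: contraR h => /exists_inPn H.
  by apply/eqP; rewrite big1 // => r /H; rewrite negbK => /eqP.
have sr p : (g r)`_p != 0 -> (A <= p <= D.+1 - B - r)%N.
  by move=> /sg /and3P[]; lia.
have ex : exists p, (g r)`_p != 0.
  have : g r != 0 by apply: contraNneq hr => ->; rewrite mul0r coef0.
  by move=> g0'; exists (size (g r)).-1; rewrite -[_`_ _]/(lead_coef _) lead_coef_eq0.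
case: ex => p /sg /and3P[e1 e2 e3].
have /andP[h1 h2] := supp_mul_N1DX sr hr.
apply/and3P; split=> //; last by lia.
rewrite leqNgt; apply/negP => jM; case/negP: h; apply/eqP.
have gM s : (s < M)%N -> g s = 0.
  move=> sM; apply/polyP => q; rewrite coef0; apply/eqP.
  by apply: contraTT sM => /sg /and3P[]; lia.
suff fj : f j = 0 by rewrite -coef_sum -/(f j) fj coef0.
have yn : y ^+ j.+1 != 0 by rewrite expf_neq0 // oppr_eq0 onePX_neq0.
apply: (mulIf yn); transitivity (\sum_(s < D.+2) g s * y ^+ s); last by rewrite g0 mul0r.
rewrite /f mulr_suml big_mkcond /=; apply: eq_bigr => s _; case: ifP => js; last by rewrite gM ?mul0r //; lia.
by rewrite -mulrA -exprD subnK.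
Qed.

(* On the side at height [L], the triangle [t] meets that side if [hl t = L], in the segment from [s t] to [D - L - o t]. *)
Definition cov_side (I : finType) (S : {set I}) (hl s o : I -> nat) (L D : nat) :
  pred nat := fun p => [exists t, [&& t \in S, hl t == L, s t <= p & p.+1 + L + o t <= D]]%N.

Lemma sum_restrict (X : nat -> bool) (lo hi D : nat) : (hi <= D)%N ->
  (\sum_(0 <= p < D) ((lo <= p < hi) && X p) = \sum_(lo <= p < hi) X p)%N.
Proof.
move=> hD; case: (leqP hi lo) => h.
  by rewrite [RHS]big_geq // big1 // => p _; case: andP => // -[]; lia.
rewrite (big_cat_nat _ (n := lo)) /=; [|lia|lia].
rewrite (big_cat_nat _ (n := hi) (m := lo)) /=; [|lia|lia].
rewrite big_nat_cond big1 ?add0n; last first.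
  by move=> p; rewrite andbT => hp; case: andP => // -[]; lia.
rewrite [X in (_ + X)%N]big_nat_cond [X in (_ + X)%N]big1 ?addn0; last first.
  by move=> p; rewrite andbT => hp; case: andP => // -[]; lia.
by rewrite big_nat_cond [RHS]big_nat_cond; apply: eq_bigr => p; rewrite andbT => ->.
Qed.

(** * One side of the support, all groups together *)

Section SideAssemble.

Variables (F : realFieldType) (I : finType) (S : {set I}) (g : I -> I).
Variables (hl s o : I -> nat) (L D : nat) (v : nat -> F) (w : I -> nat -> F).
Variable r' : nat -> bool.

Let Cs := g @: S.
Let HL c := minval hl (class_of S g c).
Let Sc c := minval s (class_of S g c).
Let Oc c := minval o (class_of S g c).

Hypothesis tri_S : forall t, t \in S -> (hl t + s t + o t <= D.+1)%N.
Hypothesis lineS : forall c, c \in Cs -> (HL c + Sc c + Oc c <= D)%N.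
Hypothesis supp_w : forall c, c \in Cs -> HL c = L -> forall p, w c p != 0 ->
  (Sc c <= p)%N && (p + L + Oc c <= D)%N.
Hypothesis shift_w : forall c, c \in Cs -> HL c = L -> forall p,
  (Sc c <= p)%N -> (p + L + Oc c <= D.+1)%N -> shift_add (w c) p = shift_add v p.
Hypothesis w_eq : forall c, c \in Cs -> HL c = L -> forall p,
  (Sc c <= p)%N -> (p + L + Oc c <= D)%N -> w c p = v p.
Hypothesis cov_w : forall c, c \in Cs -> HL c = L -> forall p,
  shift_add (w c) p != 0 ->
  exists2 t, t \in class_of S g c & [&& hl t == L, s t <= p & p + L + o t <= D.+1]%N.
Hypothesis disjoint_classes : forall c c', c \in Cs -> c' \in Cs -> c != c' ->
  HL c = L -> HL c' = L -> (D.+1 < L + maxn (Sc c) (Sc c') + maxn (Oc c) (Oc c'))%N.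
Hypothesis supp_v : forall p, v p != 0 -> exists2 c, c \in Cs & HL c = L /\ w c p != 0.
Hypothesis v_neq0 : exists p, v p != 0.
Hypothesis fill' : sign_fill (shift_add v) r'.

Let lo c := Sc c.
Let h c := (D - L - Oc c - Sc c)%N.
Let T c := [set t in class_of S g c | hl t == L].

Let hlo c : c \in Cs -> HL c = L -> (lo c + h c + L + Oc c = D)%N.
Proof. by move=> /lineS; rewrite /lo /h => + e; rewrite e; lia. Qed.

Let class_neq0 c : c \in Cs -> class_of S g c != set0.
Proof. by move=> /imsetP[t tS ->]; apply/set0Pn; exists t; rewrite inE tS eqxx. Qed.

Let covC c p := [exists t, [&& t \in T c, s t <= p & p < D.+1 - L - o t]]%N.

Let per_class c : exists r : nat -> bool, c \in Cs -> HL c = L ->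
  sign_fill (w c) r /\
  (nmono r (fun _ => true) (lo c) (lo c + h c) + 1 + [exists p : 'I_D.+1, w c p != 0%R] <=
   nmono r' (covC c) (lo c) (lo c + h c).+1 + #|T c|)%N.
Proof.
have [/andP[cC /eqP HLc]|] := boolP ((c \in Cs) && (HL c == L)); last first.
  by move=> H; exists odd => cC e; rewrite cC e eqxx in H.
have hh := hlo cC HLc.
have T0 : T c != set0.
  have [t tc e] := minval_ex hl (class_neq0 cC).
  by apply/set0Pn; exists t; rewrite inE tc e -HLc eqxx.
have [/existsP[p0 wp0]|/existsPn nw] := boolP [exists p : 'I_D.+1, w c p != 0]; last first.
  exists odd => _ _; have w0 p : w c p = 0.
    apply/eqP; apply: contraT => wp; have := supp_w cC HLc wp => /andP[_ h2].
    have pD : (p < D.+1)%N by lia.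
    by have := nw (Ordinal pD); rewrite wp.
  split; first by move=> p; rewrite w0 ltxx.
  rewrite alternating_nmono; move/set0Pn: T0 => [t tT].
  have : (0 < #|T c|)%N by apply/card_gt0P; exists t.
  by rewrite /=; lia.
have [||||||r fr hr] := @side_nmono F (w c) r' (lo c) (h c) I (T c) s (fun t => D.+1 - L - o t)%N.
- by move=> p /(supp_w cC HLc); move: hh; rewrite /lo; lia.
- by exists p0.
- move=> t; rewrite inE => /andP[tc /eqP ht]; have := minval_le s tc; have := minval_le o tc.
  have tS : t \in S by move: tc; rewrite inE => /andP[].
  by have := tri_S tS; move: hh; rewrite /lo -/(Sc c) -/(Oc c); lia.
- move=> p /(cov_w cC HLc)[t tc /and3P[h1 h2 h3]]; exists t; first by rewrite inE tc h1.
  by rewrite h2 /=; lia.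
- exact: T0.
- by move=> p hp; have := fill' p; rewrite (shift_w cC HLc) //; move: hp hh; rewrite /lo; lia.
by exists r => _ _; split=> //; rewrite /= -addnA.
Qed.

(** A group with nonzero quotient on the side saves two, by [side_nmono]. Any other group saves one:
    it has a contact with its own hull line, and on a zero quotient an alternating filling has no
    monotone pair. Some group is of the first kind because [v] is nonzero, hence the [+ 1]. Disjoint
    hulls ensure that no pair is counted twice. *)
Lemma side_assemble : exists2 r, sign_fill v r &
  (nmono r (cov_side Cs HL Sc Oc L D) 0 D + #|Cs| + 1 <=
   nmono r' (cov_side S hl s o L D.+1) 0 D.+1 +
   \sum_(c in Cs) \sum_(t in class_of S g c) (hl t == HL c))%N.
Proof.
have [rr Hrr] := boolp.choice per_class.
pose inC c p := [&& c \in Cs, HL c == L, Sc c <= p & p + L + Oc c <= D]%N.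
have uniqC c c' p q : inC c p -> inC c' q -> (p <= q <= p.+1)%N -> c = c'.
  move=> /and4P[h1 /eqP h2 h3 h4] /and4P[k1 /eqP k2 k3 k4] pq; apply/eqP; apply: contraT => cc.
  by have := disjoint_classes h1 k1 cc h2 k2; lia.
pose r p := if [pick c | inC c p] is Some c then rr c p else true.
have rE c p : inC c p -> r p = rr c p.
  move=> hc; rewrite /r; case: pickP => [c' hc'|/(_ c)]; last by rewrite hc.
  by rewrite (uniqC _ _ _ _ hc hc') // leqnn leqnSn.
have wD c p : c \in Cs -> HL c = L -> w c p != 0 -> inC c p.
  by move=> h1 h2 /(supp_w h1 h2); rewrite /inC h1 h2 eqxx.
exists r.
  move=> p; case: (eqVneq (v p) 0) => [->|vp]; first by rewrite ltxx.
  have [c cC [HLc wp]] := supp_v vp; have hc := wD _ _ cC HLc wp.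
  rewrite (rE _ _ hc); case/and4P: hc => _ _ h3 h4.
  by have [fr _] := Hrr c cC HLc; have := fr p; rewrite (w_eq cC HLc).
have step1 : (nmono r (cov_side Cs HL Sc Oc L D) 0 D <=
    \sum_(c in Cs | HL c == L) nmono (rr c) (fun _ => true) (lo c) (lo c + h c))%N.
  rewrite [leqRHS](eq_bigr (fun c => \sum_(0 <= p < D)
    ((lo c <= p < lo c + h c) && (rr c p == rr c p.+1)))%N); last first.
    move=> c /andP[cC /eqP HLc]; rewrite sum_restrict //.
    by have := hlo cC HLc; lia.
  rewrite exchange_big /= /nmono; apply: leq_sum => p _.
  case: (boolP (cov_side _ _ _ _ _ _ p)) => //= /existsP[c /and4P[cC /eqP HLc h3 h4]].
  rewrite (bigD1 c) /= ?cC ?HLc ?eqxx // (rE c) ?(rE c p.+1); last 2 first.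
  - by rewrite /inC cC HLc eqxx /=; lia.
  - by rewrite /inC cC HLc eqxx /=; lia.
  have -> : (lo c <= p < lo c + h c)%N by have := hlo cC HLc; rewrite /lo; lia.
  by rewrite leq_addr.
have step2 : (\sum_(c in Cs | HL c == L) nmono r' (covC c) (lo c) (lo c + h c).+1 <=
    nmono r' (cov_side S hl s o L D.+1) 0 D.+1)%N.
  rewrite (eq_bigr (fun c => \sum_(0 <= p < D.+1)
    ((lo c <= p < (lo c + h c).+1) && (covC c p && (r' p == r' p.+1))))%N); last first.
    move=> c /andP[cC /eqP HLc]; rewrite (@sum_restrict (fun p => covC c p && _)) //.
    by have := hlo cC HLc; lia.
  rewrite exchange_big /= /nmono; apply: leq_sum => p _.
  case: (boolP [exists c, [&& c \in Cs, HL c == L & (lo c <= p < (lo c + h c).+1) && covC c p]]%N)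
    => [/existsP[c /and3P[cC HLc /andP[h1 h2]]]|/existsPn H]; last first.
    rewrite big1 // => c /andP[cC HLc]; have := H c; rewrite cC HLc /= andbA.
    by move=> /negbTE ->.
  rewrite (bigD1 c) /= ?cC // big1 ?addn0.
    case/existsP: h2 => t /and3P[tT h2 h3].
    have -> : cov_side S hl s o L D.+1 p.
      apply/existsP; exists t; move: tT; rewrite 2!inE => /andP[/andP[-> _] ->] /=.
      by lia.
    by case: (r' p == r' p.+1); rewrite ?andbF ?andbT ?leq_b1.
  move=> c' /andP[/andP[c'C /eqP HLc'] cc']; case: (boolP (lo c' <= p < _)%N) => //= h4.
  have := disjoint_classes cC c'C; rewrite eq_sym cc' (eqP HLc) HLc' => /(_ isT erefl erefl).
  by have := hlo cC (eqP HLc); have := hlo c'C HLc'; move: h1 h4; rewrite /lo; lia.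
have step3 : (\sum_(c in Cs | HL c == L) nmono (rr c) (fun _ => true) (lo c) (lo c + h c) +
   #|Cs| + 1 <= \sum_(c in Cs | HL c == L) nmono r' (covC c) (lo c) (lo c + h c).+1 +
   \sum_(c in Cs) \sum_(t in class_of S g c) (hl t == HL c))%N.
  have pos c : c \in Cs -> (0 < \sum_(t in class_of S g c) (hl t == HL c))%N.
    move=> /class_neq0 /(minval_ex hl)[t tc e]; rewrite (bigD1 t) //= e eqxx //.
  have eT c : HL c = L -> (#|T c| = \sum_(t in class_of S g c) (hl t == HL c))%N.
    move=> e; rewrite -sum1_card e (eq_bigl (fun t => (t \in class_of S g c) && (hl t == L))).
      by rewrite big_mkcondr; apply: eq_bigr => t _; case: eqP.
    by move=> t; rewrite inE.
  have [p0 vp0] := v_neq0; have [c0 c0C [HLc0 wp0]] := supp_v vp0.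
  have -> : (#|Cs| = \sum_(c in Cs | HL c == L) 1 + \sum_(c in Cs | HL c != L) 1)%N.
    by rewrite -sum1_card (bigID (fun c => HL c == L)).
  rewrite [X in (_ <= _ + X)%N](bigID (fun c => HL c == L)) /=.
  have out : (\sum_(c in Cs | HL c != L) 1 <=
     \sum_(c in Cs | HL c != L) \sum_(t in class_of S g c) (hl t == HL c))%N.
    by apply: leq_sum => c /andP[/pos].
  suff : (\sum_(c in Cs | HL c == L) (nmono (rr c) (fun _ => true) (lo c) (lo c + h c) + 1) + 1 <=
    \sum_(c in Cs | HL c == L) (nmono r' (covC c) (lo c) (lo c + h c).+1 +
      \sum_(t in class_of S g c) (hl t == HL c)))%N.
    by rewrite !big_split /=; move: out; lia.
  rewrite (bigD1 c0) /= ?c0C ?HLc0 ?eqxx // [leqRHS](bigD1 c0) /= ?c0C ?HLc0 ?eqxx //.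
  rewrite -addnA [X in (_ + X)%N]addnC addnA; apply: leq_add.
    have [_] := Hrr c0 c0C HLc0; rewrite (eT _ HLc0).
    have -> : [exists p : 'I_D.+1, w c0 p != 0].
      have pD : (p0 < D.+1)%N by have := supp_w c0C HLc0 wp0; lia.
      by apply/existsP; exists (Ordinal pD).
    by rewrite /= HLc0.
  apply: leq_sum => c /andP[/andP[cC /eqP HLc] _].
  have [_] := Hrr c cC HLc; rewrite (eT _ HLc).
  by apply: leq_trans; rewrite leq_addr.
by move: step1 step2 step3; lia.
Qed.

End SideAssemble.

Definition side_x (F : realFieldType) (f : nat -> {poly F}) (L : nat) (j : nat) : F :=
  (f j)`_L.
Definition side_y (F : realFieldType) (f : nat -> {poly F}) (L D : nat) (j : nat) : F :=
  if (j + L <= D)%N then (f j)`_(D - L - j) else 0.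
Definition side_z (F : realFieldType) (f : nat -> {poly F}) (L : nat) (i : nat) : F :=
  (f L)`_i.

(** Coefficients further out than the line [A] are zero, so on this line multiplication by
    [x + y + z] acts as multiplication by [y + z]. *)
Lemma shift_side_x (F : realFieldType) (f : nat -> {poly F}) A B M D p :
  supported f A B M D -> shift_add (side_x f A) p = side_x (smul f) A p.
Proof.
move=> sf; rewrite /side_x coef_smul /shift_add; case: A sf => [|A] sf; first by rewrite addr0.
suff -> : (f p)`_A = 0 by rewrite addr0.
by apply/eqP; apply: contraT => /sf /and3P[]; rewrite ltnn.
Qed.

Lemma shift_side_y (F : realFieldType) (f : nat -> {poly F}) A B M D p :
  supported f A B M D -> shift_add (side_y f B D) p = side_y (smul f) B D.+1 p.
Proof.
move=> sf; have z i j : (D < i + j + B)%N -> (f j)`_i = 0.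
  by move=> h; apply/eqP; apply: contraTT h => /sf /and3P[]; rewrite -leqNgt.
rewrite /side_y coef_smul /shift_add; case: (leqP (p + B) D.+1) => h; last first.
  rewrite leqNgt (ltn_trans _ h) //= add0r; case: p h => // p h.
  by rewrite leqNgt; have -> : (D < p + B)%N by lia.
rewrite (z (D.+1 - B - p)%N p) ?add0r; last by lia.
congr (_ + _).
  case: (leqP (p + B) D) => h2; first by have -> : (D.+1 - B - p = (D - B - p).+1)%N by lia.
  by have -> : (D.+1 - B - p = 0)%N by lia.
case: p h => // p h; have -> : (p + B <= D)%N by lia.
by congr ((f p)`_ _); lia.
Qed.

Lemma shift_side_z (F : realFieldType) (f : nat -> {poly F}) A B M D p :
  supported f A B M D -> shift_add (side_z f M) p = side_z (smul f) M p.
Proof.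
move=> sf; rewrite /side_z coef_smul /shift_add; case: M sf => [|M] sf; first by rewrite addr0.
suff -> : (f M)`_p = 0 by rewrite addr0.
by apply/eqP; apply: contraT => /sf /and3P[_]; rewrite ltnn.
Qed.

Lemma supported_smul (F : realFieldType) (f : nat -> {poly F}) A B M D :
  supported f A B M D -> supported (smul f) A B M D.+1.
Proof.
move=> sf i j; rewrite coef_smul => h; apply: contraT => nt.
have z i' j' : (i' <= i)%N -> (j' <= j)%N -> (i + j <= i' + j' + 1)%N -> (f j')`_i' = 0.
  move=> hi hj hij; apply/eqP; apply: contraR nt => /sf /and3P[h1 h2 h3].
  by apply/and3P; split; lia.
by move: h; rewrite z //; [case: i j nt z => [|i] [|j] nt z; rewrite ?z ?addr0 ?eqxx //; lia | lia].
Qed.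

(* The last condition bounds the cost of a cover by triangles: a triangle of size k costs k + 2, and on each of the three sides of the support one pays for the adjacent pairs inside a common triangle whose signs agree. *)
Definition cover (F : realFieldType) (D : nat) (f : nat -> {poly F}) (lx ly lz c : nat) :=
  exists (I : finType) (S : {set I}) (a b m : I -> nat) (rx ry rz : nat -> bool),
  [/\ forall t, t \in S -> [&& lx <= a t, ly <= b t, lz <= m t & a t + b t + m t <= D]%N,
      forall i j, (f j)`_i != 0 -> exists2 t, t \in S & in_tri (a t) (b t) (m t) D i j,
      [/\ sign_fill (side_x f lx) rx, sign_fill (side_y f ly D) ry
        & sign_fill (side_z f lz) rz] &
      (\sum_(t in S) (D - (a t + b t + m t) + 2) +
       (nmono rx (cov_side S a m b lx D) 0 D + nmono ry (cov_side S b m a ly D) 0 D +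
        nmono rz (cov_side S m a b lz D) 0 D) <= c)%N].

Lemma eq_sign_fill (F : realFieldType) (v v' : nat -> F) r :
  v =1 v' -> sign_fill v r -> sign_fill v' r.
Proof. by move=> e H p; rewrite -e; apply: H. Qed.

Lemma nmono_sub r (c c' : nat -> bool) lo hi : (forall p, c p -> c' p) ->
  (nmono r c lo hi <= nmono r c' lo hi)%N.
Proof.
move=> H; apply: leq_sum => p _; case e: (c p) => //=; first by rewrite (H p e).
Qed.

(** * Dividing a cover by x + y + z *)

Section Growth.

Variables (F : realFieldType) (D : nat) (f : nat -> {poly F}) (lx ly lz : nat).
Variables (I : finType) (S : {set I}) (a b m : I -> nat) (rx ry rz : nat -> bool).

Let g := smul f.

Hypothesis supp_f : supported f lx ly lz D.
Hypothesis neq_x : exists p, side_x f lx p != 0.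
Hypothesis neq_y : exists p, side_y f ly D p != 0.
Hypothesis neq_z : exists p, side_z f lz p != 0.
Hypothesis tri_S : forall t, t \in S ->
  [&& lx <= a t, ly <= b t, lz <= m t & a t + b t + m t <= D.+1]%N.
Hypothesis cov_S : forall i j, (g j)`_i != 0 ->
  exists2 t, t \in S & in_tri (a t) (b t) (m t) D.+1 i j.
Hypothesis fill_x : sign_fill (side_x g lx) rx.
Hypothesis fill_y : sign_fill (side_y g ly D.+1) ry.
Hypothesis fill_z : sign_fill (side_z g lz) rz.

Let y : {poly F} := - (1 + 'X).
(** Triangles may overlap; giving each monomial to a single triangle that contains it splits [g]
    into the polynomials [part t]. *)
Let owner i j := [pick t | (t \in S) && in_tri (a t) (b t) (m t) D.+1 i j].
Let part t j : {poly F} :=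
  \poly_(i < D.+2) (if owner i j == Some t then (g j)`_i else 0).
Let S0 := [set t in S | [exists i : 'I_D.+2, exists j : 'I_D.+2, (part t j)`_i != 0]].
Let k t := (D.+1 - (a t + b t + m t))%N.
(** The value of [part t] at [z = y], divided by [(1 + x)^(m t)]; the sign comes from [y^(m t)]. *)
Let u t : {poly F} := (-1) ^+ m t * \sum_(j < D.+2) part t j * y ^+ (j - m t).

Let supp_g : supported g lx ly lz D.+1.
Proof. exact: supported_smul. Qed.

Let coef_part t i j : (part t j)`_i = if owner i j == Some t then (g j)`_i else 0.
Proof.
rewrite coef_poly; case: ltnP => // h; case: ifP => // _; apply/esym/eqP.
by apply: contraTT h => /supp_g /and3P[]; lia.
Qed.

Let ownerP i j t : owner i j = Some t -> t \in S /\ in_tri (a t) (b t) (m t) D.+1 i j.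
Proof. by rewrite /owner; case: pickP => // t' /andP[h1 h2] [<-]. Qed.

Let supp_part t : supported (part t) (a t) (b t) (m t) D.+1.
Proof.
move=> i j; rewrite coef_part; case: ifP => [/eqP /ownerP[]//|_].
by rewrite eqxx.
Qed.

Let part_S0 t i j : (part t j)`_i != 0 -> t \in S0.
Proof.
move=> h; have /and3P[h1 h2 h3] := supp_part h.
have iD : (i < D.+2)%N by lia. have jD : (j < D.+2)%N by lia.
rewrite inE; apply/andP; split.
  by move: h; rewrite coef_part; case: ifP => [/eqP /ownerP[]//|]; rewrite eqxx.
by apply/existsP; exists (Ordinal iD); apply/existsP; exists (Ordinal jD).
Qed.

Let S0S : S0 \subset S.
Proof. by apply/subsetP => t; rewrite inE => /andP[]. Qed.

Let size_S0 t : t \in S0 -> (a t + b t + m t + k t = D.+1)%N.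
Proof. by move=> /(subsetP S0S) /tri_S /and4P[]; rewrite /k; lia. Qed.

Let sum_part (J : {set I}) t i j : t \in J -> (part t j)`_i != 0 ->
  (\sum_(t in J) part t j)`_i = (g j)`_i.
Proof.
move=> tJ; rewrite coef_part; case: ifP => [/eqP e|]; last by rewrite eqxx.
move=> _; rewrite coef_sum (bigD1 t) //= coef_part e eqxx big1 ?addr0 // => s /andP[_ st].
by rewrite coef_part e; case: eqP => // -[] e'; rewrite e' eqxx in st.
Qed.

Let sum_part_neq0 (J : {set I}) i j : (\sum_(t in J) part t j)`_i != 0 ->
  exists2 t, t \in J & (part t j)`_i != 0.
Proof.
rewrite coef_sum => h; apply/exists_inP; apply: contraR h => /exists_inPn H.
by apply/eqP; rewrite big1 // => t /H; rewrite negbK => /eqP.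
Qed.

Let sum_S0 j : \sum_(t in S0) part t j = g j.
Proof.
apply/polyP => i; case: (eqVneq (g j)`_i 0) => [e|h].
  by rewrite e coef_sum big1 // => t _; rewrite coef_part e; case: ifP.
have [t ot] : exists t, owner i j = Some t.
  rewrite /owner; case: pickP => [t _|H]; first by exists t.
  by case: (cov_S h) => t tS ht; have := H t; rewrite tS ht.
have pt : (part t j)`_i != 0 by rewrite coef_part ot eqxx.
exact: sum_part (part_S0 pt) pt.
Qed.

Let uE t : u t * (1 + 'X) ^+ m t = \sum_(j < D.+2) part t j * y ^+ j.
Proof.
have ye : 1 + 'X = - y :> {poly F} by rewrite opprK.
rewrite /u ye mulrAC -exprMn mulN1r opprK mulrC mulr_suml.
apply: eq_bigr => j _; case: (leqP (m t) j) => h; first by rewrite -mulrA -exprD subnK.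
suff -> : part t j = 0 by rewrite !mul0r.
by apply/polyP => i; rewrite coef0; apply/eqP; apply: contraTT h => /supp_part /and3P[]; rewrite -leqNgt.
Qed.

Let supp_u t : t \in S0 -> forall p, (u t)`_p != 0 -> (a t <= p <= a t + k t)%N.
Proof.
move=> tS p h; have {h} : (\sum_(j < D.+2) part t j * y ^+ (j - m t))`_p != 0.
  move: h; rewrite /u -signr_odd.
  by case: (odd _); rewrite ?expr1 ?mulN1r ?coefN ?oppr_eq0 // expr0 mul1r.
rewrite coef_sum => h.
have [j hj] : exists j : 'I_D.+2, (part t j * y ^+ (j - m t))`_p != 0.
  apply/existsP; apply: contraR h => /existsPn H.
  by apply/eqP; rewrite big1 // => j _; have := H j; rewrite negbK => /eqP.
have sj q : (part t j)`_q != 0 -> (a t <= q <= D.+1 - b t - j)%N.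
  by move=> /supp_part /and3P[]; lia.
have /andP[h1 h2] := supp_mul_N1DX sj hj.
have [q] : exists q, (part t j)`_q != 0.
  have : part t j != 0 by apply: contraNneq hj => ->; rewrite mul0r coef0.
  by move=> h'; exists (size (part t j)).-1; rewrite -[_`_ _]/(lead_coef _) lead_coef_eq0.
by move=> /supp_part /and3P[]; have := size_S0 tS; lia.
Qed.

(** The right-hand side is the value at [z = -(1 + x)], so the vanishing sums are the groups whose
    part of [g] is divisible by [x + y + z]. *)
Let zero_sumE (J : {set I}) : zero_sum m u J =
  (\sum_(j < D.+2) (\sum_(t in J) part t j) * y ^+ j == 0).
Proof.
rewrite /zero_sum; congr (_ == _); rewrite (eq_bigr _ (fun t _ => uE t)) exchange_big /=.
by apply: eq_bigr => j _; rewrite mulr_suml.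
Qed.

Let zero_sum_S0 : zero_sum m u S0.
Proof.
rewrite zero_sumE (eq_bigr (fun j : 'I_D.+2 => g j * y ^+ j)) => [|j _]; last by rewrite sum_S0.
rewrite smul_telescope; suff -> : f D.+1 = 0 by rewrite mulr0 mul0r.
apply/polyP => i; rewrite coef0; apply/eqP; apply: contraT => /supp_f /and3P[_ _]; lia.
Qed.

Let divide (J : {set I}) : zero_sum m u J ->
  exists2 h, (forall j, smul h j = \sum_(t in J) part t j) &
    supported h (minval a J) (minval b J) (minval m J) D.
Proof.
rewrite zero_sumE => /eqP z; apply: smul_div => // i j /sum_part_neq0[t tJ /supp_part].
move=> /and3P[h1 h2 h3]; have := minval_le a tJ; have := minval_le b tJ.
by have := minval_le m tJ => e1 e2 e3; apply/and3P; split; lia.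
Qed.

(** A hull reduced to a point in degree [D + 1] has no room for a quotient of degree [D]; but the
    quotient is nonzero, since every triangle of [S0] owns a monomial of [g]. *)
Let nondeg (J : {set I}) : J \subset S0 -> J != set0 -> zero_sum m u J ->
  (minval a J + minval b J + minval m J < D.+1)%N.
Proof.
move=> sJ /set0Pn[t tJ] /divide[h hE sh].
have := subsetP sJ t tJ; rewrite inE => /andP[_ /existsP[i /existsP[j pij]]].
have : (smul h j)`_i != 0.
  rewrite hE (sum_part tJ pij); move: pij; rewrite coef_part; case: ifP => //.
  by rewrite eqxx.
have nz : (exists i' j', (h j')`_i' != 0) ->
    (minval a J + minval b J + minval m J < D.+1)%N.
  by move=> [i' [j' /sh /and3P[]]]; lia.
rewrite coef_smul => hh; apply: nz.
case: (eqVneq (h j)`_i 0) hh => [->|h1 _]; last by exists i; exists j.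
rewrite add0r; case: (nat_of_ord i) => [|i'].
  by rewrite add0r; case: (nat_of_ord j) => [|j'] h1; [rewrite eqxx in h1|exists 0%N; exists j'].
case: (eqVneq (h j)`_i' 0) => [->|h1 _]; last by exists i'; exists j.
by rewrite add0r; case: (nat_of_ord j) => [|j'] h1; [rewrite eqxx in h1|exists i'.+1; exists j'].
Qed.

Lemma growth_step : exists2 c', (c' + 4 <=
    \sum_(t in S) (D.+1 - (a t + b t + m t) + 2) +
       (nmono rx (cov_side S a m b lx D.+1) 0 D.+1 +
        nmono ry (cov_side S b m a ly D.+1) 0 D.+1 +
        nmono rz (cov_side S m a b lz D.+1) 0 D.+1))%N & cover D f lx ly lz c'.
Proof.
have [cl [Hgood Hsep]] := separated_classes size_S0 supp_u nondeg zero_sum_S0.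
pose Cs := cl @: S0; pose J c := class_of S0 cl c.
pose A c := minval a (J c); pose B c := minval b (J c); pose M c := minval m (J c).
have JS c : J c \subset S0 by apply/subsetP => t; rewrite inE => /andP[].
have goodJ c : c \in Cs -> good a b m k u D.+1 (J c) by apply: Hgood.
have hull c : c \in Cs -> (A c + B c + M c <= D)%N.
  by move=> /goodJ[n0 z0 _]; rewrite -ltnS; apply: nondeg.
have lineA c : c \in Cs -> [&& lx <= A c, ly <= B c & lz <= M c]%N.
  move=> /goodJ[n0 _ _]; apply/and3P; split; apply: minval_ge => // t /(subsetP (JS c));
  by move=> /(subsetP S0S) /tri_S /and4P[].
have [Fc HF] : exists Fc : I -> nat -> {poly F}, forall c, c \in Cs ->
    (forall j, smul (Fc c) j = \sum_(t in J c) part t j) /\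
    supported (Fc c) (A c) (B c) (M c) D.
  have [|Fc HF] := boolp.choice (P := fun c (h : nat -> {poly F}) => c \in Cs ->
      (forall j, smul h j = \sum_(t in J c) part t j) /\ supported h (A c) (B c) (M c) D).
    move=> c; have [/goodJ[_ /divide[h h1 h2] _]|nc] := boolP (c \in Cs); first by exists h.
    by exists f.
  by exists Fc.
have suppF c : c \in Cs -> supported (Fc c) (A c) (B c) (M c) D by move=> /HF[].
have smulF c j : c \in Cs -> smul (Fc c) j = \sum_(t in J c) part t j by move=> /HF[].
have part_classes (V : nmodType) (G : I -> V) :
    \sum_(t in S0) G t = \sum_(c in Cs) \sum_(t in J c) G t.
  rewrite (partition_big_imset cl) /=; apply: eq_bigr => c _.
  by apply: eq_bigl => t; rewrite [RHS]inE.
have fE j : f j = \sum_(c in Cs) Fc c j.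
  apply/eqP; rewrite -subr_eq0; apply/eqP; move: j.
  apply: smul_eq0 => j; have -> : smul (fun j => f j - \sum_(c in Cs) Fc c j) j =
      smul f j - smul (fun j => \sum_(c in Cs) Fc c j) j.
    rewrite /smul; case: j => [|j]; first by rewrite !addr0 mulrBr.
    by rewrite mulrBr opprD addrACA.
  rewrite smul_sum (eq_bigr _ (fun c cC => smulF c j cC)) -part_classes sum_S0.
  by rewrite subrr.
(* The hulls are disjoint already in degree [D + 1]; therefore both [f] and [g] restrict on each
   hull to the contribution of its group. *)
have sep c c' i j : c \in Cs -> c' \in Cs -> in_tri (A c) (B c) (M c) D.+1 i j ->
    in_tri (A c') (B c') (M c') D.+1 i j -> c = c'.
  move=> cC cC' /and3P[h1 h2 h3] /and3P[k1 k2 k3]; apply/eqP; apply: contraT => cc.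
  have := Hsep c c' cC cC' cc; rewrite -/(J c) -/(J c') -/(A c) -/(A c') -/(B c) -/(B c') -/(M c) -/(M c'). lia.
have tri_up c i j : in_tri (A c) (B c) (M c) D i j -> in_tri (A c) (B c) (M c) D.+1 i j.
  by move=> /and3P[h1 h2 h3]; apply/and3P; split=> //; apply: leqW.
have f_on c i j : c \in Cs -> in_tri (A c) (B c) (M c) D i j -> (Fc c j)`_i = (f j)`_i.
  move=> cC h; rewrite fE coef_sum (bigD1 c) //= big1 ?addr0 // => c' /andP[cC' cc].
  apply/eqP; apply: contraNT cc => /(suppF _ cC') h'.
  by rewrite (sep _ _ _ _ cC' cC (tri_up _ _ _ h') (tri_up _ _ _ h)).
have g_on c i j : c \in Cs -> in_tri (A c) (B c) (M c) D.+1 i j ->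
    (smul (Fc c) j)`_i = (g j)`_i.
  move=> cC h; have -> : g j = \sum_(c in Cs) smul (Fc c) j.
    by rewrite (eq_bigr _ (fun c cC => smulF c j cC)) -part_classes sum_S0.
  rewrite coef_sum (bigD1 c) //= big1 ?addr0 // => c' /andP[cC' cc].
  apply/eqP; apply: contraNT cc => /(supported_smul (suppF _ cC')) h'.
  by rewrite (sep _ _ _ _ cC' cC h' h).
have f_class i j : (f j)`_i != 0 -> exists2 c, c \in Cs & (Fc c j)`_i != 0.
  rewrite fE coef_sum => h; apply/exists_inP; apply: contraR h => /exists_inPn H.
  by apply/eqP; rewrite big1 // => c /H; rewrite negbK => /eqP.
have part_t c i j : c \in Cs -> (smul (Fc c) j)`_i != 0 ->
    exists2 t, t \in J c & [&& lx <= a t, ly <= b t, lz <= m t & in_tri (a t) (b t) (m t) D.+1 i j]%N.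
  move=> cC; rewrite smulF // => /sum_part_neq0[t tJ /supp_part h]; exists t => //.
  have /tri_S /and4P[-> -> ->] : t \in S by apply/(subsetP S0S)/(subsetP (JS c)).
  by rewrite h.
have triS0 t : t \in S0 -> (a t + b t + m t <= D.+1)%N.
  by move=> /(subsetP S0S) /tri_S /and4P[].
have [r1 fr1 hr1] : exists2 r, sign_fill (side_x f lx) r &
  (nmono r (cov_side Cs A M B lx D) 0 D + #|Cs| + 1 <=
   nmono rx (cov_side S0 a m b lx D.+1) 0 D.+1 +
   \sum_(c in Cs) \sum_(t in J c) (a t == A c))%N.
  apply: (@side_assemble _ _ _ _ _ _ _ _ _ _ (fun c => side_x (Fc c) lx)).
  - by move=> t /triS0; rewrite addnAC.
  - by move=> c /hull; rewrite addnAC.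
  - move=> c cC _ p /(suppF c cC) /and3P[h1 h2 h3].
    by rewrite -/(M c) -/(B c) h2; lia.
  - move=> c cC; rewrite -/(A c) -/(M c) -/(B c) => Ac p h1 h2.
    rewrite (shift_side_x p supp_f) -[in LHS]Ac (shift_side_x p (suppF c cC)) Ac.
    by apply: g_on => //; apply/and3P; split=> //; [rewrite Ac|lia].
  - move=> c cC; rewrite -/(A c) -/(M c) -/(B c) => Ac p h1 h2.
    by apply: f_on => //; apply/and3P; split=> //; [rewrite Ac|lia].
  - move=> c cC; rewrite -/(A c) => Ac p.
    rewrite -[in side_x _ _]Ac (shift_side_x p (suppF c cC)) => h.
    have [t tJ /and4P[h1 h2 h3 /and3P[h4 h5 h6]]] := part_t _ _ _ cC h.
    by exists t => //; rewrite h5 /=; move: h4 h6; rewrite Ac; lia.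
  - move=> c c' cC cC' cc; have := Hsep c c' cC cC' cc => + Ac Ac'.
    by rewrite Ac Ac' maxnn addnAC.
  - move=> p /f_class[c cC h]; exists c => //; split=> //.
    have /and3P[h1 _ _] := suppF c cC _ _ h; have /and3P[k1 _ _] := lineA c cC.
    by apply/eqP; rewrite -/(A c) eqn_leq h1 k1.
  - exact: neq_x.
  - by apply: eq_sign_fill fill_x => p; rewrite (shift_side_x p supp_f).
have [r2 fr2 hr2] : exists2 r, sign_fill (side_y f ly D) r &
  (nmono r (cov_side Cs B M A ly D) 0 D + #|Cs| + 1 <=
   nmono ry (cov_side S0 b m a ly D.+1) 0 D.+1 +
   \sum_(c in Cs) \sum_(t in J c) (b t == B c))%N.
  apply: (@side_assemble _ _ _ _ _ _ _ _ _ _ (fun c => side_y (Fc c) ly D)).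
  - by move=> t /triS0; lia.
  - by move=> c /hull; rewrite -/(A c) -/(B c) -/(M c); lia.
  - move=> c cC _ p; rewrite /side_y; case: leqP => h0 h; last by rewrite eqxx in h.
    have /and3P[h1 h2 h3] := suppF c cC _ _ h.
    by rewrite -/(M c) -/(A c) h2; lia.
  - move=> c cC; rewrite -/(A c) -/(M c) -/(B c) => Bc p h1 h2.
    rewrite (shift_side_y p supp_f) -[in LHS]Bc (shift_side_y p (suppF c cC)) Bc.
    rewrite /side_y; have -> : (p + ly <= D.+1)%N by lia.
    by apply: g_on => //; apply/and3P; split=> //; lia.
  - move=> c cC; rewrite -/(A c) -/(M c) -/(B c) => Bc p h1 h2.
    rewrite /side_y; have -> : (p + ly <= D)%N by lia.
    by apply: f_on => //; apply/and3P; split=> //; lia.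
  - move=> c cC; rewrite -/(B c) => Bc p.
    rewrite -[in side_y _ _ _]Bc (shift_side_y p (suppF c cC)) Bc /side_y.
    case: leqP => h0 h; last by rewrite eqxx in h.
    have [t tJ /and4P[h1 h2 h3 /and3P[h4 h5 h6]]] := part_t _ _ _ cC h.
    by exists t => //; rewrite h5 /=; move: h4 h6; lia.
  - move=> c c' cC cC' cc; have := Hsep c c' cC cC' cc => + Bc Bc'.
    by rewrite Bc Bc' maxnn; lia.
  - move=> p; rewrite {1}/side_y; case: leqP => h0 h; last by rewrite eqxx in h.
    have [c cC h'] := f_class _ _ h; exists c => //.
    have /and3P[h1 h2 h3] := suppF c cC _ _ h'; have /and3P[_ k1 _] := lineA c cC.
    by rewrite /side_y h0; split=> //; rewrite -/(B c); lia.
  - exact: neq_y.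
  - by apply: eq_sign_fill fill_y => p; rewrite (shift_side_y p supp_f).
have [r3 fr3 hr3] : exists2 r, sign_fill (side_z f lz) r &
  (nmono r (cov_side Cs M A B lz D) 0 D + #|Cs| + 1 <=
   nmono rz (cov_side S0 m a b lz D.+1) 0 D.+1 +
   \sum_(c in Cs) \sum_(t in J c) (m t == M c))%N.
  apply: (@side_assemble _ _ _ _ _ _ _ _ _ _ (fun c => side_z (Fc c) lz)).
  - by move=> t /triS0; lia.
  - by move=> c /hull; rewrite -/(A c) -/(B c) -/(M c); lia.
  - move=> c cC _ p /(suppF c cC) /and3P[h1 h2 h3].
    by rewrite -/(A c) -/(B c) h1.
  - move=> c cC; rewrite -/(A c) -/(M c) -/(B c) => Mc p h1 h2.
    rewrite (shift_side_z p supp_f) -[in LHS]Mc (shift_side_z p (suppF c cC)) Mc.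
    by apply: g_on => //; apply/and3P; split=> //; rewrite Mc.
  - move=> c cC; rewrite -/(A c) -/(M c) -/(B c) => Mc p h1 h2.
    by apply: f_on => //; apply/and3P; split=> //; rewrite Mc.
  - move=> c cC; rewrite -/(M c) => Mc p.
    rewrite -[in side_z _ _]Mc (shift_side_z p (suppF c cC)) => h.
    have [t tJ /and4P[h1 h2 h3 /and3P[h4 h5 h6]]] := part_t _ _ _ cC h.
    by exists t => //; rewrite h4 /=; move: h5 h6; rewrite Mc; lia.
  - move=> c c' cC cC' cc; have := Hsep c c' cC cC' cc => + Mc Mc'.
    by rewrite Mc Mc' maxnn; lia.
  - move=> p /f_class[c cC h]; exists c => //; split=> //.
    have /and3P[_ h1 _] := suppF c cC _ _ h; have /and3P[_ _ k1] := lineA c cC.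
    by apply/eqP; rewrite -/(M c) eqn_leq h1 k1.
  - exact: neq_z.
  - by apply: eq_sign_fill fill_z => p; rewrite (shift_side_z p supp_f).
pose newcost := (\sum_(c in Cs) (D - (A c + B c + M c) + 2) +
   (nmono r1 (cov_side Cs A M B lx D) 0 D + nmono r2 (cov_side Cs B M A ly D) 0 D +
    nmono r3 (cov_side Cs M A B lz D) 0 D))%N.
exists newcost; last first.
  exists I, Cs, A, B, M, r1, r2, r3; split=> //.
  - by move=> c cC; have /and3P[-> -> ->] := lineA c cC; rewrite hull.
  - by move=> i j /f_class[c cC h]; exists c => //; apply: suppF.
(* Each of the three sides saves [#|Cs| + 1] up to contacts. The contacts are paid by [good], whose
   [+ 1] is absorbed by the drop from degree [D + 1] to [D], and each hull costs 2 besides its size.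
   In all [#|Cs| + 3] is saved, at least 4. *)
have Cs0 : (0 < #|Cs|)%N.
  have [p] := neq_x; rewrite /side_x => /f_class[c cC _].
  by apply/card_gt0P; exists c.
have sub_cov hl s o L : forall p, cov_side S0 hl s o L D.+1 p -> cov_side S hl s o L D.+1 p.
  move=> p /existsP[t /and4P[h1 h2 h3 h4]]; apply/existsP; exists t.
  by rewrite (subsetP S0S) ?h2 ?h3.
have m1 := nmono_sub rx 0 D.+1 (sub_cov a m b lx).
have m2 := nmono_sub ry 0 D.+1 (sub_cov b m a ly).
have m3 := nmono_sub rz 0 D.+1 (sub_cov m a b lz).
have c1 : (\sum_(t in S0) (k t + 2) <= \sum_(t in S) (D.+1 - (a t + b t + m t) + 2))%N.
  by rewrite [leqRHS](big_setID S0) /= (setIidPr S0S) leq_addr.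
have c2 : (\sum_(c in Cs) (D - (A c + B c + M c)) +
   (\sum_(c in Cs) \sum_(t in J c) (a t == A c) + \sum_(c in Cs) \sum_(t in J c) (b t == B c) +
    \sum_(c in Cs) \sum_(t in J c) (m t == M c)) <= \sum_(t in S0) (k t + 2))%N.
  have -> : (\sum_(t in S0) (k t + 2) = \sum_(c in Cs) \sum_(t in J c) (k t + 2))%N.
    rewrite (partition_big_imset cl) /=; apply: eq_bigr => c _.
    by apply: eq_bigl => t; rewrite [RHS]inE.
  rewrite -!big_split /=; apply: leq_sum => c cC.
  have [_ _] := goodJ c cC; have := hull c cC.
  rewrite /touching !big_split /= -[minval a (J c)]/(A c) -[minval b (J c)]/(B c).
  by rewrite -[minval m (J c)]/(M c); lia.
have c3 : (\sum_(c in Cs) (D - (A c + B c + M c) + 2) =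
   \sum_(c in Cs) (D - (A c + B c + M c)) + 2 * #|Cs|)%N.
  by rewrite big_split /= sum_nat_const mulnC.
by rewrite /newcost; move: hr1 hr2 hr3; lia.
Qed.

End Growth.

(** * Adding monomials to a cover *)

Lemma sum_select (n x c : nat) :
  (\sum_(0 <= i < n) (if i == x then c else 0) = if x < n then c else 0)%N.
Proof.
elim: n => [|n IH]; first by rewrite big_geq.
rewrite big_nat_recr //= IH; case: (ltngtP n x) => h.
- by rewrite leqNgt ltnS h.
- by rewrite ltnS (ltnW h) addn0.
- by rewrite h ltnSn.
Qed.

(** If [L < L'], the new side meets no triangle and costs nothing. Otherwise the old signs are kept
    where nothing changed, and a changed position spoils at most its two adjacent pairs, which count
    only if covered. *)
Lemma side_update (F : realFieldType) (I : finType) (S : {set I}) (hl s o : I -> nat)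
  (L L' D : nat) (v v' : nat -> F) (r' : nat -> bool) (ch : nat -> bool) :
  (forall t, t \in S -> (L' <= hl t)%N) -> (L <= L')%N ->
  sign_fill v' r' -> (L = L' -> forall p, ~~ ch p -> v p = v' p) ->
  exists2 r, sign_fill v r &
  (nmono r (cov_side S hl s o L D) 0 D <= nmono r' (cov_side S hl s o L' D) 0 D +
   \sum_(0 <= p < D.+1) ch p * ((0 < p) && cov_side S hl s o L D p.-1 +
      cov_side S hl s o L D p))%N.
Proof.
move=> HS; rewrite leq_eqVlt => /orP[/eqP LL|LL] fr' Hv.
  have {}Hv := Hv LL; rewrite -{L'}LL in HS *.
  exists (fun p => if ch p then 0 < v p else r' p).
    move=> p; case: ifPn => [_|cp]; last by rewrite Hv.
    by split=> // h; rewrite -leNgt ltW.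
  set cov := cov_side _ _ _ _ _ _.
  apply: (@leq_trans (nmono r' cov 0 D + \sum_(0 <= p < D) (ch p * cov p) +
     \sum_(0 <= p < D) (ch p.+1 * cov p))%N).
    rewrite /nmono -!big_split /=; apply: leq_sum => p _.
    by case: (cov p) => //=; case: (ch p); case: (ch p.+1) => //=; rewrite ?addn0 ?leq_b1 //; lia.
  have -> : (\sum_(0 <= p < D.+1) ch p * ((0 < p) && cov p.-1 + cov p) =
     \sum_(0 <= p < D.+1) (ch p * cov p) +
     \sum_(0 <= p < D.+1) (ch p * ((0 < p) && cov p.-1)))%N.
    by rewrite -big_split /=; apply: eq_bigr => p _; rewrite mulnDr addnC.
  rewrite [X in (_ <= _ + (_ + X))%N]big_nat_recl //= muln0 add0n.
  by rewrite [X in (_ <= _ + (X + _))%N]big_nat_recr //=; lia.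
exists (fun p => 0 < v p).
  by move=> p; split=> // h; rewrite -leNgt ltW.
rewrite [X in (X <= _)%N]/nmono big1 // => p _.
case: (boolP (cov_side _ _ _ _ _ _ _)) => // /existsP[t /and3P[/HS h /eqP e _]].
by move: LL; rewrite -e ltnNge h.
Qed.

Definition nzc (F : realFieldType) (p : nat -> {poly F}) (i j : nat) : bool :=
  (p j)`_i != 0.

(** A monomial outside all triangles gets a triangle of size 0, which costs 2, and no covered pair
    meets it. A monomial inside a triangle can only alter signs on the sides: at most two pairs on a
    single side, or one pair on each of two sides at a corner. *)
Lemma cover_add (F : realFieldType) (D : nat) (f f' p : nat -> {poly F})
  (lx ly lz lx' ly' lz' c : nat) :
  cover D f' lx' ly' lz' c -> (lx <= lx')%N -> (ly <= ly')%N -> (lz <= lz')%N ->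
  supported p lx ly lz D -> (forall j, f j = f' j + p j) ->
  cover D f lx ly lz
    (c + 2 * \sum_(0 <= i < D.+1) \sum_(0 <= j < D.+1) nzc p i j)%N.
Proof.
move=> [I [S [a [b [m [rx [ry [rz [tri cov [fx fy fz] cost]]]]]]]]] hx hy hz sp fE.
have fE' i j : (p j)`_i = 0 -> (f j)`_i = (f' j)`_i by move=> e; rewrite fE coefD e addr0.
have [||||qx qxf qxc] := @side_update F I S a m b lx lx' D (side_x f lx) (side_x f' lx') rx
  (fun j => nzc p lx j).
- by move=> t /tri /and4P[].
- exact: hx.
- exact: fx.
- by move=> <- j; rewrite /nzc negbK => /eqP /fE'.
have [||||qy qyf qyc] := @side_update F I S b m a ly ly' D (side_y f ly D) (side_y f' ly' D) ry
  (fun j => (j + ly <= D)%N && nzc p (D - ly - j) j).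
- by move=> t /tri /and4P[].
- exact: hy.
- exact: fy.
- by move=> <- j; rewrite /side_y; case: leqP => //= _; rewrite /nzc negbK => /eqP /fE'.
have [||||qz qzf qzc] := @side_update F I S m a b lz lz' D (side_z f lz) (side_z f' lz') rz
  (fun i => nzc p i lz).
- by move=> t /tri /and4P[].
- exact: hz.
- exact: fz.
- by move=> <- i; rewrite /nzc negbK => /eqP /fE'.
pose inS i j := [exists t, (t \in S) && in_tri (a t) (b t) (m t) D i j].
pose unc i j := nzc p i j && ~~ inS i j.
pose I' := (I + ('I_D.+1 * 'I_D.+1))%type.
pose S' := [set x : I' | match x with inl t => t \in S | inr ij => unc ij.1 ij.2 end].
pose a' (x : I') := match x with inl t => a t | inr ij => ij.1 : nat end.
pose m' (x : I') := match x with inl t => m t | inr ij => ij.2 : nat end.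
pose b' (x : I') := match x with inl t => b t | inr ij => (D - ij.1 - ij.2)%N end.
have cov' (hl s o : I -> nat) (hl' s' o' : I' -> nat) L q :
    (forall t, hl' (inl t) = hl t) -> (forall t, s' (inl t) = s t) ->
    (forall t, o' (inl t) = o t) ->
    (forall ij, inr ij \in S' -> (D <= hl' (inr ij) + s' (inr ij) + o' (inr ij))%N) ->
    cov_side S' hl' s' o' L D q -> cov_side S hl s o L D q.
  move=> e1 e2 e3 H /existsP[[t|ij] /and4P[h1 h2 h3 h4]].
    apply/existsP; exists t; move: h1 h2 h3 h4; rewrite inE e1 e2 e3 => -> -> ->.
    by [].
  by have := H _ h1; rewrite (eqP h2); move: h3 h4; lia.
exists I', S', a', b', m', qx, qy, qz; split.
- case=> [t|[i j]]; rewrite inE /=.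
    by move=> /tri /and4P[h1 h2 h3 ->]; rewrite (leq_trans hx h1) (leq_trans hy h2) (leq_trans hz h3).
  by move=> /andP[/sp /and3P[h1 h2 h3] _]; lia.
- move=> i j fij; case: (boolP (inS i j)) => [/existsP[t /andP[tS ht]]|nS].
    by exists (inl t) => //; rewrite inE.
  have pij : nzc p i j.
    apply: contraNneq nS => e; move: fij; rewrite fE' // => /cov[t tS ht].
    by apply/existsP; exists t; rewrite tS.
  have /and3P[h1 h2 h3] := sp _ _ pij.
  have iD : (i < D.+1)%N by lia. have jD : (j < D.+1)%N by lia.
  exists (inr (Ordinal iD, Ordinal jD)); first by rewrite inE /= /unc pij.
  by apply/and3P; split=> //=; lia.
- by split.
set Cx := cov_side S a m b lx D in qxc *; set Cy := cov_side S b m a ly D in qyc *.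
set Cz := cov_side S m a b lz D in qzc *.
have nx : (nmono qx (cov_side S' a' m' b' lx D) 0 D <= nmono qx Cx 0 D)%N.
  apply: nmono_sub => q; apply: cov' => // -[i j]; rewrite inE /= => /andP[/sp /and3P[h1 h2 h3] _].
  by lia.
have ny : (nmono qy (cov_side S' b' m' a' ly D) 0 D <= nmono qy Cy 0 D)%N.
  apply: nmono_sub => q; apply: cov' => // -[i j]; rewrite inE /= => /andP[/sp /and3P[h1 h2 h3] _].
  by lia.
have nz : (nmono qz (cov_side S' m' a' b' lz D) 0 D <= nmono qz Cz 0 D)%N.
  apply: nmono_sub => q; apply: cov' => // -[i j]; rewrite inE /= => /andP[/sp /and3P[h1 h2 h3] _].
  by lia.
have costS : (\sum_(t in S') (D - (a' t + b' t + m' t) + 2) =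
   \sum_(t in S) (D - (a t + b t + m t) + 2) +
   \sum_(0 <= i < D.+1) \sum_(0 <= j < D.+1) 2 * unc i j)%N.
  rewrite big_sumType /=; congr (_ + _)%N.
    by apply: eq_bigl => t; rewrite inE.
  rewrite big_mkord; under [RHS]eq_bigr do rewrite big_mkord.
  rewrite pair_big /= big_mkcond /=; apply: eq_bigr => -[i j] _; rewrite inE /=.
  case: (boolP (unc i j)) => //= /andP[/sp /and3P[_ _ h] _].
  by rewrite muln1; lia.
pose gx j := (nzc p lx j * ((0 < j) && Cx j.-1 + Cx j))%N.
pose gy j := (((j + ly <= D) && nzc p (D - ly - j) j) * ((0 < j) && Cy j.-1 + Cy j))%N.
pose gz i := (nzc p i lz * ((0 < i) && Cz i.-1 + Cz i))%N.
have sx : (\sum_(0 <= j < D.+1) gx j =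
    \sum_(0 <= i < D.+1) \sum_(0 <= j < D.+1) (i == lx) * gx j)%N.
  rewrite exchange_big /=; apply: eq_bigr => j _; rewrite -big_distrl /=.
  case: (leqP D.+1 lx) => h.
    rewrite /gx; case: (boolP (nzc p lx j)) => [/sp /and3P[]|_]; first by lia.
    by rewrite mul0n muln0.
  have -> : (\sum_(0 <= i < D.+1) (i == lx) = 1)%N.
    have := sum_select D.+1 lx 1; rewrite h => <-; apply: eq_bigr => i _; by case: eqP.
  by rewrite mul1n.
have sz : (\sum_(0 <= i < D.+1) gz i =
    \sum_(0 <= i < D.+1) \sum_(0 <= j < D.+1) (j == lz) * gz i)%N.
  apply: eq_bigr => i _; rewrite -big_distrl /=.
  case: (leqP D.+1 lz) => h.
    rewrite /gz; case: (boolP (nzc p i lz)) => [/sp /and3P[]|_]; first by lia.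
    by rewrite mul0n muln0.
  have -> : (\sum_(0 <= i < D.+1) (i == lz) = 1)%N.
    have := sum_select D.+1 lz 1; rewrite h => <-; apply: eq_bigr => j _; by case: eqP.
  by rewrite mul1n.
have sy : (\sum_(0 <= j < D.+1) gy j =
    \sum_(0 <= i < D.+1) \sum_(0 <= j < D.+1) (i + j + ly == D) * gy j)%N.
  rewrite exchange_big /=; apply: eq_bigr => j _; rewrite -big_distrl /=.
  case: (leqP (j + ly) D) => h; last by rewrite /gy leqNgt h muln0.
  have -> : (\sum_(0 <= i < D.+1) (i + j + ly == D) = 1)%N.
    have := sum_select D.+1 (D - ly - j) 1.
    have -> : (D - ly - j < D.+1)%N by lia.
    move=> <-; apply: eq_bigr => i _; have -> : (i == D - ly - j)%N = (i + j + ly == D)%N by lia.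
    by case: eqP.
  by rewrite mul1n.
have point : (\sum_(0 <= i < D.+1) \sum_(0 <= j < D.+1) 2 * unc i j +
   (\sum_(0 <= j < D.+1) gx j + \sum_(0 <= j < D.+1) gy j + \sum_(0 <= i < D.+1) gz i) <=
   2 * \sum_(0 <= i < D.+1) \sum_(0 <= j < D.+1) nzc p i j)%N.
  rewrite sx sy sz -!big_split /= big_distrr /=; apply: leq_sum => i _.
  rewrite -!big_split /= big_distrr /=; apply: leq_sum => j _.
  have ex : (i == lx) -> gx j = (nzc p i j * ((0 < j) && Cx j.-1 + Cx j))%N.
    by move=> /eqP ->.
  have ey : (i + j + ly == D) -> gy j = (nzc p i j * ((0 < j) && Cy j.-1 + Cy j))%N.
    move=> e; rewrite /gy; have -> : (D - ly - j = i)%N by lia.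
    by have -> : (j + ly <= D)%N by lia.
  have ez : (j == lz) -> gz i = (nzc p i j * ((0 < i) && Cz i.-1 + Cz i))%N.
    by move=> /eqP ->.
  have {ex ey ez} -> : (((i == lx) * gx j + (i + j + ly == D) * gy j + (j == lz) * gz i) =
     nzc p i j * ((i == lx) * ((0 < j) && Cx j.-1 + Cx j) +
       (i + j + ly == D) * ((0 < j) && Cy j.-1 + Cy j) +
       (j == lz) * ((0 < i) && Cz i.-1 + Cz i)))%N.
    rewrite !mulnDr; congr (_ + _ + _)%N.
    - by case: (boolP (i == lx)) => [/ex ->|_]; rewrite ?mul1n ?mul0n ?muln0 // mulnDr.
    - by case: (boolP (_ == D)) => [/ey ->|_]; rewrite ?mul1n ?mul0n ?muln0 // mulnDr.
    - by case: (boolP (j == lz)) => [/ez ->|_]; rewrite ?mul1n ?mul0n ?muln0 // mulnDr.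
  rewrite /unc; case: (boolP (nzc p i j)) => //= /sp /and3P[p1 p2 p3]; rewrite mul1n.
  (* A covered pair at the monomial lies in a triangle that contains the monomial and extends in the
     direction of the pair; at a corner this excludes one of the two pairs on each side. *)
  have cA x : i = lx -> Cx x -> (x == j) || (x.+1 == j) ->
      [/\ inS i j, x.+1 = j -> (lz < j)%N & x = j -> (i + j + ly < D)%N].
    move=> e /existsP[t /and4P[tS /eqP h1 h2 h3]] hx'; have /and4P[k1 k2 k3 k4] := tri _ tS.
    split; [|by lia|by lia].
    by apply/existsP; exists t; rewrite tS /=; apply/and3P; split; lia.
  have cB x : (i + j + ly = D)%N -> Cy x -> (x == j) || (x.+1 == j) ->
      [/\ inS i j, x.+1 = j -> (lz < j)%N & x = j -> (lx < i)%N].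
    move=> e /existsP[t /and4P[tS /eqP h1 h2 h3]] hx'; have /and4P[k1 k2 k3 k4] := tri _ tS.
    split; [|by lia|by lia].
    by apply/existsP; exists t; rewrite tS /=; apply/and3P; split; lia.
  have cC x : j = lz -> Cz x -> (x == i) || (x.+1 == i) ->
      [/\ inS i j, x.+1 = i -> (lx < i)%N & x = i -> (i + j + ly < D)%N].
    move=> e /existsP[t /and4P[tS /eqP h1 h2 h3]] hx'; have /and4P[k1 k2 k3 k4] := tri _ tS.
    split; [|by lia|by lia].
    by apply/existsP; exists t; rewrite tS /=; apply/and3P; split; lia.
  have bA : ((i == lx) * ((0 < j) && Cx j.-1 + Cx j) <=
      inS i j * (i == lx) * ((lz < j) + (i + j + ly < D)))%N.
    case: eqP => [e|_]; rewrite ?mul0n // mul1n muln1.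
    have : ((0 < j)%N && Cx j.-1 -> inS i j /\ (lz < j)%N).
      move=> /andP[j0 h]; have [|h1 h2 _] := cA _ e h; first by rewrite prednK // eqxx orbT.
      by split=> //; apply: h2; rewrite prednK.
    have : (Cx j -> inS i j /\ (i + j + ly < D)%N).
      by move=> h; have [|h1 _ h2] := cA _ e h; rewrite ?eqxx //; split=> //; apply: h2.
    case: (Cx j) => [/(_ isT)[-> ->]|_]; case: (_ && _) => [/(_ isT)[h ->]|_] //;
    by rewrite ?h //; lia.
  have bB : ((i + j + ly == D) * ((0 < j) && Cy j.-1 + Cy j) <=
      inS i j * (i + j + ly == D) * ((lz < j) + (lx < i)))%N.
    case: eqP => [e|_]; rewrite ?mul0n // mul1n muln1.
    have : ((0 < j)%N && Cy j.-1 -> inS i j /\ (lz < j)%N).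
      move=> /andP[j0 h]; have [|h1 h2 _] := cB _ e h; first by rewrite prednK // eqxx orbT.
      by split=> //; apply: h2; rewrite prednK.
    have : (Cy j -> inS i j /\ (lx < i)%N).
      by move=> h; have [|h1 _ h2] := cB _ e h; rewrite ?eqxx //; split=> //; apply: h2.
    case: (Cy j) => [/(_ isT)[-> ->]|_]; case: (_ && _) => [/(_ isT)[h ->]|_] //;
    by rewrite ?h //; lia.
  have bC : ((j == lz) * ((0 < i) && Cz i.-1 + Cz i) <=
      inS i j * (j == lz) * ((lx < i) + (i + j + ly < D)))%N.
    case: eqP => [e|_]; rewrite ?mul0n // mul1n muln1.
    have : ((0 < i)%N && Cz i.-1 -> inS i j /\ (lx < i)%N).
      move=> /andP[j0 h]; have [|h1 h2 _] := cC _ e h; first by rewrite prednK // eqxx orbT.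
      by split=> //; apply: h2; rewrite prednK.
    have : (Cz i -> inS i j /\ (i + j + ly < D)%N).
      by move=> h; have [|h1 _ h2] := cC _ e h; rewrite ?eqxx //; split=> //; apply: h2.
    case: (Cz i) => [/(_ isT)[-> ->]|_]; case: (_ && _) => [/(_ isT)[h ->]|_] //;
    by rewrite ?h //; lia.
  apply: leq_trans (leq_add (leqnn _) (leq_add (leq_add bA bB) bC)) _.
  case: (inS i j); rewrite /= ?mul0n ?muln0 ?mul1n ?addn0 //.
  by move: p1 p2 p3; case: (ltngtP lx i); case: (ltngtP lz j); case: (ltngtP (i + j + ly) D);
    rewrite /=; lia.
move: (qxc : (_ <= _ + \sum_(0 <= j < D.+1) gx j)%N).
move: (qyc : (_ <= _ + \sum_(0 <= j < D.+1) gy j)%N).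
move: (qzc : (_ <= _ + \sum_(0 <= j < D.+1) gz j)%N).
have arith (s u x y z x' y' z' rx' ry' rz' gx' gy' gz' n : nat) :
    (x' <= x -> y' <= y -> z' <= z -> u + (gx' + gy' + gz') <= 2 * n ->
     s + (rx' + ry' + rz') <= c -> z <= rz' + gz' -> y <= ry' + gy' -> x <= rx' + gx' ->
     s + u + (x' + y' + z') <= c + 2 * n)%N by lia.
by rewrite costS; move: nx ny nz point cost; apply: arith.
Qed.

Lemma exists_lines (F : realFieldType) (f : nat -> {poly F}) (D : nat) :
  supported f 0 0 0 D -> (exists i j, (f j)`_i != 0) ->
  exists lx ly lz, [/\ supported f lx ly lz D, exists p, side_x f lx p != 0,
    exists p, side_y f ly D p != 0 & exists p, side_z f lz p != 0].
Proof.
move=> sf [i0 [j0 f0]].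
have exw (w : nat -> nat -> nat) : exists i j, (f j)`_i != 0 /\
    forall i' j', (f j')`_i' != 0 -> (w i j <= w i' j')%N.
  have exn : exists n, [exists i : 'I_D.+1, exists j : 'I_D.+1,
      ((f j)`_i != 0) && (w i j == n)].
    have /and3P[_ _ h] := sf _ _ f0.
    have iD : (i0 < D.+1)%N by lia. have jD : (j0 < D.+1)%N by lia.
    exists (w i0 j0); apply/existsP; exists (Ordinal iD); apply/existsP; exists (Ordinal jD).
    by rewrite f0 eqxx.
  case: (ex_minnP exn) => n /existsP[i /existsP[j /andP[fij /eqP e]]] nmin.
  exists i, j; split=> // i' j' h; have /and3P[_ _ h'] := sf _ _ h.
  have iD : (i' < D.+1)%N by lia. have jD : (j' < D.+1)%N by lia.
  rewrite e; apply: nmin; apply/existsP; exists (Ordinal iD).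
  by apply/existsP; exists (Ordinal jD); rewrite h eqxx.
have [ix [jx [fx mx]]] := exw (fun i _ => i).
have [iy [jy [fy my]]] := exw (fun i j => D - i - j)%N.
have [iz [jz [fz mz]]] := exw (fun _ j => j).
exists ix, (D - iy - jy)%N, jz; split.
- move=> i j h; apply/and3P; split; [exact: mx h|exact: mz h|].
  by have := my _ _ h; have /and3P[_ _] := sf _ _ h; lia.
- by exists jx.
- exists jy; rewrite /side_y; have /and3P[_ _ h] := sf _ _ fy.
  have -> : (jy + (D - iy - jy) <= D)%N by lia.
  by have -> : (D - (D - iy - jy) - jy = iy)%N by lia.
- by exists iz.
Qed.

Lemma addB_le0 (F : realFieldType) (x y z t : F) :
  x <= 0 -> y <= 0 -> z <= 0 -> 0 <= t -> x + y + z - t <= 0.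
Proof. by move=> *; lra. Qed.

Lemma addB_lt0 (F : realFieldType) (x y z t : F) :
  x <= 0 -> y <= 0 -> z <= 0 -> 0 <= t -> (x < 0) || (y < 0) || (0 < t) ->
  x + y + z - t < 0.
Proof. by move=> ? ? ? ? /orP[/orP[]|] ?; lra. Qed.

(** * Descent along the degrees *)

Section Chain.

Variables (F : realFieldType) (p q : nat -> nat -> {poly F}) (d : nat).

Hypothesis supp_q0 : supported (q 0%N) 0 0 0 0.
Hypothesis q0_neq0 : exists i j, (q 0%N j)`_i != 0.
Hypothesis qS : forall k j, q k.+1 j = smul (q k) j - p k.+1 j.
Hypothesis p_ge0 : forall k i j, 0 <= (p k j)`_i.
Hypothesis supp_p : forall k, supported (p k) 0 0 0 k.
Hypothesis qd : forall j, q d j = 0.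
Hypothesis pd : exists i j, (p d j)`_i != 0.
Hypothesis d_gt0 : (0 < d)%N.

Let supp_q k : supported (q k) 0 0 0 k.
Proof.
elim: k => [|k IH] i j; first exact: supp_q0.
rewrite qS coefB; case: (eqVneq (p k.+1 j)`_i 0) => [->|/supp_p //].
by rewrite subr0 => /(supported_smul IH).
Qed.

(* Negative coefficients of q propagate to all later levels, because p is nonnegative; hence the sides of the support never move outwards. *)
Let negative_region (Z : nat -> nat -> nat -> bool) k :
  (forall k i j, Z k.+1 i j -> [/\ Z k i j, forall i', i = i'.+1 -> Z k i' j &
     forall j', j = j'.+1 -> Z k i j']) ->
  (forall k i j, Z k i j -> Z k.+1 i j \/ Z k.+1 i.+1 j) ->
  (k <= d)%N -> (forall i j, Z k i j -> (q k j)`_i <= 0) ->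
  (exists i j, Z k i j /\ (q k j)`_i < 0) -> False.
Proof.
move=> down up; move e : (d - k)%N => n; elim: n k e => [|n IH] k e kd qle [i [j [zij qlt]]].
  have kd' : k = d by lia.
  by move: qlt; rewrite kd' qd coef0 ltxx.
have parents i' j' : Z k.+1 i' j' -> [/\ (q k j')`_i' <= 0,
    (if i' is i''.+1 then (q k j')`_i'' else 0) <= 0 &
    (if j' is j''.+1 then (q k j'')`_i' else 0) <= 0].
  move=> /down[h1 h2 h3]; split; first exact: qle.
    by case: i' h1 h2 h3 => // i'' _ h2 _; apply/qle/h2.
  by case: j' h1 h2 h3 => // j'' _ _ h3; apply/qle/h3.
have coefE i' j' : (q k.+1 j')`_i' = (q k j')`_i' +
    (if i' is i''.+1 then (q k j')`_i'' else 0) +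
    (if j' is j''.+1 then (q k j'')`_i' else 0) - (p k.+1 j')`_i'.
  by rewrite qS coefB coef_smul.
apply: (IH k.+1); [lia|lia| |].
  by move=> i' j' /parents[h1 h2 h3]; rewrite coefE; apply: addB_le0.
case: (up _ _ _ zij) => z'.
  exists i, j; split=> //; have [h1 h2 h3] := parents _ _ z'.
  by rewrite coefE; apply: addB_lt0; rewrite ?qlt.
exists i.+1, j; split=> //; have [h1 h2 h3] := parents _ _ z'.
by rewrite coefE; apply: addB_lt0; rewrite ?qlt ?orbT.
Qed.

(** If [q k] vanished, all later ones would have coefficients at most zero, and subtracting the
    nonzero [p d] would leave a negative coefficient in [q d]. *)
Let q_neq0 k : (k < d)%N -> exists i j, (q k j)`_i != 0.
Proof.
move=> kd; have [//|nex] := boolp.pselect (exists i j, (q k j)`_i != 0).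
have qk0 i j : (q k j)`_i = 0.
  by apply/eqP; apply: contraT => h; case: nex; exists i, j.
have le0 n i j : (q (k + n)%N j)`_i <= 0.
  elim: n i j => [|n IH] i j; first by rewrite addn0 qk0.
  rewrite addnS qS coefB coef_smul; apply: addB_le0 => //; first by case: i.
  by case: j.
have [i [j pij]] := pd; exfalso.
have := qS d.-1 j; rewrite prednK // qd => /(congr1 (fun g : {poly F} => g`_i)).
rewrite coef0 coefB coef_smul.
have ek : d.-1 = (k + (d.-1 - k))%N by lia.
have h1 : (q d.-1 j)`_i <= 0 by rewrite ek.
have h2 : (if i is i'.+1 then (q d.-1 j)`_i' else 0) <= 0 by case: i {pij h1} => // i'; rewrite ek.
have h3 : (if j is j'.+1 then (q d.-1 j')`_i else 0) <= 0 by case: j {pij h1 h2} => // j'; rewrite ek.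
have h4 : 0 < (p d j)`_i by rewrite lt_neqAle eq_sym pij p_ge0.
move/esym/eqP; rewrite lt_eqF //; apply: addB_lt0 => //.
by rewrite h4 !orbT.
Qed.

Let is_lines k lx ly lz := [/\ supported (q k) lx ly lz k, exists j, side_x (q k) lx j != 0,
    exists j, side_y (q k) ly k j != 0 & exists i, side_z (q k) lz i != 0].

(** Beyond the old lines [q k.+1] equals [- p k.+1]; a side that moved outwards would carry a
    negative coefficient, and the half-plane beyond it contradicts [negative_region]. *)
Let lines_mono k lx ly lz lx' ly' lz' : (k.+1 < d)%N -> is_lines k lx ly lz ->
  is_lines k.+1 lx' ly' lz' -> [/\ lx <= lx', ly <= ly' & lz <= lz']%N.
Proof.
move=> kd [s0 _ _ _] [s1 [jx hx] [jy hy] [iz hz]].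
have out i j : ~~ in_tri lx ly lz k.+1 i j -> (q k.+1 j)`_i = - (p k.+1 j)`_i.
  move=> h; rewrite qS coefB; suff -> : (smul (q k) j)`_i = 0 by rewrite add0r.
  by apply/eqP; apply: contraR h => /(supported_smul s0).
have neg i j : ~~ in_tri lx ly lz k.+1 i j -> (q k.+1 j)`_i <= 0.
  by move=> /out ->; rewrite oppr_le0.
split; rewrite leqNgt; apply/negP => h.
- apply: (@negative_region (fun _ i _ => i <= lx')%N k.+1).
  + by move=> k' i j hi; split=> // i' e; lia.
  + by move=> k' i j hi; left.
  + exact: ltnW.
  + by move=> i j hi; apply: neg; apply/negP => /and3P[]; lia.
  exists lx', jx; split=> //; rewrite lt_neqAle hx neg //.
  by apply/negP => /and3P[]; lia.
(* The exponent of [y] is [k - i - j], so this half-plane depends on [k]; a monomial stays in it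
   when multiplied by [x], while in the other two cases it is multiplied by [y]. *)
- apply: (@negative_region (fun k i j => k <= i + j + ly')%N k.+1).
  + by move=> k' i j hi; split; [lia|move=> i'; lia|move=> j'; lia].
  + by move=> k' i j hi; right; lia.
  + exact: ltnW.
  + by move=> i j hi; apply: neg; apply/negP => /and3P[]; lia.
  move: hy; rewrite /side_y; case: leqP => h0; last by rewrite eqxx.
  move=> hy; exists (k.+1 - ly' - jy)%N, jy; split; first by lia.
  by rewrite lt_neqAle hy neg //; apply/negP => /and3P[]; lia.
- apply: (@negative_region (fun _ _ j => j <= lz')%N k.+1).
  + by move=> k' i j hi; split=> // i' e; lia.
  + by move=> k' i j hi; left.
  + exact: ltnW.
  + by move=> i j hi; apply: neg; apply/negP => /and3P[]; lia.
  exists iz, lz'; split=> //; rewrite lt_neqAle hz neg //.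
  by apply/negP => /and3P[]; lia.
Qed.

Let size_p k := (\sum_(0 <= i < k.+1) \sum_(0 <= j < k.+1) nzc (p k) i j)%N.

Let step k lx ly lz lx' ly' lz' c : is_lines k lx ly lz ->
  cover k.+1 (q k.+1) lx' ly' lz' c -> (lx <= lx')%N -> (ly <= ly')%N -> (lz <= lz')%N ->
  supported (q k.+1) lx' ly' lz' k.+1 ->
  exists2 c', (c' + 4 <= c + 2 * size_p k.+1)%N & cover k (q k) lx ly lz c'.
Proof.
move=> [s0 nx ny nz] cv hx hy hz s1.
have pE j : p k.+1 j = smul (q k) j - q k.+1 j by rewrite qS opprB addrCA subrr addr0.
have sp : supported (p k.+1) lx ly lz k.+1.
  move=> i j; rewrite pE coefB; case: (eqVneq (q k.+1 j)`_i 0) => [->|/s1 /and3P[h1 h2 h3] _].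
    by rewrite subr0 => /(supported_smul s0).
  by apply/and3P; split; lia.
have fE j : smul (q k) j = q k.+1 j + p k.+1 j by rewrite qS subrK.
have [I [S [a [b [m [rx [ry [rz [tri cov [fx fy fz] cost]]]]]]]]] := cover_add cv hx hy hz sp fE.
have [c' hc' cv'] := growth_step s0 nx ny nz tri cov fx fy fz.
by exists c' => //; apply: leq_trans hc' cost.
Qed.

(** The induction starts at [q d = 0] with the empty cover, of cost 0. Having no support, [q d] has
    no sides of its own and is given the lines of [q d.-1]. *)
Let cover_chain n k : (k + n.+1 = d)%N -> exists lx ly lz c,
  [/\ is_lines k lx ly lz, cover k (q k) lx ly lz c &
      (c + 4 * n.+1 <= 2 * \sum_(k.+1 <= l < d.+1) size_p l)%N].
Proof.
elim: n k => [|n IH] k hk.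
  have [lx [ly [lz L]]] := exists_lines (@supp_q k) (q_neq0 (k := k) ltac:(lia)).
  have kd : k.+1 = d by lia.
  have q0 j i : (q k.+1 j)`_i = 0 by rewrite kd qd coef0.
  have cv : cover k.+1 (q k.+1) lx ly lz 0.
    exists (void : finType), set0, (fun _ => 0%N), (fun _ => 0%N), (fun _ => 0%N),
      xpredT, xpredT, xpredT; split.
    - by move=> t; rewrite inE.
    - by move=> i j; rewrite q0 eqxx.
    - have z : sign_fill (fun _ => 0 : F) xpredT by move=> x; rewrite ltxx.
      split; apply: eq_sign_fill z => x; rewrite /side_x /side_y /side_z ?q0 //.
      by case: ifP.
    rewrite big_set0 add0n !/nmono !big1 // => x _; rewrite /cov_side;
    by case: existsP => // -[].
  have [|c' hc' cv'] := step L cv (leqnn _) (leqnn _) (leqnn _).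
    by move=> i j; rewrite q0 eqxx.
  exists lx, ly, lz, c'; split=> //.
  by rewrite -kd big_nat1; move: hc'; lia.
have [|lx' [ly' [lz' [c [L' cv hc]]]]] := IH k.+1; first by lia.
have [lx [ly [lz L]]] := exists_lines (@supp_q k) (q_neq0 (k := k) ltac:(lia)).
have [|h1 h2 h3] := lines_mono _ L L'; first by lia.
have [s1 _ _ _] := L'.
have [c' hc' cv'] := step L cv h1 h2 h3 s1.
exists lx, ly, lz, c'; split=> //.
by rewrite big_ltn ?mulnDr; [move: hc hc'; lia|lia].
Qed.

(** A cover of the nonzero [q 0] contains a triangle, so [c >= 2]; halving [c + 4 * d <= 2 * n],
    with [n] the number of monomials, gives the claim. *)
Lemma monomials_of_chain : (2 * d + 1 <= \sum_(1 <= k < d.+1)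
  \sum_(0 <= i < k.+1) \sum_(0 <= j < k.+1) nzc (p k) i j)%N.
Proof.
have [|lx [ly [lz [c [_ [I [S [a [b [m [rx [ry [rz [tri cov _ cost]]]]]]]]] hc]]]]] :=
  @cover_chain d.-1 0; first by lia.
have [i [j h]] := q0_neq0; have [t tS _] := cov _ _ h.
move: cost hc; rewrite (bigD1 t) //= -[X in (_ <= 2 * X)%N]/(\sum_(1 <= k < d.+1) size_p k)%N.
by rewrite /size_p prednK //; lia.
Qed.

End Chain.

(** * Projection to a relation in one variable *)

Lemma coef_1DX_exp_top (F : realFieldType) n : ((1 + 'X : {poly F}) ^+ n)`_n = 1.
Proof.
elim: n => [|n IH]; first by rewrite coef1.
rewrite exprS coef_1DX_mul /shift_add IH; suff -> : ((1 + 'X : {poly F}) ^+ n)`_n.+1 = 0 by rewrite add0r.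
apply/eqP; apply: contraT => h; have := @supp_mul_1DX F 1 0 0 n _ n.+1.
rewrite mul1r add0n ltnn andbF => H; suff : false by [].
apply: H h => p; by rewrite coef1; case: p => //= p; rewrite eqxx.
Qed.

Lemma coef_monomial_1DX (F : realFieldType) (w : F) (a m p : nat) :
  (w%:P * 'X^a * (1 + 'X) ^+ m)`_p =
  if (p < a)%N then 0 else w * ((1 + 'X : {poly F}) ^+ m)`_(p - a).
Proof. by rewrite -mulrA coefCM coefXnM; case: ifP; rewrite ?mulr0. Qed.

Lemma two_terms (F : realFieldType) (I : finType) (P : pred I) (c : I -> F) :
  (exists i, P i) -> (forall i, P i -> c i != 0) -> \sum_(i | P i) c i = 0 ->
  (2 <= \sum_(i : I) P i)%N.
Proof.
move=> [i Pi] cn s0; rewrite (bigD1 i) //= Pi.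
suff : (0 < \sum_(j | j != i) P j)%N by lia.
rewrite lt0n; apply/negP => /eqP/eqP; rewrite sum_nat_eq0 => /forallP H.
move: s0; rewrite (bigD1 i) //= big1 ?addr0 => [/eqP|j /andP[Pj ji]]; first by rewrite (negbTE (cn i Pi)).
by have := H j; rewrite ji Pj.
Qed.

(** Each side has at least two contacts: the coefficient of [x^A], that of [x^(D - B)] and, after
    division by [(1 + X)^M], the value at [-1] are vanishing sums of nonzero numbers. Six contacts
    against the [+ 1] give the 5. *)
Lemma relation_bound (F : realFieldType) (I : finType) (w : I -> F) (a b m : I -> nat)
  (D A B M : nat) :
  (forall i, a i + b i + m i = D)%N -> (forall i, w i != 0) ->
  \sum_i (w i)%:P * 'X^(a i) * (1 + 'X) ^+ m i = 0 ->
  (forall J : {set I}, J != set0 ->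
    \sum_(i in J) (w i)%:P * 'X^(a i) * (1 + 'X) ^+ m i = 0 -> J = [set: I]) ->
  (forall i, A <= a i)%N -> (forall i, B <= b i)%N -> (forall i, M <= m i)%N ->
  (exists i, a i = A) -> (exists i, b i = B) -> (exists i, m i = M) ->
  (A + B + M < D)%N -> (D + 5 <= 2 * #|I| + (A + B + M))%N.
Proof.
move=> hD w0 sum0 minimal minA minB minM [iA eA] [iB eB] [iM eM] hull.
have := @minimal_relation_size F I [set: I] a b m (fun _ => 0%N)
  (fun i => (w i)%:P * 'X^(a i)) D A B M.
have -> : \sum_(i in [set: I]) (w i)%:P * 'X^(a i) * (1 + 'X) ^+ m i = 0.
  by rewrite -[RHS]sum0; apply: eq_bigl => i; rewrite inE.
have h1 i : i \in [set: I] -> (a i + b i + m i + 0 = D)%N by rewrite addn0.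
have h2 i : i \in [set: I] -> forall p, ((w i)%:P * 'X^(a i))`_p != 0 -> (a i <= p <= a i + 0)%N.
  move=> _ p; rewrite coefCM coefXn addn0; case: (eqVneq p (a i)) => [->|_]; first by rewrite leqnn.
  by rewrite mulr0 eqxx.
move=> /(_ h1 h2 erefl) H; have {H} := H _ (fun i _ => minA i) (fun i _ => minB i) (fun i _ => minM i).
have inT (h : I -> nat) c i : h i = c -> exists2 i, i \in [set: I] & h i = c by exists i.
move=> /(_ _ (inT _ _ _ eA) (inT _ _ _ eB) (inT _ _ _ eM) hull) H.
have {H} := H (fun J' _ n e => minimal J' n e).
have -> : (\sum_(i in [set: I]) (0 + 2) = 2 * #|I|)%N.
  by rewrite sum_nat_const cardsT mulnC.
have eT (f : I -> nat) : (\sum_(i in [set: I]) f i = \sum_i f i)%N.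
  by apply: eq_bigl => i; rewrite inE.
rewrite eT !big_split /=.
have rA : (2 <= \sum_i (a i == A))%N.
  apply: (@two_terms F I (fun i => a i == A) w) => //; first by exists iA; rewrite eA.
  transitivity (\sum_i ((w i)%:P * 'X^(a i) * (1 + 'X) ^+ m i)`_A).
    rewrite big_mkcond; apply: eq_bigr => i _; rewrite coef_monomial_1DX.
    case: (ltngtP A (a i)) (minA i) => // <- _.
    by rewrite subnn -horner_coef0 !hornerE expr1n mulr1.
  by rewrite -coef_sum sum0 coef0.
have rB : (2 <= \sum_i (b i == B))%N.
  apply: (@two_terms F I (fun i => b i == B) w) => //; first by exists iB; rewrite eB.
  transitivity (\sum_i ((w i)%:P * 'X^(a i) * (1 + 'X) ^+ m i)`_(D - B)).
    rewrite big_mkcond; apply: eq_bigr => i _; rewrite coef_monomial_1DX.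
    have := hD i; have := minB i; case: eqP => e1 e2 e3.
      have -> : (D - B < a i)%N = false by lia.
      have -> : (D - B - a i = m i)%N by lia.
      by rewrite coef_1DX_exp_top mulr1.
    case: ifP => // hlt; apply/esym/eqP; rewrite mulf_eq0; apply/orP; right.
    apply: contraT => h; have := @supp_mul_1DX F 1 0 0 (m i) _ (D - B - a i).
    rewrite mul1r => /(_ _ h) H; suff : (D - B - a i <= 0 + m i)%N by lia.
    have h1' p : (1 : {poly F})`_p != 0 -> (0 <= p <= 0)%N.
      by rewrite coef1; case: p => //= p; rewrite eqxx.
    by have /andP[] := H h1'.
  by rewrite -coef_sum sum0 coef0.
have rM : (2 <= \sum_i (m i == M))%N.
  apply: (@two_terms F I (fun i => m i == M) (fun i => w i * (-1) ^+ a i)).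
  - by exists iM; rewrite eM.
  - by move=> i _; rewrite mulf_neq0 // expf_neq0 // oppr_eq0 oner_eq0.
  have sum0' : \sum_i (w i)%:P * 'X^(a i) * (1 + 'X) ^+ (m i - M) = 0.
    have h : (1 + 'X : {poly F}) ^+ M != 0 by rewrite expf_neq0 // onePX_neq0.
    apply: (mulIf h); rewrite mul0r mulr_suml; move: sum0; congr (_ = _).
    by apply: eq_bigr => i _; rewrite -[RHS]mulrA -exprD subnK.
  have := congr1 (fun g : {poly F} => g.[-1]) sum0'; rewrite horner0 horner_sum => e.
  rewrite -[RHS]e big_mkcond; apply: eq_bigr => i _.
  rewrite !hornerE subrr expr0n; case: (ltngtP M (m i)) (minM i) => // [lt|eq] _.
    by rewrite subn_eq0 leqNgt lt mulr0.
  by rewrite -eq subnn mulr1.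
lia.
Qed.

Lemma poly_eq0_infinite (F : realFieldType) (P : {poly F}) (r : nat -> F) :
  injective r -> (forall n, P.[r n] = 0) -> P = 0.
Proof.
move=> inj_r H; apply: (@roots_geq_poly_eq0 _ _ [seq r n | n <- iota 0 (size P)]).
- by apply/allP => x /mapP[n _ ->]; apply/rootP.
- by rewrite map_inj_uniq // iota_uniq.
- by rewrite size_map size_iota.
Qed.

Lemma natr_inj (F : realFieldType) : injective (fun n : nat => n%:R : F).
Proof. by move=> x y /eqP; rewrite eqr_nat => /eqP. Qed.

Lemma nonroot_unit_interval (F : realFieldType) (P : {poly F}) :
  P != 0 -> exists2 x, 0 <= x <= 1 & P.[x] != 0.
Proof.
move=> P0; pose r n : F := n.+1%:R^-1.
have inj_r : injective r by move=> x y /invr_inj /natr_inj [].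
have [[n hn]|nex] := boolp.pselect (exists n, P.[r n] != 0); last first.
  case/negP: P0; apply/eqP/(poly_eq0_infinite inj_r) => n.
  by apply/eqP; apply: contraT => h; case: nex; exists n.
exists (r n) => //; rewrite invr_ge0 ler0n /= invf_le1 ?ltr0n //.
by rewrite ler1n.
Qed.

(** * A generic line in the cone of admissible points *)

Section Projection.

Variables (F : realFieldType) (I : finType) (nv D : nat) (sd : pred nat).
Variables (w : I -> F) (A : I -> nat -> nat).

Definition cone (X : nat -> F) := (forall j, (j < nv)%N -> 0 <= X j) /\
  \sum_(j < nv | sd j) X j = \sum_(j < nv | ~~ sd j) X j.

Let T k (X : nat -> F) := w k * \prod_(j < nv) X j ^+ A k j.

Hypothesis size_A : forall k, (\sum_(j < nv) A k j = D)%N.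
Hypothesis w_neq0 : forall k, w k != 0.
Hypothesis vanish : forall X, cone X -> \sum_k T k X = 0.
Hypothesis indec : forall J : {set I}, J != set0 -> J != [set: I] ->
  exists2 X, cone X & \sum_(k in J) T k X != 0.
Hypothesis ex_sd : exists2 j, (j < nv)%N & sd j.
Hypothesis ex_nsd : exists2 j, (j < nv)%N & ~~ sd j.

Let seg (X Y : nat -> F) x j := X j + x * (Y j - X j).

Let cone_seg X Y x : cone X -> cone Y -> 0 <= x <= 1 -> cone (seg X Y x).
Proof.
move=> [X0 eX] [Y0 eY] /andP[x0 x1]; split.
  move=> j jn; rewrite /seg; have -> : X j + x * (Y j - X j) = (1 - x) * X j + x * Y j by ring.
  by rewrite addr_ge0 // mulr_ge0 ?X0 ?Y0 // subr_ge0.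
by rewrite !big_split /= -!mulr_sumr !sumrB eX eY.
Qed.

Let segpoly (X Y : nat -> F) j : {poly F} := (X j)%:P + (Y j - X j)%:P * 'X.

Let segpolyE X Y j x : (segpoly X Y j).[x] = seg X Y x j.
Proof. by rewrite /segpoly !hornerE /seg mulrC. Qed.

Let Tpoly k X Y : {poly F} := (w k)%:P * \prod_(j < nv) segpoly X Y j ^+ A k j.

Let TpolyE k X Y x : (Tpoly k X Y).[x] = T k (seg X Y x).
Proof.
rewrite /Tpoly /T hornerM hornerC horner_prod; congr (_ * _).
by apply: eq_bigr => j _; rewrite horner_exp segpolyE.
Qed.

Let seg0 X Y : seg X Y 0 =1 X.
Proof. by move=> j; rewrite /seg mul0r addr0. Qed.

Let seg1 X Y : seg X Y 1 =1 Y.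
Proof. by move=> j; rewrite /seg mul1r addrC subrK. Qed.

Let eqT k X Y : X =1 Y -> T k X = T k Y.
Proof. by move=> e; congr (_ * _); apply: eq_bigr => j _; rewrite e. Qed.

(** The cone is convex, so the segment from a point that serves the earlier sets to one that serves
    [J0] stays in it. Along the segment the product of all partial sums and all coordinates is a
    nonzero polynomial, which has a nonroot in the unit interval. *)
Let common_point (s : seq {set I}) :
  (forall J, J \in s -> exists2 X, cone X & \sum_(k in J) T k X != 0) ->
  exists X, [/\ cone X, forall j, (j < nv)%N -> 0 < X j &
     forall J, J \in s -> \sum_(k in J) T k X != 0].
Proof.
elim: s => [_|J0 s IH Hs].
  pose p := (\sum_(j < nv | sd j) 1)%N; pose q := (\sum_(j < nv | ~~ sd j) 1)%N.
  have p0 : (0 < p)%N by case: ex_sd => j jn sj; rewrite /p (bigD1 (Ordinal jn)).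
  have q0 : (0 < q)%N by case: ex_nsd => j jn sj; rewrite /q (bigD1 (Ordinal jn)).
  (* Constant on each side, with the sizes of the two sides interchanged, so that both sums are
     [p * q]. *)
  exists (fun j => if sd j then q%:R else p%:R); split=> //.
  - split=> [j _|]; first by case: ifP; rewrite ler0n.
    rewrite (eq_bigr (fun _ => q%:R)) => [|j ->] //.
    rewrite [RHS](eq_bigr (fun _ => p%:R)) => [|j /negbTE ->] //.
    rewrite -!natr_sum; congr _%:R; transitivity (p * q)%N.
      by rewrite /p big_distrl /=; apply: eq_bigr => j _; rewrite mul1n.
    by rewrite mulnC {1}/q big_distrl /=; apply: eq_bigr => j _; rewrite mul1n.
  - by move=> j _; case: ifP; rewrite ltr0n.
have [|X [cX pX HX]] := IH; first by move=> J Js; apply: Hs; rewrite inE Js orbT.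
have [Y cY hY] := Hs J0 (mem_head _ _).
pose P (J : {set I}) : {poly F} := \sum_(k in J) Tpoly k X Y.
have PE J x : (P J).[x] = \sum_(k in J) T k (seg X Y x).
  by rewrite horner_sum; apply: eq_bigr => k _; rewrite TpolyE.
pose Q : {poly F} := P J0 * (\prod_(J <- s) P J) * \prod_(j < nv) segpoly X Y j.
have Q0 : Q != 0.
  rewrite /Q !mulf_neq0 //.
  - apply: contraNneq hY => e; rewrite -[X in _ == X](horner0 1) -e PE; apply/eqP.
    by apply: eq_bigr => k _; apply: eqT => j; rewrite seg1.
  - rewrite prodf_seq_neq0; apply/allP => J Js /=.
    apply: contraNneq (HX J Js) => e; rewrite -[X in _ == X](horner0 0) -e PE; apply/eqP.
    by apply: eq_bigr => k _; apply: eqT => j; rewrite seg0.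
  - apply/prodf_neq0 => j _; apply: contraTneq (pX j (ltn_ord j)) => e.
    by have := segpolyE X Y j 0; rewrite e horner0 seg0 => <-; rewrite ltxx.
have [x x01] := nonroot_unit_interval Q0.
rewrite /Q !hornerM !mulf_eq0 !negb_or => /andP[/andP[h1 h2] h3].
have cS := cone_seg cX cY x01.
exists (seg X Y x); split=> //.
  move=> j jn; have [c1 _] := cS; rewrite lt_neqAle c1 // andbT eq_sym.
  move: h3; rewrite horner_prod => /prodf_neq0 /(_ (Ordinal jn) isT).
  by rewrite segpolyE.
move=> J; rewrite inE => /orP[/eqP ->|Js]; first by rewrite -PE.
move: h2; rewrite horner_prod prodf_seq_neq0 => /allP /(_ J Js) /=.
by rewrite PE.
Qed.

Variable c : nat -> nat.

Hypothesis class_lt3 : forall j, (j < nv)%N -> (c j < 3)%N.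
Hypothesis class_side : (forall j, (j < nv)%N -> (c j == 2) = sd j) \/
  (forall j, (j < nv)%N -> (c j == 2) = ~~ sd j).
Hypothesis class_ex : forall i, (i < 3)%N -> exists2 j, (j < nv)%N & c j = i.

Definition expo i k := (\sum_(j < nv | c j == i) A k j)%N.

Let sumc (X : nat -> F) i := \sum_(j < nv | c j == i) X j.

Let cone_class X : cone X <-> (forall j, (j < nv)%N -> 0 <= X j) /\
  sumc X 2 = sumc X 0 + sumc X 1.
Proof.
have e01 : sumc X 0 + sumc X 1 = \sum_(j < nv | c j != 2) X j.
  rewrite [RHS](bigID (fun j : 'I_nv => c j == 0%N)) /=; congr (_ + _);
  apply: eq_bigl => j; have := class_lt3 (ltn_ord j);
  by case: (c j) => [|[|[|]]].
rewrite /cone e01 /sumc; case: class_side => H.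
  have -> : \sum_(j < nv | c j == 2) X j = \sum_(j < nv | sd j) X j.
    by apply: eq_bigl => j; rewrite H.
  have -> : \sum_(j < nv | c j != 2) X j = \sum_(j < nv | ~~ sd j) X j.
    by apply: eq_bigl => j; rewrite H.
  by [].
have -> : \sum_(j < nv | c j == 2) X j = \sum_(j < nv | ~~ sd j) X j.
  by apply: eq_bigl => j; rewrite H.
have -> : \sum_(j < nv | c j != 2) X j = \sum_(j < nv | sd j) X j.
  by apply: eq_bigl => j; rewrite H // negbK.
by split=> -[h1 h2].
Qed.

Lemma projection_bound (a b m : nat) :
  (forall k, a <= expo 0 k)%N -> (forall k, b <= expo 1 k)%N ->
  (forall k, m <= expo 2 k)%N ->
  (exists k, expo 0 k = a) -> (exists k, expo 1 k = b) -> (exists k, expo 2 k = m) ->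
  (a + b + m < D)%N -> (D + 5 <= 2 * #|I| + (a + b + m))%N.
Proof.
have [X [cX pX HX]] := @common_point (enum [pred J : {set I} | (J != set0) && (J != [set: I])])
  (fun J => ltac:(by rewrite mem_enum => /andP[h1 h2]; apply: indec)).
have {}HX J : J != set0 -> J != [set: I] -> \sum_(k in J) T k X != 0.
  by move=> h1 h2; apply: HX; rewrite mem_enum inE h1 h2.
have sp i : (i < 3)%N -> 0 < sumc X i.
  move=> /class_ex[j jn cj]; rewrite /sumc (bigD1 (Ordinal jn)) /= ?cj //.
  by rewrite ltr_pwDl ?pX // sumr_ge0 // => j' _; rewrite ltW // pX.
have s2 : sumc X 2 = sumc X 0 + sumc X 1 by have /cone_class[] := cX.
(* The generic point is normalized to sum 1 on each class, and the classes are then scaled by [x],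
   [1] and [1 + x], which preserves the equation of the cone. *)
pose lam j := X j / sumc X (c j).
pose val (x : F) j := if c j == 0%N then x else if c j == 1%N then 1 else 1 + x.
pose Y x j := lam j * val x j.
have sumlam i : (i < 3)%N -> sumc lam i = 1.
  move=> i3; rewrite /sumc /lam (eq_bigr (fun j : 'I_nv => X j / sumc X i)) => [|j /eqP -> //].
  by rewrite -mulr_suml divff // gt_eqF // sp.
have sumY x i : (i < 3)%N -> sumc (Y x) i = if i == 0%N then x else if i == 1%N then 1 else 1 + x.
  move=> i3; rewrite /sumc /Y (eq_bigr (fun j : 'I_nv => lam j *
     (if i == 0%N then x else if i == 1%N then 1 else 1 + x))) => [|j /eqP e].
    by rewrite -mulr_suml -/(sumc lam i) sumlam // mul1r.
  by rewrite /val e.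
have coneY x : 0 <= x -> cone (Y x).
  move=> x0; apply/cone_class; split; last by rewrite !sumY //= addrC.
  move=> j jn; rewrite /Y /lam; apply: mulr_ge0.
    by apply: divr_ge0; apply: ltW; [apply: pX|apply/sp/class_lt3].
  by rewrite /val; case: ifP => // _; case: ifP => // _; rewrite addr_ge0.
pose w' k := w k * \prod_(j < nv) lam j ^+ A k j.
pose U k : {poly F} := (w' k)%:P * 'X^(expo 0 k) * (1 + 'X) ^+ expo 2 k.
have UE k x : (U k).[x] = T k (Y x).
  rewrite /U !hornerE /= /w' /T -!mulrA; congr (_ * _).
  rewrite /Y; under [RHS]eq_bigr do rewrite exprMn.
  rewrite big_split /=; congr (_ * _).
  rewrite [RHS](bigID (fun j : 'I_nv => c j == 0%N)) /=; congr (_ * _).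
    rewrite (eq_bigr (fun j : 'I_nv => x ^+ A k j)) => [|j h]; last by rewrite /val h.
    by rewrite prodrXr.
  rewrite (bigID (fun j : 'I_nv => c j == 1%N)) /= big1 ?mul1r => [|j /andP[h1 h2]]; last first.
    by rewrite /val (negbTE h1) h2 expr1n.
  rewrite (eq_bigr (fun j : 'I_nv => (1 + x) ^+ A k j)) => [|j /andP[h1 h2]]; last first.
    by rewrite /val (negbTE h1) (negbTE h2).
  rewrite prodrXr; congr (_ ^+ _); apply: eq_bigl => j.
  by have := class_lt3 (ltn_ord j); case: (c j) => [|[|[|]]].
have sumU : \sum_k U k = 0.
  apply: (poly_eq0_infinite (@natr_inj F)) => n.
  rewrite horner_sum (eq_bigr _ (fun k _ => UE k n%:R)); apply: vanish.
  exact/coneY/ler0n.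
have minU (J : {set I}) : J != set0 -> \sum_(k in J) U k = 0 -> J = [set: I].
  move=> J0 UJ; apply/eqP; apply: contraT => JT; case/negP: (HX J J0 JT); apply/eqP.
  (* Up to scaling the line passes through [X]; by homogeneity a proper subsum vanishing along the
     line would vanish at [X], which was chosen to prevent this. *)
  have YX j : (j < nv)%N -> Y (sumc X 0 / sumc X 1) j = X j / sumc X 1.
    move=> jn; have s0 := sp 0%N isT; have s1 := sp 1%N isT; have n1 := lt0r_neq0 s1.
    have n0 := lt0r_neq0 s0; have n2 : sumc X 0 + sumc X 1 != 0 by rewrite -s2 lt0r_neq0 // sp.
    rewrite /Y /lam /val; have := class_lt3 jn; case: (c j) => [|[|[|]]] //= _.
    - by field; rewrite n1 n0.
    - by rewrite mulr1.
    - by rewrite s2; field; rewrite n1 n2.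
  have TY k : T k (Y (sumc X 0 / sumc X 1)) = T k X * (sumc X 1)^-1 ^+ D.
    rewrite /T -mulrA; congr (_ * _); rewrite -(size_A k) -prodrXr -big_split /=.
    by apply: eq_bigr => j _; rewrite YX // exprMn.
  have h : (sumc X 1)^-1 ^+ D != 0 by rewrite expf_neq0 // invr_neq0 // lt0r_neq0 // sp.
  apply: (mulIf h); rewrite mul0r mulr_suml.
  have := congr1 (fun g : {poly F} => g.[sumc X 0 / sumc X 1]) UJ.
  rewrite horner0 horner_sum => e; rewrite -[RHS]e; apply: eq_bigr => k _.
  by rewrite UE TY.
apply: (@relation_bound F I w' (expo 0) (expo 1) (expo 2)) => // k; last first.
  rewrite /w' mulf_neq0 //; apply/prodf_neq0 => j _; rewrite expf_neq0 // /lam.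
  by rewrite mulf_neq0 ?invr_neq0 ?lt0r_neq0 ?pX ?sp ?class_lt3.
rewrite -(size_A k) [RHS](bigID (fun j : 'I_nv => c j == 0%N)) /= -addnA; congr (_ + _)%N.
rewrite [RHS](bigID (fun j : 'I_nv => c j == 1%N)) /=; congr (_ + _)%N;
apply: eq_bigl => j; have := class_lt3 (ltn_ord j); by case: (c j) => [|[|[|]]].
Qed.

End Projection.

(** * Monomial CR maps *)

Lemma RsumE n g : Rsum n g = \sum_(i < n) g i.
Proof. by elim: n => [|n IH] /=; rewrite ?big_ord0 // big_ord_recr /= -IH. Qed.

Lemma nsumE n g : nsum n g = (\sum_(i < n) g i)%N.
Proof. by elim: n => [|n IH] /=; rewrite ?big_ord0 // big_ord_recr /= -IH. Qed.

Lemma Cnorm2_mul x y : Cnorm2 (Cmul x y) = Cnorm2 x * Cnorm2 y.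
Proof.
rewrite /Cnorm2 /Cmul /=; move: (re x) (im x) (re y) (im y) => p q r s.
by rewrite !(RmultE, RplusE, RminusE); ring.
Qed.

Lemma Cnorm2_1 : Cnorm2 Defs.C1 = 1.
Proof. by rewrite /Cnorm2 /= !(RmultE, RplusE) mulr1 mulr0 addr0. Qed.

Lemma Cnorm2_pow x m : Cnorm2 (Cpow x m) = Cnorm2 x ^+ m.
Proof. by elim: m => [|m IH] /=; rewrite ?Cnorm2_1 // Cnorm2_mul IH exprS. Qed.

Lemma Cnorm2_prod n g : Cnorm2 (Cprod n g) = \prod_(i < n) Cnorm2 (g i).
Proof.
by elim: n => [|n IH] /=; rewrite ?big_ord0 ?Cnorm2_1 // big_ord_recr /= Cnorm2_mul IH.
Qed.

Lemma Cnorm2_monomial nv c alpha z : Cnorm2 (monomial nv c alpha z) =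
  Cnorm2 c * \prod_(j < nv) Cnorm2 (z j) ^+ alpha j.
Proof.
rewrite /monomial Cnorm2_mul Cnorm2_prod; congr (_ * _).
by apply: eq_bigr => j _; rewrite Cnorm2_pow.
Qed.

Lemma Cnorm2_ge0 x : 0 <= Cnorm2 x.
Proof.
rewrite /Cnorm2 !(RmultE, RplusE) addr_ge0 // -expr2; exact: sqr_ge0.
Qed.

Lemma Cnorm2_eq0 x : Cnorm2 x = 0 -> x = Defs.C0.
Proof.
case: x => p q; rewrite /Cnorm2 /= !(RmultE, RplusE) -!expr2 => /eqP.
by rewrite paddr_eq0 ?sqr_ge0 // !sqrf_eq0 => /andP[/eqP -> /eqP ->].
Qed.

Definition rpoint (X : nat -> R) (j : nat) : CC := mkC (sqrt (X j)) 0.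

Lemma Cnorm2_rpoint X j : 0 <= X j -> Cnorm2 (rpoint X j) = X j.
Proof.
move=> /RleP h; rewrite /Cnorm2 /rpoint /= sqrt_sqrt // !(RmultE, RplusE) mulr0 addr0 //.
Qed.

Lemma Cmul0l x : Cmul Defs.C0 x = Defs.C0.
Proof.
by case: x => p q; congr mkC; rewrite /= !Rmult_0_l ?Rminus_0_r ?Rplus_0_r.
Qed.

Lemma Cmul0r x : Cmul x Defs.C0 = Defs.C0.
Proof.
by case: x => p q; congr mkC; rewrite /= !Rmult_0_r ?Rminus_0_r ?Rplus_0_r.
Qed.

Lemma CnzE x : Cnz x = (Cnorm2 x != 0).
Proof.
case: x => p q; rewrite /Cnz /Cnorm2 /= !(RmultE, RplusE) -!expr2 paddr_eq0 ?sqr_ge0 // !sqrf_eq0.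
have nz (t : R) : (t == 0) = (if Req_dec_T t 0 then true else false).
  by case: (Req_dec_T t 0) => h; apply/eqP.
by rewrite !nz; case: (Req_dec_T p 0) => hp; case: (Req_dec_T q 0).
Qed.

Lemma Csum0 n g : (forall k, (k < n)%N -> g k = Defs.C0) -> Csum n g = Defs.C0.
Proof.
elim: n => [//|n IH] H /=; rewrite IH ?H //; last by move=> k kn; apply: H; apply: ltnW.
by congr mkC; rewrite /= RplusE addr0.
Qed.

Lemma fold_min_spec (f : nat -> nat) r x :
  let v := fold_left (fun m k => Nat.min m (f k)) r x in
  [/\ (v <= x)%N, forall k, List.In k r -> (v <= f k)%N &
      v = x \/ exists2 k, List.In k r & v = f k].
Proof.
elim: r x => [|k r IH] x /=; first by split=> //; left.
have [h1 h2 h3] := IH (Nat.min x (f k)).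
have hm : Nat.min x (f k) = minn x (f k) by lia.
split; first by rewrite (leq_trans h1) // hm geq_minl.
  by move=> k' [<-|/h2 //]; rewrite (leq_trans h1) // hm geq_minr.
case: h3 => [->|[k' hk' e]]; last by right; exists k' => //; right.
rewrite hm; case: (leqP x (f k)) => h; [left|right]; first by [].
by exists k => //; left.
Qed.

Lemma filter_all (f : nat -> bool) l : (forall k, List.In k l -> f k) -> List.filter f l = l.
Proof.
elim: l => //= k l IH H; rewrite H; last by left.
by rewrite IH // => k' h; apply: H; right.
Qed.

(** * Indecomposable monomial CR maps *)

Section CRMap.

Variables (a b c e : nat) (Cf : nat -> CC) (A : nat -> nat -> nat).

Hypothesis a1 : le 1 a.
Hypothesis CR : is_monomial_CR_map a b c e Cf A.
Hypothesis indep : lin_indep_components a b c e Cf A.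
Hypothesis indec : ~ monomial_decomposable a b c e Cf A.

Let nv := (a + b).+1.
Let K := (c + e).+1.
Let sd : pred nat := fun j => (j < a)%N.
Let w (k : 'I_K) : R := if (k < c)%N then Cnorm2 (Cf k) else - Cnorm2 (Cf k).
Let T (k : 'I_K) (X : nat -> R) := w k * \prod_(j < nv) X j ^+ A k j.

Lemma Cf_neq0 k : (k < K)%N -> Cnorm2 (Cf k) != 0.
Proof.
move=> kK; apply/eqP => /Cnorm2_eq0 e0.
have := indep (lam := fun k' => if k' == k then Defs.C1 else Defs.C0).
have kK' : le k (c + e) by apply/ssrnat.leP; rewrite -ltnS.
move=> /(_ _ k kK'); rewrite eqxx => H; have : Defs.C1 = Defs.C0.
  apply: H => z; apply: Csum0 => k' _; case: eqP => [->|_]; last exact: Cmul0l.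
  by rewrite /Defs.comp /monomial e0 Cmul0l Cmul0r.
by move=> /(congr1 re) /=; exact: R1_neq_R0.
Qed.

Lemma sum_lt_split (p q : nat) (G : nat -> R) :
  \sum_(j < (p + q).+1 | (j < p)%N) G j = Rsum p G /\
  \sum_(j < (p + q).+1 | ~~ (j < p)%N) G j = Rsum (S q) (fun k => G (Nat.add p k)).
Proof.
rewrite !RsumE -addnS; split.
  rewrite big_mkcond big_split_ord /= [X in _ + X]big1 ?addr0 => [|i _]; last first.
    by rewrite ltnNge leq_addr.
  by apply: eq_bigr => i _; rewrite ltn_ord.
rewrite big_mkcond big_split_ord /= [X in X + _]big1 ?add0r => [|i _]; last first.
  by rewrite ltn_ord.
by apply: eq_bigr => i _; rewrite ltnNge leq_addr.
Qed.

Let hqformE p q u : hqform p q u = \sum_(j < (p + q).+1 | (j < p)%N) Cnorm2 (u j) -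
  \sum_(j < (p + q).+1 | ~~ (j < p)%N) Cnorm2 (u j).
Proof. by have [-> ->] := sum_lt_split p q (fun j => Cnorm2 (u j)). Qed.

Let cone_z z : hqform a b z = 0 -> cone nv sd (fun j => Cnorm2 (z j)).
Proof.
rewrite hqformE => /eqP; rewrite subr_eq0 => /eqP h; split; last exact: h.
by move=> j _; apply: Cnorm2_ge0.
Qed.

Let TE z (k : 'I_K) : T k (fun j => Cnorm2 (z j)) =
  if (k < c)%N then Cnorm2 (Defs.comp a b Cf A k z) else - Cnorm2 (Defs.comp a b Cf A k z).
Proof. by rewrite /T /w /Defs.comp Cnorm2_monomial; case: ifP => // _; rewrite mulNr. Qed.

Let eqT k X Y : (forall j, (j < nv)%N -> X j = Y j) -> T k X = T k Y.
Proof. by move=> E; congr (_ * _); apply: eq_bigr => j _; rewrite E. Qed.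

Let vanish_z z : hqform a b z = 0 -> \sum_k T k (fun j => Cnorm2 (z j)) = 0.
Proof.
case: CR => _ [_ H] /H; rewrite hqformE => h; rewrite -[RHS]h -/K.
rewrite (bigID (fun k : 'I_K => (k < c)%N)) /= -sumrN; congr (_ + _);
by apply: eq_bigr => k hk; rewrite TE ?hk // (negbTE hk).
Qed.

Let rpoint_cone X : cone nv sd X -> hqform a b (rpoint X) = 0.
Proof.
move=> [X0 eX]; rewrite hqformE; apply/eqP; rewrite subr_eq0; apply/eqP.
transitivity (\sum_(j < nv | sd j) X j).
  by apply: eq_bigr => j _; rewrite Cnorm2_rpoint ?X0.
by rewrite eX; apply: eq_bigr => j _; rewrite Cnorm2_rpoint ?X0.
Qed.

Let vanish X : cone nv sd X -> \sum_k T k X = 0.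
Proof.
move=> cX; rewrite -[RHS](vanish_z (rpoint_cone cX)); apply: eq_bigr => k _; apply: eqT => j jn.
by case: cX => X0 _; rewrite Cnorm2_rpoint ?X0.
Qed.

(** If the sum over [J] vanishes on the cone, so does the complementary one, the total being zero;
    this is a decomposition. *)
Let indec_sum (J : {set 'I_K}) : J != set0 -> J != [set: 'I_K] ->
  exists2 X, cone nv sd X & \sum_(k in J) T k X != 0.
Proof.
move=> J0 JT; have [//|nex] := boolp.pselect (exists2 X, cone nv sd X & \sum_(k in J) T k X != 0).
have J_0 X : cone nv sd X -> \sum_(k in J) T k X = 0.
  by move=> cX; apply/eqP; apply: contraT => h; case: nex; exists X.
case: indec; pose P k := if insub k is Some i then i \in J else false.
have PE (k : 'I_K) : P k = (k \in J) by rewrite /P valK.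
have leK (k : 'I_K) : le k (c + e) by apply/ssrnat.leP; rewrite -ltnS.
have pE (Q : nat -> bool) z : partial_form a b c e Cf A Q z =
    \sum_(k < K | Q k) T k (fun j => Cnorm2 (z j)).
  rewrite /partial_form RsumE [RHS]big_mkcond; apply: eq_bigr => k _.
  rewrite TE; case: (Q k) => //; have -> : (k <? c)%nat = (k < c)%N; last by [].
  by apply/idP/idP => [/Nat.ltb_lt/ssrnat.ltP|/ssrnat.ltP/Nat.ltb_lt].
exists P; split; [|split].
- by have /set0Pn[k kJ] := J0; exists k; split=> //; rewrite PE.
- have : ~: J != set0 by apply: contraNneq JT => h; rewrite -[J]setCK h setC0.
  case/set0Pn => k; rewrite inE => kJ; exists k; split=> //.
  by rewrite PE (negbTE kJ).
move=> z hz; have hJ := J_0 _ (cone_z hz); have hT := vanish_z hz.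
have eJ : \sum_(k < K | P k) T k (fun j => Cnorm2 (z j)) = 0.
  by rewrite -[RHS]hJ; apply: eq_bigl => k; rewrite PE.
split; rewrite pE //.
by move: hT; rewrite (bigID (fun k : 'I_K => P k)) /= eJ add0r.
Qed.

Let D := nsum nv (A 0%N).

Lemma size_exp (k : 'I_K) : (\sum_(j < nv) A k j = D)%N.
Proof.
case: CR => -[d Hd] _; rewrite -nsumE /D.
have h0 : le 0 (c + e) by apply/ssrnat.leP.
have hk : le k (c + e) by apply/ssrnat.leP; rewrite -ltnS.
by rewrite (Hd _ h0) (Hd _ hk).
Qed.

Lemma CR_projection (cl : nat -> nat) (x y z : nat) :
  (forall j, (j < nv)%N -> (cl j < 3)%N) ->
  (forall j, (j < nv)%N -> (cl j == 2) = sd j) \/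
  (forall j, (j < nv)%N -> (cl j == 2) = ~~ sd j) ->
  (forall i, (i < 3)%N -> exists2 j, (j < nv)%N & cl j = i) ->
  let ex i (k : 'I_K) := expo nv (fun k : 'I_K => A k) cl i k in
  (forall k, x <= ex 0%N k)%N -> (forall k, y <= ex 1%N k)%N -> (forall k, z <= ex 2%N k)%N ->
  (exists k, ex 0%N k = x) -> (exists k, ex 1%N k = y) -> (exists k, ex 2%N k = z) ->
  (x + y + z < D)%N -> (D + 5 <= 2 * K + (x + y + z))%N.
Proof.
move=> cl3 cls clx ex hx hy hz ox oy oz hD; rewrite -[K]card_ord.
apply: (@projection_bound _ _ nv D sd w (fun k : 'I_K => A k) _ _ _ _ _ _ cl) => //.
- exact: size_exp.
- move=> k; rewrite /w; case: ifP => _; rewrite ?oppr_eq0; exact: Cf_neq0.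
- by exists 0%N => //; apply/ssrnat.leP.
- by exists a; rewrite /sd ?ltnn // /nv ltnS leq_addr.
Qed.

Let g j := gcd_exp K Cf A j.

Let nz_all : nz_idx K Cf = List.seq 0 K.
Proof.
apply: filter_all => k /List.in_seq[_ /ssrnat.ltP h]; rewrite CnzE; exact: Cf_neq0.
Qed.

Lemma gcd_le (k : 'I_K) j : (g j <= A k j)%N.
Proof.
rewrite /g /gcd_exp nz_all /=; have [h1 h2 _] := fold_min_spec (fun k => A k j) (List.seq 1 (c + e)) (A 0%N j).
case: k => -[|k] kK //=; apply: h2; apply/List.in_seq; split; apply/ssrnat.leP => //.
Qed.

Lemma gcd_ex j : exists k : 'I_K, A k j = g j.
Proof.
rewrite /g /gcd_exp nz_all /=; have [_ _] := fold_min_spec (fun k => A k j) (List.seq 1 (c + e)) (A 0%N j).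
case=> [->|[k /List.in_seq[_ /ssrnat.ltP h] ->]]; first by exists ord0.
have kK : (k < K)%N by [].
by exists (Ordinal kK).
Qed.

Lemma deg_CR_E : deg_CR a b c e Cf A = (\sum_(j < nv) (A 0 j - g j))%N.
Proof. by rewrite /deg_CR /mdeg nz_all [LHS]nsumE. Qed.

(* Project with [{j0}] as one of the three classes. *)
Lemma exponent_range (k : 'I_K) j0 : (j0 < nv)%N -> (2 <= a + b)%N -> (A k j0 <= 2 * K + g j0)%N.
Proof.
move=> jn n2.
have bound (cl : nat -> nat) i0 : (i0 < 3)%N ->
  (forall j, (j < nv)%N -> (cl j < 3)%N) ->
  (forall j, (j < nv)%N -> (cl j == 2) = sd j) \/
  (forall j, (j < nv)%N -> (cl j == 2) = ~~ sd j) ->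
  (forall i, (i < 3)%N -> exists2 j, (j < nv)%N & cl j = i) ->
  (forall j, (j < nv)%N -> (cl j == i0) = (j == j0)) -> (A k j0 <= 2 * K + g j0)%N.
  move=> i03 cl3 cls clx cl0.
  pose ex i (k : 'I_K) := expo nv (fun k : 'I_K => A k) cl i k.
  have exj k' : ex i0 k' = A k' j0.
    rewrite /ex /expo (big_pred1 (Ordinal jn)) // => j.
    by rewrite cl0 // -(inj_eq val_inj).
  have sumex k' : (ex 0%N k' + ex 1%N k' + ex 2%N k' = D)%N.
    rewrite -(size_exp k') [RHS](bigID (fun j : 'I_nv => cl j == 0%N)) /= -addnA; congr (_ + _)%N.
    rewrite [RHS](bigID (fun j : 'I_nv => cl j == 1%N)) /=; congr (_ + _)%N;
    apply: eq_bigl => j; have := cl3 j (ltn_ord j); by case: (cl j) => [|[|[|]]].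
  pose mn i := minval (ex i) [set: 'I_K].
  have mnle i k' : (mn i <= ex i k')%N by apply: minval_le.
  have mnex i : exists k', ex i k' = mn i.
    have [|t _ h] := @minval_ex _ (ex i) [set: 'I_K]; last by exists t.
    by apply/set0Pn; exists k.
  have := @CR_projection cl (mn 0%N) (mn 1%N) (mn 2%N) cl3 cls clx (mnle 0%N) (mnle 1%N) (mnle 2%N)
    (mnex 0%N) (mnex 1%N) (mnex 2%N).
  have gi : (mn i0 <= g j0)%N.
    by have [k' <-] := gcd_ex j0; rewrite -exj.
  have := sumex k; have := mnle 0%N k; have := mnle 1%N k; have := mnle 2%N k.
  have := exj k; case: (leqP D (mn 0%N + mn 1%N + mn 2%N)) => hD; last move=> + + + + + /(_ isT).
    by case: i0 gi {exj cl0} i03 => [|[|[|]]] // gi _; lia.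
  by case: i0 gi {exj cl0} i03 => [|[|[|]]] // gi _; lia.
(* If the side of [j0] has another variable, it splits into [{j0}] and the rest, and the opposite
   side is class 2. Otherwise [{j0}] is a full side and becomes class 2; the opposite side then has
   at least two variables to split, as [2 <= a + b]. *)
have [/existsP[j1 /andP[s1 n1]]|/existsPn alone] :=
  boolP [exists j1 : 'I_nv, (sd j1 == sd j0) && (j1 != j0 :> nat)].
  apply: (bound (fun j => if j == j0 then 0 else if sd j == sd j0 then 1 else 2)%N 0%N) => //.
  - by move=> j _; case: ifP => // _; case: ifP.
  - case s0 : (sd j0); [right|left] => j _; case: (eqVneq j j0) => [->|_]; rewrite ?s0 //;
    by case: (sd j).
  - case=> [|[|[|]]] // _; first by exists j0; rewrite ?eqxx.
      by exists j1 => //; rewrite (negbTE n1) s1.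
    case s0 : (sd j0).
      exists a; first by rewrite /nv ltnS leq_addr.
      have -> : (a == j0) = false by apply/negP => /eqP h; move: s0; rewrite /sd -h ltnn.
      by rewrite /sd ltnn.
    exists 0%N => //; have sa : sd 0%N by apply/ssrnat.leP.
    by rewrite sa; case: eqP => // h; move: s0; rewrite -h sa.
  - by move=> j _; case: ifP => // _; case: ifP.
have alone' j : (j < nv)%N -> j != j0 -> sd j = ~~ sd j0.
  move=> jn' jj; have := alone (Ordinal jn'); rewrite /= jj andbT.
  by case: (sd j); case: (sd j0).
have [i1 [i2 [h1 h2 h3 h4 h5]]] : exists i1 i2, [/\ (i1 < nv)%N, (i2 < nv)%N, i1 != j0, i2 != j0 & i1 != i2].
  exists (if j0 == 0%N then 1%N else 0%N), (if (j0 <= 1)%N then 2%N else 1%N).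
  rewrite /nv; case: (j0) => [|[|[|j]]] /=; split=> //; lia.
apply: (bound (fun j => if j == j0 then 2 else if j == i1 then 0 else 1)%N 2%N) => //.
- by move=> j _; case: ifP => // _; case: ifP.
- case s0 : (sd j0); [left|right] => j jn'; case: (eqVneq j j0) => [->|jj]; rewrite ?s0 //;
  by rewrite (alone' j) // s0; case: ifP.
- case=> [|[|[|]]] // _.
  + by exists i1; rewrite // (negbTE h3) eqxx.
  + by exists i2; rewrite // (negbTE h4) eq_sym (negbTE h5).
  by exists j0; rewrite ?eqxx.
- by move=> j _; case: ifP => // _; case: ifP.
Qed.

End CRMap.

(** The degree is the sum, over the [a + b + 1] variables, of the excess of the exponent over its
    minimum, and [exponent_range] bounds each excess. *)
Lemma CR_degree_bound a b c e Cf A : le 1 a -> le 2 (a + b) ->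
  is_monomial_CR_map a b c e Cf A -> lin_indep_components a b c e Cf A ->
  ~ monomial_decomposable a b c e Cf A ->
  le (deg_CR a b c e Cf A) ((a + b).+1 * (2 * (c + e).+1)).
Proof.
move=> a1 /ssrnat.leP n2 CR li id; apply/ssrnat.leP; rewrite (deg_CR_E li).
rewrite -[X in (_ <= X * _)%N]card_ord -sum_nat_const; apply: leq_sum => j _.
by rewrite leq_subLR [(gcd_exp _ _ _ _ + _)%N]addnC; apply: (exponent_range a1 CR li id ord0).
Qed.

Lemma Cnorm2_0 : Cnorm2 Defs.C0 = 0.
Proof. by rewrite /Cnorm2 /= Rmult_0_l Rplus_0_r. Qed.

(** Two multiples of one monomial, with coefficients [C_0] and [C_1], satisfy the relation with
    weights [C_1] and [- C_0]. This excludes maps of degree 0 for [N = 1], where [2N - 3] is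
    negative. *)
Lemma lin_indep_two_terms a b c e Cf A : (c + e = 1)%N ->
  lin_indep_components a b c e Cf A ->
  ~ (forall j, (j < (a + b).+1)%N -> A 0%N j = A 1%N j).
Proof.
move=> ce li eqA; pose Copp (x : CC) := mkC (- re x) (- im x).
have lt1 : (0 < (c + e).+1)%N by [].
case/negP: (Cf_neq0 li lt1); apply/eqP.
have le1 : le 1 (c + e) by apply/ssrnat.leP; rewrite ce.
have /(_ _ 1%N le1) := li (fun k => if k is 0 then Cf 1%N else Copp (Cf 0%N)).
have Cprod_ext n u v : (forall j, (j < n)%N -> u j = v j) -> Cprod n u = Cprod n v.
  elim: n => [//|n IH] H /=; rewrite IH ?H // => j jn; apply: H; exact: ltnW.
suff H : forall z, Csum (S (c + e)) (fun k =>
    Cmul (if k is 0 then Cf 1%N else Copp (Cf 0%N)) (Defs.comp a b Cf A k z)) = Defs.C0.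
  move=> /(_ H) /(congr1 Cnorm2) => h; rewrite -[RHS]Cnorm2_0 -h.
  by rewrite /Cnorm2 /= !(RmultE, RplusE, RoppE) !mulrNN.
move=> z; rewrite ce /= /Defs.comp /monomial.
have -> : Cprod (S (a + b)) (fun j => Cpow (z j) (A 1%N j)) =
          Cprod (S (a + b)) (fun j => Cpow (z j) (A 0%N j)).
  by apply: Cprod_ext => j jn; rewrite eqA.
case: (Cf 0%N) => p q; case: (Cf 1%N) => r s; case: (Cprod _ _) => u v.
rewrite /Cadd /Cmul /Copp /=; rewrite !Rplus_0_l !(RmultE, RplusE, RminusE, RoppE).
by congr mkC; transitivity (0%R : R) => //; ring.
Qed.

Lemma CR_degree_bound_three a b c e Cf A : le 1 a -> le 1 c -> (a + b = 2)%coq_nat ->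
  is_monomial_CR_map a b c e Cf A -> lin_indep_components a b c e Cf A ->
  ~ monomial_decomposable a b c e Cf A ->
  le (deg_CR a b c e Cf A + 3) (2 * (c + e)).
Proof.
move=> a1 c1 n2 CR li id; apply/ssrnat.leP; rewrite (deg_CR_E li).
have gle := gcd_le li; have gex := gcd_ex li; have hD := size_exp CR.
pose g := gcd_exp (c + e).+1 Cf A.
(* Each class is one variable, and [ic] inverts [cl]. Class 2 is the variable alone on its side: the
   last one for [(a, b) = (2, 0)], the first one for [(1, 1)]. *)
have [cl [ic [clic iccl cls]]] : exists cl ic : nat -> nat,
  [/\ forall i, (i < 3)%N -> (ic i < (a + b).+1)%N /\ cl (ic i) = i,
    forall j, (j < (a + b).+1)%N -> (cl j < 3)%N /\ ic (cl j) = j &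
    (forall j, (j < (a + b).+1)%N -> (cl j == 2) = (j < a)%N) \/
      (forall j, (j < (a + b).+1)%N -> (cl j == 2) = ~~ (j < a)%N)].
  have [[-> ->]|[-> ->]] : (a = 2 /\ b = 0 \/ a = 1 /\ b = 1)%N by lia.
    exists (fun j => j), (fun j => j); split=> //; right.
    by case=> [|[|[|]]].
  exists (fun j => if j is j'.+1 then j' else 2)%N, (fun i => if i is 2 then 0 else i.+1)%N.
  by split; [case=> [|[|[|]]]|case=> [|[|[|]]]|left; case=> [|[|[|]]]].
have ic3 i : (i < 3)%N -> (ic i < (a + b).+1)%N by move=> /clic[].
have pick (f : nat -> nat) i : (i < 3)%N -> (\sum_(j < (a + b).+1 | cl j == i) f j = f (ic i))%N.
  move=> i3; rewrite (big_pred1 (Ordinal (ic3 i i3))) // => j.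
  have [_ e1] := clic i i3; have [_ e2] := iccl j (ltn_ord j).
  by apply/eqP/eqP => [h|->] //; apply: val_inj; rewrite /= -h e2.
have sum3 (f : nat -> nat) : (\sum_(j < (a + b).+1) f j = f (ic 0%N) + f (ic 1%N) + f (ic 2%N))%N.
  rewrite -!pick // [LHS](bigID (fun j : 'I_(a + b).+1 => cl j == 0%N)) /= -addnA.
  congr (_ + _)%N; rewrite [LHS](bigID (fun j : 'I_(a + b).+1 => cl j == 1%N)) /=.
  by congr (_ + _)%N; apply: eq_bigl => j; have [] := iccl j (ltn_ord j); case: (cl j) => [|[|[|]]].
have proj := @CR_projection _ _ _ _ _ _ a1 CR li id cl (g (ic 0%N)) (g (ic 1%N)) (g (ic 2%N)).
have exE i (k : 'I_(c + e).+1) : (i < 3)%N ->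
  expo (a + b).+1 (fun k : 'I_(c + e).+1 => A k) cl i k = A k (ic i).
  by move=> i3; rewrite /expo pick.
have {}proj : (g (ic 0%N) + g (ic 1%N) + g (ic 2%N) < nsum (a + b).+1 (A 0%N))%N ->
   (nsum (a + b).+1 (A 0%N) + 5 <= 2 * (c + e).+1 + (g (ic 0%N) + g (ic 1%N) + g (ic 2%N)))%N.
  apply: proj => //.
  - by move=> j /iccl[].
  - by move=> i /clic[h1 h2]; exists (ic i).
  - by move=> k; rewrite exE //; apply: gle.
  - by move=> k; rewrite exE //; apply: gle.
  - by move=> k; rewrite exE //; apply: gle.
  - by have [k hk] := gex (ic 0%N); exists k; rewrite exE.
  - by have [k hk] := gex (ic 1%N); exists k; rewrite exE.
  - by have [k hk] := gex (ic 2%N); exists k; rewrite exE.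
have hD0 := hD ord0; rewrite (sum3 (A 0%N)) in hD0.
rewrite (sum3 (fun j => A 0 j - gcd_exp (c + e).+1 Cf A j)%N) -/g -hD0 in proj *.
have l0 := gle ord0 (ic 0%N); have l1 := gle ord0 (ic 1%N); have l2 := gle ord0 (ic 2%N).
rewrite -/g /= in l0 l1 l2.
case: (ltnP (g (ic 0%N) + g (ic 1%N) + g (ic 2%N)) (A 0%N (ic 0%N) + A 0%N (ic 1%N) + A 0%N (ic 2%N))) => hlt.
  have := proj hlt; clear - l0 l1 l2; lia.
(* Here all components are multiples of one monomial and the degree is 0, so [c + e >= 2] is
   enough. *)
suff : (c + e != 1)%N by clear - l0 l1 l2 hlt c1; lia.
apply/eqP => ce1; apply: (lin_indep_two_terms ce1 li) => j jn.
have eqg (k : 'I_(c + e).+1) : A k j = g j.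
  have := hD k; rewrite -hD0 (sum3 (A k)); have [] := iccl j jn => j3 <-.
  have k0 := gle k (ic 0%N); have k1 := gle k (ic 1%N); have k2 := gle k (ic 2%N).
  by rewrite -/g in k0 k1 k2; case: (cl j) j3 => [|[|[|]]] //= _; lia.
have h1 : (1 < (c + e).+1)%N by rewrite ce1.
by rewrite (eqg ord0) (eqg (Ordinal h1)).
Qed.

(** * Monomial maps between spheres *)

Lemma sum_eq_le1 (m n c : nat) : (\sum_(m <= j < n) (c == j) <= 1)%N.
Proof.
rewrite -big_mkcondr /= sum1_count; have -> : count (fun j => c == j) (index_iota m n) = count_mem c (index_iota m n).
  by apply: eq_count => j; rewrite /= eq_sym.
by rewrite count_uniq_mem ?iota_uniq //; case: (_ \in _).
Qed.

Section Sphere.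

Variables (F : realFieldType) (I : finType) (w : I -> F) (al be ga : I -> nat) (d : nat).

Let e t := (al t + be t + ga t)%N.

Hypothesis w_ge0 : forall t, 0 <= w t.
Hypothesis e_le : forall t, w t != 0 -> (e t <= d)%N.
Hypothesis e_max : exists2 t, w t != 0 & e t = d.
Hypothesis d_gt0 : (0 < d)%N.
Hypothesis sphere : forall x y z, 0 <= x -> 0 <= y -> 0 <= z -> x + y + z = 1 ->
  \sum_t w t * (x ^+ al t * y ^+ be t * z ^+ ga t) = 1.

(** Row [j] of the part of degree [l]; the exponent of [y] is determined by [l] and need not be
    recorded. *)
Let p l j : {poly F} := \sum_(t | (ga t == j) && (e t == l)) (w t)%:P * 'X^(al t).

Let r : F := 1 - \sum_(t | e t == 0%N) w t.

Let q := fix q k j : {poly F} := if k is k'.+1 then smul (q k') j - p k'.+1 j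
  else if j is 0 then r%:P else 0.

Let coef_p l i j : (p l j)`_i = \sum_(t | [&& ga t == j, e t == l & al t == i]) w t.
Proof.
rewrite /p coef_sum [RHS]big_mkcond [LHS]big_mkcond; apply: eq_bigr => t _.
rewrite coefCM coefXn; case: (ga t == j) => //=; case: (e t == l) => //=.
by rewrite eq_sym; case: eqP; rewrite ?mulr1 ?mulr0.
Qed.

(** At the point with all coordinates 1/3 every monomial is positive, so the one of degree [d > 0]
    keeps the constant part strictly below 1. *)
Let r_neq0 : r != 0.
Proof.
have third : 0 <= (3%:R : F)^-1 by rewrite invr_ge0 ler0n.
have e3 : (3%:R : F)^-1 + 3%:R^-1 + 3%:R^-1 = 1 by field.
have := sphere third third third e3; rewrite (bigID (fun t => e t == 0%N)) /= => s1.
rewrite /r -s1 (eq_bigr w) => [|t e0]; last first.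
  have [-> -> ->] : [/\ al t = 0, be t = 0 & ga t = 0]%N by move: e0; rewrite /e; split; lia.
  by rewrite !expr0 !mulr1.
rewrite addrAC subrr add0r; have [t0 wt0 et0] := e_max.
have pos t : 0 <= w t * (3^-1 ^+ al t * 3^-1 ^+ be t * 3^-1 ^+ ga t).
  by rewrite mulr_ge0 // !mulr_ge0 // exprn_ge0.
rewrite psumr_neq0 //; apply/hasP; exists t0; first exact: mem_index_enum.
rewrite et0 -lt0n d_gt0 /= lt_neqAle pos andbT eq_sym.
by rewrite !mulf_neq0 // expf_neq0 // invr_neq0 // pnatr_eq0.
Qed.

Let ev n (f : nat -> {poly F}) x z := \sum_(j < n) (f j).[x] * z ^+ j.

Let supp_p l : supported (p l) 0 0 0 l.
Proof.
move=> i j; rewrite coef_p; apply: contraNT => h; apply/eqP; apply: big_pred0 => t.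
by apply/negP => /and3P[/eqP h1 /eqP h2 /eqP h3]; move: h; rewrite /in_tri -h1 -h2 -h3 /e; lia.
Qed.

Let supp_q0 : supported (q 0%N) 0 0 0 0.
Proof.
by move=> i [|j] /=; rewrite ?coef0 ?eqxx // coefC; case: i => [|i] /=; rewrite ?eqxx.
Qed.

Let supp_q k : supported (q k) 0 0 0 k.
Proof.
elim: k => [|k IH] i j; first exact: supp_q0.
rewrite /= coefB; case: (eqVneq (p k.+1 j)`_i 0) => [->|/supp_p //].
by rewrite subr0 => /(supported_smul IH).
Qed.

Let ev_smul k x z : ev k.+2 (smul (q k)) x z = (1 + x + z) * ev k.+1 (q k) x z.
Proof.
have q0 : q k k.+1 = 0.
  apply/polyP => i; rewrite coef0; apply/eqP; apply: contraT => /supp_q.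
  by rewrite /in_tri; lia.
rewrite /ev /smul (eq_bigr (fun j : 'I_k.+2 => (1 + x) * ((q k j).[x] * z ^+ j) +
    (if nat_of_ord j is j'.+1 then (q k j').[x] else 0) * z ^+ j)) => [|j _]; last first.
  rewrite hornerD hornerM hornerD hornerC hornerX mulrDl mulrA; congr (_ + _ * _).
  by case: (nat_of_ord j) => [|j']; rewrite ?horner0.
rewrite big_split /= -mulr_sumr big_ord_recr /= q0 horner0 mul0r addr0 [RHS]mulrDl; congr (_ + _).
rewrite big_ord_recl mul0r add0r mulr_sumr; apply: eq_bigr => j _ /=.
by rewrite /bump /= add1n exprS mulrCA.
Qed.

Let ev_p l x z : ev l.+1 (p l) x z = \sum_(t | e t == l) w t * (x ^+ al t * z ^+ ga t).
Proof.
rewrite /ev /p (eq_bigr (fun j : 'I_l.+1 => \sum_(t | e t == l)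
    (if ga t == j then w t * (x ^+ al t * z ^+ ga t) else 0))) => [|j _]; last first.
  rewrite horner_sum mulr_suml -big_mkcondr /=; apply: eq_big => [t|t /andP[/eqP <- _]].
    by rewrite andbC.
  by rewrite hornerM hornerC hornerXn mulrA.
rewrite exchange_big /=; apply: eq_bigr => t /eqP et.
have gt : (ga t < l.+1)%N by rewrite -et /e; lia.
by rewrite -big_mkcond (big_pred1 (Ordinal gt)).
Qed.

(** Unrolls the recursion, with [y = 1]: [q k] is [s^k] minus the parts of degree at most [k], each
    raised to degree [k] by a power of [s]. *)
Let ev_q k x z : ev k.+1 (q k) x z = (1 + x + z) ^+ k -
  \sum_(t | (e t <= k)%N) w t * (x ^+ al t * z ^+ ga t) * (1 + x + z) ^+ (k - e t).
Proof.
elim: k => [|k IH].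
  rewrite /ev big_ord1 /= hornerC mulr1 expr0 /r; congr (_ - _); apply: eq_big => t.
    by rewrite leqn0.
  move=> e0; have [-> ->] : (al t = 0 /\ ga t = 0)%N by move: e0; rewrite /e; lia.
  by rewrite !expr0 !mulr1.
have -> : ev k.+2 (q k.+1) x z = ev k.+2 (smul (q k)) x z - ev k.+2 (p k.+1) x z.
  rewrite /ev -sumrB; apply: eq_bigr => j _; by rewrite /= hornerD hornerN mulrBl.
rewrite ev_smul ev_p IH mulrBr -exprS -addrA -opprD; congr (_ - _).
rewrite [RHS](bigID (fun t => e t == k.+1)) /= [LHS]addrC; congr (_ + _).
  apply: eq_big => t; first by case: eqP => [->|_]; rewrite ?leqnn ?andbF.
  by move=> /eqP ->; rewrite subnn mulr1.
rewrite mulr_sumr; apply: eq_big => t; first by lia.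
by move=> h; rewrite mulrCA -exprS subSn.
Qed.

(** The point [(x, 1, z)] divided by its sum [s] lies on the simplex, and [s^d] times the identity
    there says that [q d] vanishes at [(x, z)]. Natural values of [x] and [z] suffice to kill all
    coefficients. *)
Let qd j : q d j = 0.
Proof.
have ev0 x z : 0 <= x -> 0 <= z -> ev d.+1 (q d) x z = 0.
  move=> x0 z0; set s := 1 + x + z; have s0 : 0 < s by rewrite /s; lra.
  have sn := lt0r_neq0 s0; rewrite ev_q -/s; apply/eqP; rewrite subr_eq0; apply/eqP.
  have h : x / s + 1 / s + z / s = 1 by rewrite /s; field.
  have ds u : 0 <= u -> 0 <= u / s by move=> u0; rewrite divr_ge0 // ltW.
  have h1 := sphere (ds _ x0) (ds _ ler01) (ds _ z0) h.
  rewrite -[LHS]mulr1 -h1 mulr_sumr [RHS]big_mkcond; apply: eq_bigr => t _.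
  case: (leqP (e t) d) => et; last first.
    have -> : w t = 0 by apply/eqP; apply: contraTT et => /e_le; rewrite leqNgt.
    by rewrite mul0r mulr0.
  rewrite !expr_div_n expr1n -{1}(subnK et) exprD /e !exprD; field.
  by rewrite !expf_neq0.
case: (leqP j d) => jd; last first.
  apply/polyP => i; rewrite coef0; apply/eqP; apply: contraT => /supp_q.
  by rewrite /in_tri; lia.
apply: (poly_eq0_infinite (@natr_inj F)) => n.
have : \poly_(i < d.+1) (q d i).[n%:R] = 0.
  apply: (poly_eq0_infinite (@natr_inj F)) => m; rewrite horner_poly.
  exact: ev0 (ler0n _ _) (ler0n _ _).
by move=> /(congr1 (fun P : {poly F} => P`_j)); rewrite coef_poly ltnS jd coef0.
Qed.

(** Components may share monomials, so the monomials counted along the chain are at most as many as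
    the components. *)
Lemma sphere_degree_bound : (2 * d + 1 <= #|I|)%N.
Proof.
have H := @monomials_of_chain F p q d supp_q0.
apply: leq_trans (H _ _ _ supp_p qd _ d_gt0) _ => //.
- by exists 0%N, 0%N; rewrite /= coefC.
- by move=> k i j; rewrite coef_p sumr_ge0.
- have [t wt et] := e_max; exists (al t), (ga t); rewrite coef_p psumr_neq0 //.
  apply/hasP; exists t; first exact: mem_index_enum.
  by rewrite !eqxx et eqxx /= lt_neqAle eq_sym wt w_ge0.
have nzc_le k i j : (nzc (p k) i j <= \sum_t ((e t == k) && ((al t == i) && (ga t == j))))%N.
  rewrite /nzc coef_p; case: (boolP (_ == 0)) => //= h.
  rewrite lt0n; apply: contraNneq h => /eqP; rewrite sum_nat_eq0 => /forallP h.
  apply/eqP/big_pred0 => t; have := h t; case: (ga t == j); case: (e t == k); case: (al t == i) => //.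
rewrite -sum1_card.
apply: (@leq_trans (\sum_(1 <= k < d.+1) \sum_t (e t == k))); last first.
  by rewrite exchange_big; apply: leq_sum => t _; apply: sum_eq_le1.
apply: leq_sum => k _; apply: (@leq_trans (\sum_(0 <= i < k.+1) \sum_t (e t == k) * (al t == i))%N); last first.
  rewrite exchange_big; apply: leq_sum => t _ /=; rewrite -big_distrr /=.
  by rewrite -[X in (_ <= X)%N]muln1 leq_mul // sum_eq_le1.
apply: leq_sum => i _; apply: (@leq_trans (\sum_(0 <= j < k.+1) \sum_t (e t == k) * (al t == i) * (ga t == j))%N); last first.
  rewrite exchange_big; apply: leq_sum => t _ /=; rewrite -big_distrr /=.
  by rewrite -[X in (_ <= X)%N]muln1 leq_mul // sum_eq_le1.
apply: leq_sum => j _; apply: leq_trans (nzc_le k i j) _; apply: leq_sum => t _.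
by case: (e t == k); case: (al t == i); case: (ga t == j).
Qed.

End Sphere.

Lemma fold_max_spec (s : list nat) x :
  let v := fold_left Nat.max s x in
  [/\ (x <= v)%N, forall n, List.In n s -> (n <= v)%N & v = x \/ List.In v s].
Proof.
elim: s x => [|n s IH] x /=; first by split=> //; left.
have [h1 h2 h3] := IH (Nat.max x n).
have hm : Nat.max x n = maxn x n by lia.
rewrite hm in h1 h2 h3 *; split; first by rewrite (leq_trans _ h1) // leq_maxl.
  by move=> n' [<-|/h2 //]; rewrite (leq_trans _ h1) // leq_maxr.
case: h3 => [->|h]; last by right; right.
by rewrite /maxn; case: ifP => _; [right; left|left].
Qed.

Lemma poly_degree_bound N cf B : maps_S5_to_sphere N cf B ->
  le (2 * poly_deg N cf B + 1) N.
Proof.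
move=> maps; apply/ssrnat.leP; rewrite -[X in (_ <= X)%N]card_ord.
pose w (k : 'I_N) := Cnorm2 (cf k).
have sphere x y z : 0 <= x -> 0 <= y -> 0 <= z -> x + y + z = 1 ->
    \sum_k w k * (x ^+ B k 0%N * y ^+ B k 1%N * z ^+ B k 2%N) = 1.
  move=> x0 y0 z0 s1; pose X j := if j is j'.+1 then (if j' is 0%N then y else z) else x.
  have X0 j : 0 <= X j by case: j => [|[|j]].
  have := maps (rpoint X); rewrite !RsumE !big_ord_recl big_ord0 /= !Cnorm2_rpoint //= addr0 addrA.
  move=> /(_ s1) h; rewrite -[RHS]h; apply: eq_bigr => k _.
  rewrite Cnorm2_monomial !big_ord_recl big_ord0 /= !Cnorm2_rpoint //= mulr1.
  by rewrite -mulrA.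
set d := poly_deg N cf B; have e3 k : nsum 3 (B k) = (B k 0 + B k 1 + B k 2)%N by [].
have [_ dmax datt] := fold_max_spec (map (fun k => nsum 3 (B k)) (nz_idx N cf)) 0%N.
(* For [d = 0] the claim is [1 <= N], which holds because an empty sum is not 1. *)
have [d0|d0] := posnP d.
  rewrite d0 card_ord lt0n; apply/eqP => N0; have := sphere 1 0 0 ler01 (lexx _) (lexx _).
  rewrite !addr0 => /(_ erefl); rewrite big1 => [/eqP|k _]; first by rewrite eq_sym oner_eq0.
  by have := ltn_ord k; rewrite [X in (_ < X)%N]N0.
apply: (@sphere_degree_bound _ _ w (fun k => B k 0%N) (fun k => B k 1%N) (fun k => B k 2%N) d) => //.
- by move=> k; apply: Cnorm2_ge0.
- move=> k wk; rewrite -e3; apply: dmax; apply/in_map_iff; exists (nat_of_ord k); split=> //.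
  apply/filter_In; split; first by apply/in_seq; split; [exact/ssrnat.leP|apply/ssrnat.ltP; exact: ltn_ord].
  by rewrite CnzE.
case: datt => [h|/in_map_iff[k [h /filter_In[/in_seq[_ /ssrnat.ltP kN] nz]]]].
  by move: d0; rewrite /d /poly_deg h.
rewrite CnzE in nz; exists (Ordinal kN) => //; rewrite -e3; exact: h.
Qed.

End MonomialMaps.

Theorem theorem1p3 :
  (* (i) *)
  (forall (a b c e : nat) (Cf : nat -> CC) (A : nat -> nat -> nat),
     (1 <= a)%nat -> (a + b = 2)%nat -> (1 <= c)%nat ->
     is_monomial_CR_map a b c e Cf A ->
     lin_indep_components a b c e Cf A ->
     ~ monomial_decomposable a b c e Cf A ->
     (Z.of_nat (deg_CR a b c e Cf A) <= 2 * Z.of_nat (c + e) - 3)%Z)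
  /\
  (* (ii) *)
  (forall (N : nat) (cf : nat -> CC) (B : nat -> nat -> nat),
     maps_S5_to_sphere N cf B ->
     INR (poly_deg N cf B) <= (INR N - 1) / 2)
  /\
  (* (iii) *)
  (forall n N : nat, (2 <= n)%nat ->
     exists Cn : nat,
       forall (a b c e : nat) (Cf : nat -> CC) (A : nat -> nat -> nat),
         (1 <= a)%nat -> (a + b = n)%nat -> (1 <= c)%nat -> (c + e = N)%nat ->
         is_monomial_CR_map a b c e Cf A ->
         lin_indep_components a b c e Cf A ->
         ~ monomial_decomposable a b c e Cf A ->
         (deg_CR a b c e Cf A <= Cn)%nat).

Proof.
split; [|split].
- intros a b c e Cf A ha hab hc hCR hli hind.
  pose proof (MonomialMaps.CR_degree_bound_three ha hc hab hCR hli hind).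
  lia.
- intros N cf B h.
  pose proof (le_INR _ _ (MonomialMaps.poly_degree_bound h)) as hN.
  rewrite plus_INR, mult_INR in hN; simpl INR in hN; lra.
- intros n N hn; exists ((n + 1) * (2 * (N + 1)))%nat.
  intros a b c e Cf A ha hab hc hce hCR hli hind.
  rewrite <- hab in hn.
  pose proof (MonomialMaps.CR_degree_bound ha hn hCR hli hind) as h.
  rewrite <- hab, <- hce, !Nat.add_1_r; exact h.
Qed.
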